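(* Let $k$ be an algebraically closed field of characteristic $2$. Let $X\subset \mathbf{P}^n_k$ be a general smooth complete intersection of multidegree $(d_1,\dots,d_c)$ with $$2\le d_1\le \cdots \le d_c,\qquad c\ge 2,\qquad n-c\ge 1.$$ Assume $(d_1,\dots,d_c)\neq (2,2)$. Then $X$ admits no nontrivial linear automorphism of order $2$.
   Context: A complete intersection of multidegree $(d_1,\dots,d_c)$ in $\mathbf{P}^n_k$ is a closed subscheme of codimension $c$ whose homogeneous ideal is generated by forms $F_1,\dots,F_c$ with $\deg F_i=d_i$. A linear automorphism of $X$ is an automorphism of $X$ induced by a projective linear transformation $h$ of $\mathbf{P}^n$ with $h(X)=X$. ''General'' means: let $T^\circ$ be the (irreducible) parameter space of smooth complete intersections in $\mathbf{P}^n_k$ of the given multidegree; there is a nonempty Zariski open subset of $T^\circ$ such that the assertion holds for every $X$ in it. Equivalently, the assertion holds for $X=V(F_1,\dots,F_c)$ for all $(F_1,\dots,F_c)$ in a nonempty Zariski open subset of the affine space of $c$-tuples of forms of degrees $d_1,\dots,d_c$ in $n+1$ variables. *)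

(* Defs.v *)
From mathcomp Require Import all_boot all_order all_algebra.
From mathcomp Require Export mpoly.

Set Implicit Arguments.
Unset Strict Implicit.
Unset Printing Implicit Defensive.

Import GRing.Theory.
Local Open Scope ring_scope.

(* The affine space of c-tuples of forms of degrees d_1, ..., d_c in n+1
   variables over k. *)
Definition form_tuple (k : closedFieldType) (n c : nat) (d : c.-tuple nat) :=
  forall i : 'I_c, dhomog n.+1 k (tnth d i).

Section FormSpace.
Variables (k : closedFieldType) (n c : nat) (d : c.-tuple nat).

(* Pairs (i, m) with m a monomial of degree d_i: these index the coefficients
   of a c-tuple of forms, i.e. the coordinates of the affine space. *)
Definition coef_index : finType :=
  {i : 'I_c & {m : 'X_{1..n.+1 < (tnth d i).+1} | mdeg m == tnth d i}}.

Definition form_coef (F : form_tuple k n d) (s : coef_index) : k :=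
  (mpoly_of_dhomog (F (tag s)))@_(val (tagged s)).

Definition coef_eval (F : form_tuple k n d) (P : {mpoly k[#|coef_index|]}) : k :=
  P.@[fun j => form_coef F (enum_val j)].

Definition zariski_closed (Z : form_tuple k n d -> Prop) : Prop :=
  exists S : {mpoly k[#|coef_index|]} -> Prop,
    forall F, Z F <-> (forall P, S P -> coef_eval F P = 0).

Definition zariski_open (U : form_tuple k n d -> Prop) : Prop :=
  exists2 Z, zariski_closed Z & forall F, U F <-> ~ Z F.

End FormSpace.

Section Subscheme.
Variables (k : closedFieldType) (n c : nat) (d : c.-tuple nat).
Variable F : form_tuple k n d.

Definition in_ideal (p : {mpoly k[n.+1]}) : Prop :=
  exists a : 'I_c -> {mpoly k[n.+1]},
    p = \sum_(i < c) a i * mpoly_of_dhomog (F i).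

(* Homogeneous coordinate vectors of the k-points of X = V(F_1, ..., F_c). *)
Definition point_of (x : 'cV[k]_n.+1) : Prop :=
  x != 0 /\ forall i, (mpoly_of_dhomog (F i)).@[fun j => x j 0] = 0.

Definition jacobian (x : 'cV[k]_n.+1) : 'M[k]_(c, n.+1) :=
  \matrix_(i, j) (mpoly_of_dhomog (F i))^`M(j).@[fun l => x l 0].

(* By the Jacobian criterion, X is smooth of codimension c at every point.
   When c < n, X is then reduced and its homogeneous ideal is (F_1, ..., F_c). *)
Definition smooth_complete_intersection : Prop :=
  forall x, point_of x -> \rank (jacobian x) = c.

End Subscheme.

(* The polynomial p(h x). *)
Definition pullback (k : closedFieldType) (n : nat) (h : 'M[k]_n.+1)
    (p : {mpoly k[n.+1]}) : {mpoly k[n.+1]} :=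
  p \mPo [tuple \sum_(j < n.+1) h i j *: 'X_j | i < n.+1].

Section LinearAutomorphism.
Variables (k : closedFieldType) (n c : nat) (d : c.-tuple nat).
Variables (F : form_tuple k n d) (h : 'M[k]_n.+1).

(* The class of h in PGL_{n+1}(k) satisfies h(X) = X as an equality of closed
   subschemes, i.e. of homogeneous ideals. *)
Definition linear_automorphism : Prop :=
  h \in unitmx /\ forall p, in_ideal F p <-> in_ideal F (pullback h p).

(* Since X is reduced and k is algebraically closed, an automorphism of X is
   the identity as soon as it fixes all k-points. *)
Definition acts_trivially (g : 'M[k]_n.+1) : Prop :=
  forall x, point_of F x -> exists2 a : k, a != 0 & g *m x = a *: x.

(* The order of the automorphism of X induced by h. *)
Definition induced_order (m : nat) : Prop :=
  [/\ (0 < m)%N, acts_trivially (h ^+ m)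
    & forall j : nat, (0 < j < m)%N -> ~ acts_trivially (h ^+ j)].

End LinearAutomorphism.

(* Main.v *)
Require Import Defs.
From mathcomp Require Import all_boot all_order all_algebra zify ring.
From Stdlib Require Import ClassicalEpsilon.
From Stdlib Require List.

(** Let [h] be a linear automorphism of order 2 of a general X.

    The automorphism [h ^ 2] fixes every point of X. A general X contains
    n + 2 points in general position: cut it with n + 2 linear spaces of
    codimension n - c ([section_point], [dependent_thin]). They are
    eigenvectors of [h ^ 2], so [h ^ 2] is a scalar matrix ([frame_scalar]), and
    in characteristic 2, after rescaling, [h = 1 + N] with [N ^ 2 = 0] and
    [N <> 0] ([involution_normal_form]).

    The rest is a dimension count. Let r be the rank of N and
    a = r (n + 1 - r); the matrices N form a family of dimension 2 a
    ([adjoins_sqz]). Write D f for f o h - f. As h preserves the ideal of X,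
    each D F_i is a combination of the F_j with d_j <= d_i. Once N, the
    coefficients and the other forms are known, this is a linear system for F_i.
    In suitable coordinates h permutes the variables ([sqz_normal]), and the
    rank of the system is the number of two-element orbits of monomials of
    degree d_i: at least a for quadrics and at least 2 a + 1 in higher degree
    ([swap_orbits_quadric], [swap_orbits_cubic]). Smoothness implies that
    constant coefficients of a relation among the F_j vanish
    ([relation_vanish]), so h acts on the forms of lowest degree by a matrix
    1 + B with [B ^ 2 = 0] ([diag_block_sqz]); the parameters of B are
    compensated by the forms which the equation D F = B F determines from the
    others ([block_chart_thin]). This count excludes an involution in all cases
    but two, both with lowest degree 2.

    One quadric Q, fixed by h: some combination G of the forms of the next
    degree satisfies D G = A Q with D A = 0. The conditions on Q, G and A
    together exceed the number of parameters ([swap_orbits_pair],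
    [quadric_thin]).

    Two quadrics, both fixed by h: they give exactly 2 a conditions. As (2, 2)
    is excluded there is a form of higher degree, and a point p of the frame
    that is moved by h supplies the missing conditions: the quadrics vanish at
    p, and the last form vanishes at p and at h p ([pencil_thin]).

    Dimensions are measured by Hilbert functions. A family is a predicate Z on
    a type of parameters, and [dimle Z X M] bounds by O(D ^ M) the dimension of
    the space of functions on Z that are polynomials of degree D in the
    functions X. A family of tuples whose coefficients are polynomials in
    functions of dimension less than the number of coefficients satisfies a
    nontrivial algebraic equation ([dimle_vanish], [thin_family]). Unknowns that
    solve a linear system of rank rho count for rho less ([dimle_linear]). The
    same notion of dimension, with the Nullstellensatz, provides the points on
    the linear sections ([projective_dimension]). *)

Set Implicit Arguments.
Unset Strict Implicit.
Unset Printing Implicit Defensive.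
Import GRing.Theory.
Local Open Scope ring_scope.

(** * Dimension of families of functions *)

Section Dimension.
Variables (k : fieldType) (T : Type).
Implicit Types (Z : T -> Prop) (X Y : seq (T -> k)) (f g : T -> k).

(** The functions of t that agree on Z with a polynomial of degree at most D
    in the functions of X. An inductive predicate spares the polynomial ring on
    the variable list X; [pf_ext] makes values outside Z irrelevant. *)
Inductive pf Z X : nat -> (T -> k) -> Prop :=
| pf_const D c : pf Z X D (fun=> c)
| pf_var D f : List.In f X -> pf Z X D.+1 f
| pf_add D f g : pf Z X D f -> pf Z X D g -> pf Z X D (fun t => f t + g t)
| pf_mul D E f g :
    pf Z X D f -> pf Z X E g -> pf Z X (D + E) (fun t => f t * g t)
| pf_ext D f g : pf Z X D f -> (forall t, Z t -> f t = g t) -> pf Z X D g.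

Definition spanned Z (P : (T -> k) -> Prop) (B : nat) : Prop :=
  exists (J : finType) (g : J -> T -> k), (#|J| <= B)%N /\
    forall f, P f -> exists c : J -> k, forall t, Z t -> f t = \sum_j c j * g j t.

(** The Hilbert-function form of: the image of Z under the functions of X has
    dimension at most M. It requires neither closures nor irreducibility. *)
Definition dimle Z X (M : nat) : Prop :=
  exists C, forall D, spanned Z (pf Z X D) (C * D.+1 ^ M).

Definition pfun Z X f := exists D, pf Z X D f.

Lemma pf_leq Z X D E f : (D <= E)%N -> pf Z X D f -> pf Z X E f.
Proof.
move=> le_DE pff; elim: pff E le_DE => {D f}.
- by move=> D c E _; apply: pf_const.
- by move=> D f fX [//|E] _; apply: pf_var.
- by move=> D f g _ IHf _ IHg E le_DE; apply: pf_add; [apply: IHf|apply: IHg].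
- move=> D1 D2 f g pff _ _ IHg E le_DE.
  rewrite -(subnKC (leq_trans (leq_addr D2 D1) le_DE)).
  by apply: pf_mul => //; apply: IHg; rewrite leq_subRL // (leq_trans _ le_DE) ?leq_addr.
- by move=> D f g _ IHf eq_fg E /IHf/pf_ext; apply.
Qed.

Lemma pf_sub Z Z' X X' D f : (forall t, Z' t -> Z t) ->
  (forall g, List.In g X -> List.In g X') -> pf Z X D f -> pf Z' X' D f.
Proof.
move=> sZ sX; elim=> {D f}.
- by move=> D c; apply: pf_const.
- by move=> D f /sX; apply: pf_var.
- by move=> D f g _ pff _; apply: pf_add.
- by move=> D E f g _ pff _; apply: pf_mul.
- by move=> D f g _ pff eq_fg; apply: (pf_ext pff) => t /sZ/eq_fg.
Qed.

Lemma pf_sum Z X D (I : Type) (r : seq I) (P : pred I) (F : I -> T -> k) :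
  (forall i, P i -> pf Z X D (F i)) -> pf Z X D (fun t => \sum_(i <- r | P i) F i t).
Proof.
move=> pfF; elim: r => [|i r IHr].
  by apply: (pf_ext (pf_const Z X D 0)) => t _; rewrite big_nil.
have [Pi|nPi] := boolP (P i).
  by apply: (pf_ext (pf_add (pfF i Pi) IHr)) => t _; rewrite big_cons Pi.
by apply: (pf_ext IHr) => t _; rewrite big_cons (negPf nPi).
Qed.

Lemma pf_exp Z X D f i : pf Z X D f -> pf Z X (D * i) (fun t => f t ^+ i).
Proof.
move=> pff; elim: i => [|i IHi]; first exact: (pf_ext (pf_const _ _ _ 1)).
by rewrite mulnS; apply: (pf_ext (pf_mul pff IHi)) => t _; rewrite exprS.
Qed.

Lemma pfun_const Z X c : pfun Z X (fun=> c).
Proof. by exists 0%N; apply: pf_const. Qed.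

Lemma pfun_var Z X f : List.In f X -> pfun Z X f.
Proof. by exists 1%N; apply: pf_var. Qed.

Lemma pfun_ext Z X f g : pfun Z X f -> (forall t, Z t -> f t = g t) -> pfun Z X g.
Proof. by case=> D pff eq_fg; exists D; apply: pf_ext pff _. Qed.

Lemma pfun_add Z X f g : pfun Z X f -> pfun Z X g -> pfun Z X (fun t => f t + g t).
Proof.
move=> [D pff] [E pfg]; exists (maxn D E).
by apply: pf_add; [apply: pf_leq pff|apply: pf_leq pfg]; rewrite ?leq_maxl ?leq_maxr.
Qed.

Lemma pfun_mul Z X f g : pfun Z X f -> pfun Z X g -> pfun Z X (fun t => f t * g t).
Proof. by move=> [D pff] [E pfg]; exists (D + E)%N; apply: pf_mul. Qed.

Lemma pfun_opp Z X f : pfun Z X f -> pfun Z X (fun t => - f t).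
Proof.
move=> pff; apply: (pfun_ext (pfun_mul (pfun_const Z X (-1)) pff)) => t _.
by rewrite mulN1r.
Qed.

Lemma pfun_sub Z X f g : pfun Z X f -> pfun Z X g -> pfun Z X (fun t => f t - g t).
Proof. by move=> pff /pfun_opp; apply: pfun_add. Qed.

Lemma pfun_sum Z X (I : eqType) (r : seq I) (P : pred I) (F : I -> T -> k) :
  (forall i, i \in r -> P i -> pfun Z X (F i)) ->
  pfun Z X (fun t => \sum_(i <- r | P i) F i t).
Proof.
elim: r => [_|i r IHr pfF].
  by apply: (pfun_ext (pfun_const Z X 0)) => t _; rewrite big_nil.
have pfr: pfun Z X (fun t => \sum_(i <- r | P i) F i t).
  by apply: IHr => j jr; apply: pfF; rewrite inE jr orbT.
have [Pi|nPi] := boolP (P i).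
  have pfi: pfun Z X (F i) by apply: pfF; rewrite ?inE ?eqxx.
  by apply: (pfun_ext (pfun_add pfi pfr)) => t _; rewrite big_cons Pi.
by apply: (pfun_ext pfr) => t _; rewrite big_cons (negPf nPi).
Qed.

Lemma pfun_prod Z X (I : eqType) (r : seq I) (P : pred I) (F : I -> T -> k) :
  (forall i, i \in r -> P i -> pfun Z X (F i)) ->
  pfun Z X (fun t => \prod_(i <- r | P i) F i t).
Proof.
elim: r => [_|i r IHr pfF].
  by apply: (pfun_ext (pfun_const Z X 1)) => t _; rewrite big_nil.
have pfr: pfun Z X (fun t => \prod_(i <- r | P i) F i t).
  by apply: IHr => j jr; apply: pfF; rewrite inE jr orbT.
have [Pi|nPi] := boolP (P i).
  have pfi: pfun Z X (F i) by apply: pfF; rewrite ?inE ?eqxx.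
  by apply: (pfun_ext (pfun_mul pfi pfr)) => t _; rewrite big_cons Pi.
by apply: (pfun_ext pfr) => t _; rewrite big_cons (negPf nPi).
Qed.

Lemma pfun_exp Z X f i : pfun Z X f -> pfun Z X (fun t => f t ^+ i).
Proof. by case=> D pff; exists (D * i)%N; apply: pf_exp. Qed.

Lemma pfun_det Z X m (A : T -> 'M[k]_m) :
  (forall i j, pfun Z X (fun t => A t i j)) -> pfun Z X (fun t => \det (A t)).
Proof.
move=> polyA; apply: pfun_sum => s _ _; apply: pfun_mul; first exact: pfun_const.
by apply: pfun_prod => i _ _.
Qed.

Lemma pfun_sub_dom Z Z' X X' f : (forall t, Z' t -> Z t) ->
  (forall g, List.In g X -> List.In g X') -> pfun Z X f -> pfun Z' X' f.
Proof. by move=> sZ sX [D pff]; exists D; apply: pf_sub pff. Qed.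

Lemma pfun_unif Z X Y (q : T -> k) : (forall y, List.In y Y -> pfun Z X (fun t => q t * y t)) ->
  exists D, forall y, List.In y Y -> pf Z X D (fun t => q t * y t).
Proof.
elim: Y => [_|y Y IHY pY]; first by exists 0%N.
have [|D1 pD1] := IHY; first by move=> z zY; apply: pY; right.
have [|D2 pD2] := pY y; first by left.
exists (maxn D1 D2) => z [<-|/pD1]; first by apply: pf_leq pD2; rewrite leq_maxr.
by apply: pf_leq; rewrite leq_maxl.
Qed.

Lemma dimle0 Z : dimle Z [::] 0.
Proof.
exists 1%N => D; exists unit, (fun _ _ => 1); split; first by rewrite card_unit.
move=> f pff; suff [c cE]: exists c, forall t, Z t -> f t = c.
  by exists (fun=> c) => t /cE ->; rewrite big_const card_unit /= mulr1 addr0.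
elim: pff => {D f} [D c|//|D f g _ [a fE] _ [b gE]|D E f g _ [a fE] _ [b gE]|D f g _ [a fE] fg].
- by exists c.
- by exists (a + b) => t Zt; rewrite fE ?gE.
- by exists (a * b) => t Zt; rewrite fE ?gE.
- by exists a => t Zt; rewrite -fg ?fE.
Qed.

Lemma dimle_leq Z X M M' : (M <= M')%N -> dimle Z X M -> dimle Z X M'.
Proof.
move=> le_MM' [C dimC]; exists C => D; have [J [g [leJ gP]]] := dimC D.
exists J, g; split=> //; apply: leq_trans leJ _.
by rewrite leq_mul2l leq_pexp2l ?orbT.
Qed.

Lemma pf_cons Z X v D f : pf Z (v :: X) D f ->
  exists a : nat -> T -> k, (forall i, pf Z X D (a i)) /\
    forall t, Z t -> f t = \sum_(i < D.+1) a i t * v t ^+ i.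
Proof.
elim=> {D f} [D c|D f [->|fX]|D f g _ [a [pa fE]] _ [b [pb gE]]
             |D E f g _ [a [pa fE]] _ [b [pb gE]]|D f g _ [a [pa fE]] fg].
- exists (fun i _ => if i is 0%N then c else 0); split=> [[|i]|t _]; try exact: pf_const.
  by rewrite big_ord_recl big1 //= ?expr0 ?mulr1 ?addr0 // => i _; rewrite mul0r.
- exists (fun i _ => if i is 1%N then 1 else 0); split=> [[|[|i]]|t _]; try exact: pf_const.
  rewrite !big_ord_recl big1 //= ?expr1 ?mul0r ?mul1r ?addr0 ?add0r // => i _.
  by rewrite mul0r.
- exists (fun i t => if i is 0%N then f t else 0); split=> [[|i]|t _].
  + exact: pf_var.
  + exact: pf_const.
  by rewrite big_ord_recl big1 //= ?expr0 ?mulr1 ?addr0 // => i _; rewrite mul0r.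
- exists (fun i t => a i t + b i t); split=> [i|t Zt]; first exact: pf_add.
  by rewrite fE // gE // -big_split /=; apply: eq_bigr => i _; rewrite mulrDl.
- exists (fun l t => \sum_(i < D.+1) \sum_(j < E.+1 | (i + j == l)%N) a i t * b j t).
  split=> [l|t Zt]; first by do 2!apply: pf_sum => ? _; apply: pf_mul.
  rewrite fE // gE // mulr_suml; under [RHS]eq_bigr do rewrite mulr_suml.
  rewrite exchange_big /=; apply: eq_bigr => i _; rewrite mulr_sumr.
  under [RHS]eq_bigr do rewrite mulr_suml.
  rewrite (exchange_big_dep xpredT) //=; apply: eq_bigr => j _.
  have lt_ij: (i + j < (D + E).+1)%N by rewrite ltnS leq_add // -ltnS ltn_ord.
  rewrite (eq_bigl (pred1 (Ordinal lt_ij))); last by move=> l; rewrite /= -val_eqE /= eq_sym.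
  by rewrite big_pred1_eq /= exprD mulrACA.
- by exists a; split=> // t Zt; rewrite -fg ?fE.
Qed.

(** Expanding in powers of the new function, with D + 1 possible exponents,
    costs one factor D + 1. *)
Lemma dimle_cons Z X v M : dimle Z X M -> dimle Z (v :: X) M.+1.
Proof.
case=> C dimC; exists C => D; have [J [g [leJ gP]]] := dimC D.
exists ('I_D.+1 * J)%type, (fun (p : 'I_D.+1 * J) t => g p.2 t * v t ^+ p.1); split.
  by rewrite card_prod card_ord expnS mulnCA leq_mul2l leJ orbT.
move=> f /pf_cons[a [pa fE]].
have /fin_all_exists[c cP] (i : 'I_D.+1) : exists c : J -> k, forall t, Z t -> a i t = \sum_j c j * g j t.
  by apply: gP.
exists (fun p : 'I_D.+1 * J => c p.1 p.2) => t Zt.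
rewrite fE // -(pair_bigA _ (fun i j => c i j * (g j t * v t ^+ i))) /=.
apply: eq_bigr => i _; rewrite cP // mulr_suml; apply: eq_bigr => j _.
by rewrite mulrA.
Qed.

Lemma dimle_cat Z X Y M : dimle Z X M -> dimle Z (Y ++ X) (M + size Y).
Proof.
by move=> dX; elim: Y => [|y Y IHY]; rewrite ?addn0 ?addnS //=; apply: dimle_cons.
Qed.

(** Functions with a common denominator q: multiplying a polynomial of degree
    D in Y by q ^ D gives a polynomial in X of degree O(D), so that the
    dimension of X bounds that of Y. *)
Lemma dimle_loc Z X Y q M : dimle Z X M -> pfun Z X q ->
  (forall t, Z t -> q t != 0) ->
  (forall y, List.In y Y -> pfun Z X (fun t => q t * y t)) -> dimle Z Y M.
Proof.
move=> [C dimC] [e1 pq] q_neq0 /pfun_unif[e2 pqY].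
pose e := maxn e1 e2.
have {pq}pq: pf Z X e q by apply: pf_leq pq; rewrite leq_maxl.
have {pqY}pqY y : List.In y Y -> pf Z X e (fun t => q t * y t).
  by move/pqY; apply: pf_leq; rewrite leq_maxr.
have pfq D f : pf Z Y D f -> pf Z X (e * D) (fun t => q t ^+ D * f t).
  elim=> {D f} [D c|D f fY|D f g _ pff _ pfg|D E f g _ pff _ pfg|D f g _ pff fg].
  - by rewrite -[(e * D)%N]addn0; apply: pf_mul (pf_const _ _ _ _); apply: pf_exp.
  - rewrite mulnSr; apply: (pf_ext (pf_mul (pf_exp D pq) (pqY _ fY))) => t _.
    by rewrite exprSr mulrA.
  - by apply: (pf_ext (pf_add pff pfg)) => t _; rewrite mulrDr.
  - by rewrite mulnDr; apply: (pf_ext (pf_mul pff pfg)) => t _; rewrite exprD mulrACA.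
  - by apply: (pf_ext pff) => t Zt; rewrite fg.
exists (C * e.+1 ^ M)%N => D; have [J [g [leJ gP]]] := dimC (e * D)%N.
exists J, (fun j t => g j t / q t ^+ D); split.
  apply: leq_trans leJ _; rewrite -mulnA leq_mul2l -expnMn; apply/orP; right.
  have le_eD: ((e * D).+1 <= e.+1 * D.+1)%N.
    by rewrite mulSn mulnS addnC -addn1 leq_add // leq_addl.
  by case: (posnP M) => [->//|M_gt0]; rewrite leq_exp2r.
move=> f /pfq/gP[c cP]; exists c => t Zt.
have qD: q t ^+ D != 0 by rewrite expf_neq0 ?q_neq0.
apply: (mulfI qD); rewrite cP // mulr_sumr; apply: eq_bigr => j _.
by rewrite mulrCA [_ * (_ / _)]mulrC divfK.
Qed.
End Dimension.

Section Strata.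
Variables (k : fieldType) (T : Type).
Implicit Types (Z : T -> Prop) (X Y : seq (T -> k)) (f g : T -> k).

(** Restricting Z enlarges the class of functions by [pf_ext] only: each of
    them still has a representative that is polynomial on the larger domain. *)
Lemma pf_extend Z Z' X D f : pf Z' X D f ->
  exists g, pf Z X D g /\ forall t, Z' t -> f t = g t.
Proof.
elim=> {D f} [D c|D f fX|D f g _ [a [pa fE]] _ [b [pb gE]]
             |D E f g _ [a [pa fE]] _ [b [pb gE]]|D f g _ [a [pa fE]] fg].
- by exists (fun=> c); split=> //; apply: pf_const.
- by exists f; split=> //; apply: pf_var.
- by exists (fun t => a t + b t); split=> [|t Zt]; [apply: pf_add|rewrite fE ?gE].
- by exists (fun t => a t * b t); split=> [|t Zt]; [apply: pf_mul|rewrite fE ?gE].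
- by exists a; split=> // t Zt; rewrite -fg ?fE.
Qed.

Lemma dimle_dom Z Z' X M : (forall t, Z' t -> Z t) -> dimle Z X M -> dimle Z' X M.
Proof.
move=> sZ [C dimC]; exists C => D; have [J [g [leJ gP]]] := dimC D.
exists J, g; split=> // f /(pf_extend Z)[f' [/gP[c cE] fE]].
by exists c => t Zt; rewrite fE // cE //; apply: sZ.
Qed.

(** A function on a union is determined by its restrictions to the two parts;
    the two spanning families are extended by zero. *)
Lemma dimle_split Z (P1 P2 : T -> Prop) X M : (forall t, Z t -> P1 t \/ P2 t) ->
  dimle (fun t => Z t /\ P1 t) X M -> dimle (fun t => Z t /\ P2 t) X M ->
  dimle Z X M.
Proof.
move=> covZ [C1 dim1] [C2 dim2]; exists (C1 + C2)%N => D.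
have [J1 [g1 [leJ1 gP1]]] := dim1 D; have [J2 [g2 [leJ2 gP2]]] := dim2 D.
pose in1 t := if excluded_middle_informative (P1 t) then true else false.
pose g (j : J1 + J2) t : k :=
  match j with inl j1 => if in1 t then g1 j1 t else 0
             | inr j2 => if in1 t then 0 else g2 j2 t end.
exists (J1 + J2)%type, g; split; first by rewrite card_sum mulnDl leq_add.
move=> f pff.
have [|c1 c1E] := gP1 f; first by apply: pf_sub pff => // t [].
have [|c2 c2E] := gP2 f; first by apply: pf_sub pff => // t [].
exists (fun j => match j with inl j1 => c1 j1 | inr j2 => c2 j2 end) => t Zt.
rewrite big_sumType /= /in1; case: excluded_middle_informative => P1t /=.
  by rewrite [X in _ + X]big1 ?addr0 ?c1E // => j _; rewrite mulr0.
rewrite big1 ?add0r ?c2E // => [|j _]; last by rewrite mulr0.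
by split=> //; case: (covZ t Zt).
Qed.

Lemma dimle_void Z X M : (forall t, ~ Z t) -> dimle Z X M.
Proof.
move=> Z0; exists 1%N => D; exists void, (fun _ _ => 0); split.
  by rewrite card_void.
by move=> f _; exists (fun=> 0) => t /Z0.
Qed.

Lemma dimle_strata Z (L : finType) (P : L -> T -> Prop) X M :
  (forall t, Z t -> exists l, P l t) ->
  (forall l, dimle (fun t => Z t /\ P l t) X M) -> dimle Z X M.
Proof.
move=> covZ dimP.
suff dims (s : seq L) : dimle (fun t => Z t /\ exists2 l, l \in s & P l t) X M.
  apply: dimle_dom (dims (enum L)) => t Zt; split=> //.
  by have [l Pl] := covZ t Zt; exists l; rewrite ?mem_enum.
elim: s => [|l s IHs]; first by apply: dimle_void => t [_ []].
apply: (@dimle_split _ (P l) (fun t => exists2 l, l \in s & P l t)).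
- move=> t [_ [l']]; rewrite inE => /predU1P[->|l's] Pl'; first by left.
  by right; exists l'.
- by apply: dimle_dom (dimP l) => t [[]].
- by apply: dimle_dom IHs => t [[]].
Qed.

Lemma dimle_poly Z X Y M : dimle Z X M ->
  (forall y, List.In y Y -> pfun Z X y) -> dimle Z Y M.
Proof.
move=> dX pY; apply: (dimle_loc (q := fun=> 1) dX); first exact: pfun_const.
  by move=> t _; apply: oner_neq0.
by move=> y /pY py; apply: (pfun_ext py) => t _; rewrite mul1r.
Qed.

(** For M < N, the monomials in N functions with all exponents at most E
    outnumber the dimension of the polynomials of degree N E. *)
Lemma growth C N M : (M < N)%N ->
  exists E, (C * (N * E).+1 ^ M < E.+1 ^ N)%N.
Proof.
move=> ltMN; exists (C * N ^ M)%N; set E := (C * N ^ M)%N.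
have N_gt0: (0 < N)%N by apply: leq_ltn_trans ltMN.
have leE: ((N * E).+1 <= N * E.+1)%N by rewrite mulnS -addn1 addnC leq_add2r.
apply: (@leq_ltn_trans (C * (N * E.+1) ^ M)).
  rewrite leq_mul2l; apply/orP; right.
  by case: (posnP M) => [->//|M0]; rewrite leq_exp2r.
rewrite expnMn mulnA -/E; apply: (@leq_trans (E.+1 ^ M.+1)).
  by rewrite expnS ltn_mul2r expn_gt0 ltnSn.
by rewrite leq_pexp2l.
Qed.

(** More functions than dimensions satisfy an algebraic relation: by [growth],
    their monomials with exponents at most E lie in a space of dimension less
    than the number of these monomials. *)
Lemma dimle_vanish Z X M (I : finType) (x : I -> T -> k) :
  dimle Z X M -> (forall i, pfun Z X (x i)) -> (M < #|I|)%N ->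
  exists P : {mpoly k[#|I|]}, P != 0 /\
    forall t, Z t -> P.@[fun i => x (enum_val i) t] = 0.
Proof.
move=> dX px ltM.
have [C dimC] : dimle Z [seq x i | i <- enum I] M.
  apply: dimle_poly dX _ => y; elim: (enum I) => //= i s IHs [<-|]; last by [].
  exact: px.
set N := #|I| in ltM *; have [E ltE] := growth C ltM.
have [J [g [leJ gP]]] := dimC (N * E)%N.
have x_in i : List.In (x i) [seq x i | i <- enum I].
  have: i \in enum I by rewrite mem_enum.
  elim: (enum I) => //= j s IHs; rewrite inE => /predU1P[->|/IHs]; first by left.
  by right.
pose S := {ffun 'I_N -> 'I_E.+1}.
pose mon (m : S) t := \prod_i x (enum_val i) t ^+ m i.
have /fin_all_exists[c cP] (m : S) : exists c : J -> k,
    forall t, Z t -> mon m t = \sum_j c j * g j t.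
  apply: gP; apply: (@pf_leq _ _ _ _ (\sum_(i < N) m i)).
    apply: (@leq_trans (\sum_(i < N) E)).
      by apply: leq_sum => i _; rewrite -ltnS ltn_ord.
    by rewrite sum_nat_const card_ord.
  rewrite /mon; elim: (index_enum _) => [|i s IHs].
    by rewrite big_nil; apply: (pf_ext (pf_const _ _ _ 1)) => t _; rewrite big_nil.
  rewrite big_cons; apply: (pf_ext (pf_mul _ IHs)) => [|t _]; last by rewrite big_cons.
  by rewrite -[X in pf _ _ X]mul1n; apply: pf_exp; apply: pf_var.
pose A := \matrix_(i < #|S|, j < #|J|) c (enum_val i) (enum_val j).
have: kermx A != 0.
  rewrite kermx_eq0 /row_free neq_ltn; apply/orP; left.
  apply: leq_ltn_trans (rank_leq_col A) _; apply: leq_ltn_trans leJ _.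
  by rewrite /S card_ffun !card_ord.
case/rowV0Pn=> u /sub_kermxP uA0 u_neq0.
pose mn (m : S) : 'X_{1..N} := [multinom val (m i) | i < N].
have mn_inj : injective mn.
  move=> m1 m2 /mnmP eqm; apply/ffunP => i; apply: val_inj.
  by have := eqm i; rewrite !mnmE.
exists (\sum_(i < #|S|) u 0 i *: 'X_[mn (enum_val i)]); split.
  apply: contraNneq u_neq0 => P0; apply/eqP/rowP => i; rewrite mxE.
  have := congr1 (mcoeff (mn (enum_val i))) P0.
  rewrite mcoeff0 raddf_sum /= (bigD1 i) //= mcoeffZ mcoeffX eqxx mulr1.
  rewrite big1 ?addr0 // => j /negPf ji; rewrite mcoeffZ mcoeffX.
  by rewrite (inj_eq mn_inj) (inj_eq enum_val_inj) ji mulr0.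
move=> t Zt; rewrite raddf_sum /=.
transitivity (\sum_(j < #|J|) (u *m A) 0 j * g (enum_val j) t); last first.
  by rewrite big1 // => j _; rewrite uA0 mxE mul0r.
under [RHS]eq_bigr do rewrite mxE mulr_suml.
rewrite exchange_big /=; apply: eq_bigr => i _.
rewrite mevalZ mevalX.
have -> : \prod_(i0 < N) x (enum_val i0) t ^+ mn (enum_val i) i0 = mon (enum_val i) t.
  by apply: eq_bigr => l _; rewrite mnmE.
rewrite cP // mulr_sumr [RHS](reindex (@enum_rank J)) /=; last first.
  by exists enum_val => j _; rewrite ?enum_rankK ?enum_valK.
by apply: eq_bigr => j _; rewrite mxE enum_rankK mulrA.
Qed.

(** On the stratum where a given minor of size rho is invertible, Cramer's
    rule expresses rho of the unknowns by the p - rho others after division by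
    the minor, and [dimle_loc] applies. *)
Lemma dimle_linear Z X M m p rho (A : T -> 'M[k]_(m, p)) (b : T -> 'cV[k]_m)
    (v : T -> 'cV[k]_p) :
  dimle Z X M ->
  (forall i j, pfun Z X (fun t => A t i j)) ->
  (forall i, pfun Z X (fun t => b t i 0)) ->
  (forall t, Z t -> A t *m v t = b t) ->
  (forall t, Z t -> (rho <= \rank (A t))%N) ->
  dimle Z ([seq (fun t => v t j 0) | j <- enum 'I_p] ++ X) (M + (p - rho)).
Proof.
move=> dX pA pb Avb rkA.
pose L := ({ffun 'I_rho -> 'I_m} * {ffun 'I_rho -> 'I_p})%type.
pose minor (l : L) t := mxsub l.1 l.2 (A t).
apply: (@dimle_strata _ L (fun l t => minor l t \in unitmx)) => [t /rkA rk|l].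
  have [r1 [le1 eqr]] : exists r1, (rho <= r1)%N /\ \rank (A t) = r1 by exists (\rank (A t)).
  pose f i := maxrankfun (A t) (cast_ord (esym eqr) (widen_ord le1 i)).
  have frf : row_free (rowsub f (A t)).
    have := maxrowsub_free (A t).
    have -> : rowsub f (A t) = rowsub (fun i => cast_ord (esym eqr) (widen_ord le1 i)) (rowsub (maxrankfun (A t)) (A t)).
      by apply/matrixP => i j; rewrite !mxE.
    set B := rowsub (maxrankfun _) _; move=> freeB.
    rewrite rowsubE /row_free mxrankMfree // -/(row_free _); apply/row_freeP.
    exists (rowsub (fun i => cast_ord (esym eqr) (widen_ord le1 i)) 1%:M)^T.
    apply/matrixP => i j; rewrite !mxE (bigD1 (cast_ord (esym eqr) (widen_ord le1 i))) //=.
    rewrite !mxE eqxx mul1r big1 ?addr0 ?(inj_eq (@cast_ord_inj _ _ _)) => [|l /negPf].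
      by rewrite eq_sym -!val_eqE.
    by rewrite !mxE eq_sym => ->; rewrite mul0r.
  have frT : row_full (rowsub f (A t))^T by rewrite /row_full mxrank_tr.
  exists (finfun f, finfun (fullrankfun frT)) => /=.
  rewrite -unitmx_tr; have := fullrowsub_unit frT; congr (is_true (_ \in unitmx)).
  by apply/matrixP => i j; rewrite !mxE !ffunE.
set Zl := fun t => Z t /\ minor l t \in unitmx.
have sZ t : Zl t -> Z t by case.
pose Y := [seq (fun t => v t j 0) | j <- enum 'I_p & j \notin codom l.2].
have [[t0 [_ unit0]]|nZ] := excluded_middle_informative (exists t, Zl t); last first.
  by apply: dimle_void => t Zt; apply: nZ; exists t.
have inj_l : injective l.2.
  move=> i j eq_ij; apply/eqP; apply: contraTT unit0 => neq_ij.
  have E: col i (minor l t0) = col j (minor l t0).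
    by apply/colP => a; rewrite !mxE eq_ij.
  rewrite unitmxE -det_tr unitfE negbK.
  apply/eqP/(determinant_alternate neq_ij) => a.
  by move/colP/(_ a): E; rewrite !mxE.
have szY : size Y = (p - rho)%N.
  rewrite size_map size_filter -sum1_count big_enum_cond /= sum1dep_card.
  have -> : (p - rho = #|'I_p| - #|codom l.2|)%N by rewrite card_codom // !card_ord.
  rewrite -(cardC (mem (codom l.2))) addKn.
  by apply: eq_card => j; rewrite !inE.
rewrite -szY; pose q t := \det (minor l t).
have dXl := dimle_cat Y (dimle_dom sZ dX).
have pAl i j : pfun Zl (Y ++ X) (fun t => A t i j).
  by apply: pfun_sub_dom (pA i j) => // g gX; apply: List.in_or_app; right.
have pbl i : pfun Zl (Y ++ X) (fun t => b t i 0).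
  by apply: pfun_sub_dom (pb i) => // g gX; apply: List.in_or_app; right.
have pq : pfun Zl (Y ++ X) q.
  by apply: pfun_det => i j; apply: pfun_ext (pAl (l.1 i) (l.2 j)) _ => t _; rewrite mxE.
apply: (dimle_loc dXl pq) => [t [_]|y].
  by rewrite unitmxE unitfE.
move=> yYX; case: (List.in_app_or _ _ _ yYX) => [yv|yX]; last first.
  by apply: pfun_mul => //; apply: pfun_var; apply: List.in_or_app; right.
have {yv}[j ->] : exists j, y = fun t => v t j 0.
  by elim: (enum _) yv => //= j s IHs [<-|]; [exists j|].
have [jcod|jncod] := boolP (j \in codom l.2); last first.
  apply: pfun_mul => //; apply: pfun_var; apply: List.in_or_app; left.
  have: j \in [seq j <- enum 'I_p | j \notin codom l.2] by rewrite mem_filter jncod mem_enum.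
  rewrite /Y; elim: [seq _ <- _ | _] => //= a s IHs.
  by rewrite inE => /predU1P[->|/IHs]; [left|right].
have {jcod}[i0 ->] := codomP jcod.
pose rhs t (i : 'I_rho) : k := b t (l.1 i) 0 - \sum_(j | j \notin codom l.2) A t (l.1 i) j * v t j 0.
have main t : Zl t -> q t * v t (l.2 i0) 0 = \sum_i \adj (minor l t) i0 i * rhs t i.
  move=> [Zt _].
  have E : minor l t *m (\col_i v t (l.2 i) 0) = \col_i rhs t i.
    apply/colP => i; rewrite !mxE; apply/eqP; rewrite eq_sym subr_eq -Avb // mxE.
    rewrite (bigID (mem (codom l.2))) /=; apply/eqP; congr (_ + _).
    rewrite -[LHS]big_filter /= (perm_big (codom l.2)) /=; last first.
      apply: uniq_perm; rewrite ?filter_uniq ?index_enum_uniq //.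
        by rewrite map_inj_uniq ?enum_uniq.
      by move=> a; rewrite mem_filter mem_index_enum andbT.
    by rewrite big_image /=; apply: eq_bigr => a _; rewrite !mxE.
  have: \adj (minor l t) *m (minor l t *m (\col_i v t (l.2 i) 0)) = \adj (minor l t) *m \col_i rhs t i by rewrite E.
  rewrite mulmxA mul_adj_mx mul_scalar_mx => Ev; have := congr1 (fun M : 'cV_rho => M i0 0) Ev.
  by rewrite !mxE => Ev1; rewrite /q Ev1; apply: eq_bigr => i _; rewrite !mxE.
apply: (pfun_ext _ (fun t Zt => esym (main t Zt))).
apply: pfun_sum => i _ _; apply: pfun_mul.
  apply: (pfun_ext (f := fun t => cofactor (minor l t) i i0)) => [|t _]; last by rewrite mxE.
  apply: pfun_mul; first exact: pfun_const.
  apply: pfun_det => a c.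
  by apply: pfun_ext (pAl (l.1 (lift i a)) (l.2 (lift i0 c))) _ => t _; rewrite !mxE.
apply: pfun_sub => //; apply: pfun_sum => a _ ancod; apply: pfun_mul => //.
apply: pfun_var; apply: List.in_or_app; left.
have: a \in [seq j <- enum 'I_p | j \notin codom l.2] by rewrite mem_filter ancod mem_enum.
rewrite /Y; elim: [seq _ <- _ | _] => //= d s IHs.
by rewrite inE => /predU1P[->|/IHs]; [left|right].
Qed.
End Strata.

(** * Forms with varying coefficients *)

(** Monomials of degree exactly d; the encoding is the one of [coef_index], so
    that the two index types are convertible. *)
Definition mon (n d : nat) : finType := {m : 'X_{1..n < d.+1} | mdeg m == d}.

Definition mon_val n d (m : mon n d) : 'X_{1..n} := val (val m).

Lemma mon_valK n d (m : mon n d) : mdeg (mon_val m) = d.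
Proof. exact/eqP/(valP m). Qed.

Lemma mon_val_inj n d : injective (@mon_val n d).
Proof. by move=> m1 m2 /val_inj/val_inj. Qed.

Lemma mon_proof n d (m : 'X_{1..n}) (md : mdeg m == d) : (mdeg m < d.+1)%N.
Proof. by rewrite (eqP md). Qed.

Definition mon_of n d (m : 'X_{1..n}) (md : mdeg m == d) : mon n d :=
  exist _ (BMultinom (mon_proof md)) md.

Lemma homog_monE (k : fieldType) n d (p : {mpoly k[n]}) :
  p \is d.-homog -> p = \sum_(m : mon n d) p@_(mon_val m) *: 'X_[mon_val m].
Proof.
move=> hp; apply/mpolyP => m; rewrite raddf_sum /=.
have [md|md] := boolP (mdeg m == d).
  rewrite (bigD1 (mon_of md)) //= mcoeffZ mcoeffX eqxx mulr1 big1 ?addr0 // => m' /negPf.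
  rewrite -(inj_eq (@mon_val_inj n d)) /= => ne.
  by rewrite mcoeffZ mcoeffX ne mulr0.
rewrite (dhomog_nemf_coeff hp md) big1 // => m' _.
rewrite mcoeffZ mcoeffX; case: eqP => [E|]; last by rewrite mulr0.
by case/eqP: md; rewrite -E mon_valK.
Qed.

Lemma In_map_enum (A : Type) (I : finType) (g : I -> A) y :
  List.In y [seq g i | i <- enum I] -> exists i, y = g i.
Proof. by elim: (enum I) => //= i s IHs [<-|/IHs]; first by exists i. Qed.

Lemma In_enum_map (A : Type) (I : finType) (g : I -> A) i :
  List.In (g i) [seq g i | i <- enum I].
Proof.
have: i \in enum I by rewrite mem_enum.
by elim: (enum I) => //= j s IHs; rewrite inE => /predU1P[->|/IHs]; [left|right].
Qed.

Section Forms.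
Variables (k : fieldType) (T : Type) (n : nat).
Implicit Types (Z : T -> Prop) (X Y : seq (T -> k)) (f g : T -> {mpoly k[n]}).

Definition coefs d f : seq (T -> k) :=
  [seq (fun t => (f t)@_(mon_val m)) | m <- enum (mon n d)].

(** The analogue of [pfun] for a family of polynomials. *)
Definition pfunm Z X f := forall m, pfun Z X (fun t => (f t)@_m).

(** Adjoining Y raises the dimension by at most e. Quantifying over the lists
    X' that contain X makes such bounds composable: groups of unknowns that
    depend on X only can be adjoined in any order. *)
Definition adjoins Z X Y (e : nat) := forall X' M,
  (forall y, List.In y X -> List.In y X') ->
  dimle Z X' M -> dimle Z (Y ++ X') (M + e).

Lemma adjoins_free Z X Y : adjoins Z X Y (size Y).
Proof. by move=> X' M _; apply: dimle_cat. Qed.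

Lemma adjoins_cat Z X Y Y' e e' : adjoins Z X Y e -> adjoins Z (Y ++ X) Y' e' ->
  adjoins Z X (Y' ++ Y) (e + e').
Proof.
move=> aY aY' X' M sX dX; rewrite -catA addnA; apply: aY'; last exact: aY.
move=> y yYX; case: (List.in_app_or _ _ _ yYX) => [yY|/sX yX].
  by apply: List.in_or_app; left.
by apply: List.in_or_app; right.
Qed.

Lemma adjoins_nil Z X : adjoins Z X [::] 0.
Proof. exact: (@adjoins_free Z X [::]). Qed.

Lemma adjoins_sub Z X X' Y e : (forall y, List.In y X -> List.In y X') ->
  adjoins Z X Y e -> adjoins Z X' Y e.
Proof. by move=> sX aY X'' M sX' dX; apply: aY => // y /sX/sX'. Qed.

Lemma adjoins_pfun Z X Y Y' e : adjoins Z X Y e ->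
  (forall y, List.In y Y' -> pfun Z (Y ++ X) y) -> adjoins Z X Y' e.
Proof.
move=> aY pY' X' M sX dX; apply: (dimle_poly (aY X' M sX dX)) => y yYX.
case: (List.in_app_or _ _ _ yYX) => [/pY'|yX].
  apply: pfun_sub_dom => // g gYX; apply: List.in_or_app.
  by case: (List.in_app_or _ _ _ gYX) => [|/sX]; [left|right].
by apply: pfun_var; apply: List.in_or_app; right.
Qed.

Lemma adjoins_leq Z X Y e e' : (e <= e')%N -> adjoins Z X Y e -> adjoins Z X Y e'.
Proof. by move=> le_e aY X' M sX dX; apply: dimle_leq (aY X' M sX dX); rewrite leq_add2l. Qed.

Lemma adjoins_step Z X Y e e' :
  adjoins Z [::] X e -> adjoins Z X Y e' -> adjoins Z [::] (Y ++ X) (e + e').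
Proof. by move=> aX aY; apply: (adjoins_cat aX); rewrite cats0. Qed.

Lemma adjoins_flatten Z X (I : eqType) (s : seq I) (Y : I -> seq (T -> k)) (e : I -> nat) :
  (forall i, i \in s -> adjoins Z X (Y i) (e i)) ->
  adjoins Z X (flatten [seq Y i | i <- s]) (\sum_(i <- s) e i).
Proof.
elim: s => [|i s IHs] aY; first by rewrite big_nil => X' M _; rewrite addn0.
rewrite big_cons addnC /=; apply: adjoins_cat.
  by apply: IHs => j js; apply: aY; rewrite inE js orbT.
apply: (@adjoins_sub _ X); last by apply: aY; rewrite inE eqxx.
by move=> y yX; apply: List.in_or_app; right.
Qed.

Lemma adjoins_dimle Z Y e : adjoins Z [::] Y e -> dimle Z Y e.
Proof.
move/(_ [::] 0%N (fun _ H => H) (dimle0 k Z)); rewrite add0n.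
by rewrite cats0.
Qed.

Lemma In_flatten (I : eqType) (s : seq I) (Y : I -> seq (T -> k)) i y :
  i \in s -> List.In y (Y i) -> List.In y (flatten [seq Y i | i <- s]).
Proof.
elim: s => //= j s IHs; rewrite inE => /predU1P[->|js] yY; apply: List.in_or_app.
  by left.
by right; apply: IHs.
Qed.

Lemma size_coefs d f : size (coefs d f) = #|mon n d|.
Proof. by rewrite size_map -cardE. Qed.

Lemma pfunm_coefs Z X d f : (forall t, Z t -> f t \is d.-homog) ->
  (forall y, List.In y (coefs d f) -> List.In y X) -> pfunm Z X f.
Proof.
move=> hf sX m; have [md|md] := boolP (mdeg m == d); last first.
  by apply: (pfun_ext (pfun_const Z X 0)) => t /hf/dhomog_nemf_coeff->.
apply: pfun_var; apply: sX.
exact: (In_enum_map (fun m (t : T) => (f t)@_(mon_val m)) (mon_of md)).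
Qed.

Lemma pfunm_sub_dom Z Z' X X' f : (forall t, Z' t -> Z t) ->
  (forall g : T -> k, List.In g X -> List.In g X') -> pfunm Z X f -> pfunm Z' X' f.
Proof. by move=> sZ sX pf m; apply: pfun_sub_dom (pf m). Qed.

Lemma pfunm_ext Z X f g : pfunm Z X f -> (forall t, Z t -> f t = g t) -> pfunm Z X g.
Proof. by move=> pff fg m; apply: pfun_ext (pff m) _ => t /fg->. Qed.

Lemma pfunm_const Z X p : pfunm Z X (fun=> p).
Proof. by move=> m; apply: pfun_const. Qed.

Lemma pfunm_scale Z X (c : T -> k) f : pfun Z X c -> pfunm Z X f -> pfunm Z X (fun t => c t *: f t).
Proof.
move=> pc pff m; apply: (pfun_ext (pfun_mul pc (pff m))) => t _.
by rewrite mcoeffZ.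
Qed.

Lemma pfunm_sub Z X f g : pfunm Z X f -> pfunm Z X g -> pfunm Z X (fun t => f t - g t).
Proof.
move=> pff pfg m; apply: (pfun_ext (pfun_sub (pff m) (pfg m))) => t _.
by rewrite mcoeffB.
Qed.

Lemma pfunm_mul Z X f g : pfunm Z X f -> pfunm Z X g -> pfunm Z X (fun t => f t * g t).
Proof.
move=> pff pfg m; pose K := 'X_{1..n < (mdeg m).+1, (mdeg m).+1}.
apply: (@pfun_ext _ _ _ _ (fun t => \sum_(l : K | m == (l.1 + l.2)%MM) (f t)@_l.1 * (g t)@_l.2)).
  by apply: pfun_sum => l _ _; apply: pfun_mul.
by move=> t _; rewrite mcoeffM.
Qed.

Lemma pfunm_sum Z X (I : eqType) (r : seq I) (F : I -> T -> {mpoly k[n]}) :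
  (forall i, pfunm Z X (F i)) ->
  pfunm Z X (fun t => \sum_(i <- r) F i t).
Proof.
move=> pF m; apply: (@pfun_ext _ _ _ _ (fun t => \sum_(i <- r) (F i t)@_m)).
  by apply: pfun_sum => i _ _; apply: pF.
by move=> t _; rewrite raddf_sum.
Qed.

Lemma pfunm_prod Z X (I : eqType) (r : seq I) (F : I -> T -> {mpoly k[n]}) :
  (forall i, pfunm Z X (F i)) ->
  pfunm Z X (fun t => \prod_(i <- r) F i t).
Proof.
move=> pF; elim: r => [|i r IHr].
  by apply: (pfunm_ext (pfunm_const Z X 1)) => t _; rewrite big_nil.
by apply: (pfunm_ext (pfunm_mul (pF i) IHr)) => t _; rewrite big_cons.
Qed.

Lemma pfunm_exp Z X f i : pfunm Z X f -> pfunm Z X (fun t => f t ^+ i).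
Proof.
move=> pff; elim: i => [|i IHi]; first exact: (pfunm_ext (pfunm_const Z X 1)).
by apply: (pfunm_ext (pfunm_mul pff IHi)) => t _; rewrite exprS.
Qed.

Lemma pfun_mevalX Z X (x : T -> 'I_n -> k) m :
  (forall i, pfun Z X (fun t => x t i)) -> pfun Z X (fun t => ('X_[m] : {mpoly k[n]}).@[x t]).
Proof.
move=> px; apply: (@pfun_ext _ _ _ _ (fun t => \prod_i x t i ^+ m i)).
  by apply: pfun_prod => i _ _; apply: pfun_exp.
by move=> t _; rewrite mevalX.
Qed.

Lemma pfun_meval Z X d f (x : T -> 'I_n -> k) :
  (forall t, Z t -> f t \is d.-homog) -> pfunm Z X f ->
  (forall i, pfun Z X (fun t => x t i)) -> pfun Z X (fun t => (f t).@[x t]).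
Proof.
move=> hf pff px.
apply: (@pfun_ext _ _ _ _ (fun t => \sum_(m : mon n d) (f t)@_(mon_val m) * ('X_[mon_val m] : {mpoly k[n]}).@[x t])).
  by apply: pfun_sum => m _ _; apply: pfun_mul => //; apply: pfun_mevalX.
move=> t /hf/homog_monE E; rewrite [in RHS]E raddf_sum /=.
by apply: eq_bigr => m _; rewrite mevalZ.
Qed.

Lemma adjoins_linear Z X m p rho (A : T -> 'M[k]_(m, p))
    (b : T -> 'cV[k]_m) (v : T -> 'cV[k]_p) :
  (forall i j, pfun Z X (fun t => A t i j)) -> (forall i, pfun Z X (fun t => b t i 0)) ->
  (forall t, Z t -> A t *m v t = b t) -> (forall t, Z t -> (rho <= \rank (A t))%N) ->
  adjoins Z X [seq (fun t => v t j 0) | j <- enum 'I_p] (p - rho).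
Proof.
move=> pA pb Av rA X' M sX dX'; apply: dimle_linear Av rA => //.
  by move=> i j; apply: pfun_sub_dom (pA i j).
by move=> i; apply: pfun_sub_dom (pb i).
Qed.

(** An unknown form f subject to linear equations L r f = b r. The family w
    shows that rho of the equations are independent on forms of degree d; it may
    depend on t, which is easier to arrange than a nonvanishing minor. *)
Lemma adjoins_form Z X d f (R : finType) (L : R -> T -> {mpoly k[n]} -> k)
    (b : R -> T -> k) rho :
  (forall t, Z t -> f t \is d.-homog) ->
  (forall r t, scalar (L r t)) ->
  (forall r m, pfun Z X (fun t => L r t 'X_[m])) ->
  (forall r, pfun Z X (b r)) ->
  (forall r t, Z t -> L r t (f t) = b r t) ->
  (forall t, Z t -> exists (J : finType) (w : J -> {mpoly k[n]}),
     [/\ (rho <= #|J|)%N, forall j, w j \is d.-homog &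
         forall c : J -> k, (forall r, \sum_j c j * L r t (w j) = 0) -> forall j, c j = 0]) ->
  adjoins Z X (coefs d f) (#|mon n d| - rho).
Proof.
move=> hf linL pL pb Lf rkL X' M sX dX.
have Lsum r t (I : finType) (c : I -> k) (w : I -> {mpoly k[n]}) :
    L r t (\sum_i c i *: w i) = \sum_i c i * L r t (w i).
  have L0: L r t 0 = 0.
    by have := linL r t (-1) 0 0; rewrite scaler0 add0r mulN1r addNr.
  by elim/big_rec2: _ => // i y1 y2 _ <-; rewrite linL.
have sub h : pfun Z X h -> pfun Z X' h by apply: pfun_sub_dom.
pose N := #|mon n d|; pose ev (j : 'I_N) := mon_val (enum_val j).
pose A t := \matrix_(r < #|R|, j < N) L (enum_val r) t 'X_[ev j].
pose v t := \col_(j < N) (f t)@_(ev j).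
pose c t := \col_(r < #|R|) b (enum_val r) t.
have reidx (V : nmodType) (F : mon n d -> V) : \sum_(j < N) F (enum_val j) = \sum_m F m.
  by rewrite [RHS](reindex (fun j : 'I_N => enum_val j)) //; apply: onW_bij; apply: enum_val_bij.
have dV : dimle Z ([seq (fun t => v t j 0) | j <- enum 'I_N] ++ X') (M + (N - rho)).
  apply: (@dimle_linear k T Z X' M #|R| N rho A c v dX) => [r j|r|t Zt|t Zt].
  - by apply: sub; apply: pfun_ext (pL _ _) _ => t _; rewrite mxE.
  - by apply: sub; apply: pfun_ext (pb _) _ => t _; rewrite mxE.
  - apply/colP => r; rewrite !mxE -Lf // [in RHS](homog_monE (hf t Zt)) Lsum.
    rewrite -reidx; apply: eq_bigr => j _; by rewrite !mxE mulrC.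
  - have [J [w [leJ hw indep]]] := rkL t Zt; apply: leq_trans leJ _.
    pose W := \matrix_(j < N, i < #|J|) (w (enum_val i))@_(ev j).
    apply: leq_trans (mxrankM_maxl (A t) W); rewrite -mxrank_tr.
    suff: row_free (A t *m W)^T by move/eqP->.
    apply: inj_row_free => u uAW; apply/rowP => i; rewrite mxE.
    suff: forall j, u 0 (enum_rank j) = 0 by move/(_ (enum_val i)); rewrite enum_valK.
    apply: (indep (fun j => u 0 (enum_rank j))) => r.
    have := congr1 (fun M : 'rV_ _ => M 0 (enum_rank r)) uAW; rewrite !mxE => E.
    rewrite -[RHS]E [LHS](reindex (fun j : 'I_#|J| => enum_val j)) /=; last by apply: onW_bij; apply: enum_val_bij.
    apply: eq_bigr => l _; rewrite enum_valK; congr (_ * _).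
    rewrite !mxE (homog_monE (hw _)) Lsum -reidx; apply: eq_bigr => j _.
    by rewrite !mxE enum_rankK mulrC.
apply: (dimle_poly dV) => y yY.
case: (List.in_app_or _ _ _ yY) => [yf|yX]; last first.
  by apply: pfun_var; apply: List.in_or_app; right.
have {yf}[m ->] := In_map_enum yf.
apply: (@pfun_ext _ _ _ _ (fun t => v t (enum_rank m) 0)) => [|t _]; last first.
  by rewrite mxE /ev enum_rankK.
apply: pfun_var; apply: List.in_or_app; left.
exact: (In_enum_map (fun j (t : T) => v t j 0)).
Qed.
End Forms.

(** * Square-zero matrices *)

Section SquareZero.
Variable k : fieldType.

Lemma rowsub_mul m n p q (f : 'I_q -> 'I_m) (A : 'M[k]_(m, n)) (B : 'M[k]_(n, p)) :
  rowsub f (A *m B) = rowsub f A *m B.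
Proof. by rewrite rowsubE mulmxA -rowsubE. Qed.

(** A chart on square-zero matrices: factor B through its row space and
    normalise the factors so that rows f of u form the identity. As u is
    injective and v surjective, B ^ 2 = 0 amounts to v u = 0. *)
Lemma sqz_factor m (B : 'M[k]_m) : B *m B = 0 ->
  exists (f : {ffun 'I_(\rank B) -> 'I_m}) (u : 'M[k]_(m, \rank B)) (v : 'M[k]_(\rank B, m)),
    [/\ B = u *m v, rowsub f u = 1%:M, v *m u = 0 & row_free v].
Proof.
move=> BB0; have fu := col_base_full B.
pose f := fullrankfun fu; pose M := rowsub f (col_base B).
have Mu : M \in unitmx by apply: fullrowsub_unit.
have Be : B = (col_base B *m invmx M) *m (M *m row_base B).
  by rewrite mulmxA mulmxKV // mulmx_base.
have fv : row_free (M *m row_base B).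
  by rewrite /row_free mxrankMfree ?row_base_free // mxrank_unit.
have fu1 : rowsub [ffun i => f i] (col_base B *m invmx M) = 1%:M.
  rewrite rowsub_mul (_ : rowsub _ _ = M) ?mulmxV //.
  by apply/matrixP => i j; rewrite !mxE ffunE.
exists [ffun i => f i], (col_base B *m invmx M), (M *m row_base B); split=> //.
move: fv fu1 Be; set u := col_base B *m _; set v := M *m row_base B => fv fu1 Be.
apply: (row_free_inj fv); rewrite mul0mx.
have uvuv : u *m (v *m u *m v) = 0.
  have -> : u *m (v *m u *m v) = u *m v *m (u *m v) by rewrite !mulmxA.
  by rewrite -Be.
have := congr1 (rowsub [ffun i => f i]) uvuv.
by rewrite rowsub_mul fu1 mul1mx => ->; apply/matrixP => i j; rewrite !mxE.
Qed.

Lemma sqz_factor_rank m r (B : 'M[k]_m) : B *m B = 0 -> \rank B = r ->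
  exists (f : {ffun 'I_r -> 'I_m}) (u : 'M[k]_(m, r)) (v : 'M[k]_(r, m)),
    [/\ B = u *m v, rowsub f u = 1%:M, v *m u = 0 & row_free v].
Proof. by move=> BB <-; apply: sqz_factor. Qed.

Lemma sqz_rank m (B : 'M[k]_m) : B *m B = 0 -> (2 * \rank B <= m)%N.
Proof. by move/mulmx0_rank_max; rewrite addnn mul2n. Qed.

(** By v u = 0 the columns f of v are combinations of the other columns; so
    v has an invertible maximal minor that avoids them. *)
Lemma sqz_pivot m s (f : 'I_s -> 'I_m) (u : 'M[k]_(m, s)) (v : 'M[k]_(s, m)) :
  rowsub f u = 1%:M -> v *m u = 0 -> row_free v ->
  exists g : {ffun 'I_s -> 'I_m}, (forall l l', g l != f l') /\ colsub g v \in unitmx.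
Proof.
move=> fu1 vu0 fv; pose P : 'M[k]_m := \matrix_(i, j) ((i == j) && (i \notin codom f))%:R.
pose E : 'M[k]_m := 1%:M - u *m rowsub f 1%:M.
have fE : rowsub f E = 0.
  rewrite rowsubE mulmxBr mulmx1 mulmxA -rowsubE -[rowsub f u *m _]/(rowsub f u *m rowsub f 1%:M).
  by rewrite fu1 mul1mx subrr.
have PE : P *m E = E.
  apply/matrixP => i j; rewrite mxE (bigD1 i) //= big1 ?addr0 => [|l /negPf li]; last first.
    by rewrite mxE eq_sym li mul0r.
  rewrite mxE eqxx /=; have [/codomP[l ->]|] := boolP (i \in codom f); last by rewrite mul1r.
  by have := congr1 (fun M : 'M_(_, _) => M l j) fE; rewrite /= !mxE => ->; rewrite mulr0.
have vE : v *m P *m E = v by rewrite -mulmxA PE mulmxBr mulmx1 mulmxA vu0 mul0mx subr0.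
have full : row_full (v *m P)^T.
  rewrite /row_full mxrank_tr eqn_leq rank_leq_row /=.
  by apply: leq_trans (mxrankM_maxl (v *m P) E); rewrite vE (eqP fv).
pose g := fullrankfun full.
have ug : colsub g (v *m P) \in unitmx.
  rewrite -unitmx_tr; have := fullrowsub_unit full; congr (is_true (_ \in unitmx)).
  by apply/matrixP => i j; rewrite !mxE.
have vP i j : (v *m P) i j = if j \in codom f then 0 else v i j.
  rewrite mxE (bigD1 j) //= big1 ?addr0 => [|l /negPf lj]; last by rewrite mxE lj mulr0.
  by rewrite mxE eqxx /=; case: (j \in codom f); rewrite ?mulr0 ?mulr1.
have gf l : g l \notin codom f.
  apply: contraTN ug => gl; rewrite unitmxE unitfE negbK -det_tr.
  rewrite (expand_det_row _ l) big1 // => j _.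
  by rewrite mxE mxE vP gl mul0r.
exists [ffun l => g l]; split.
  by move=> l l'; rewrite ffunE; apply: contraNneq (gf l) => ->; apply: codom_f.
rewrite (_ : colsub _ v = colsub g (v *m P)) //.
by apply/matrixP => i j; rewrite mxE [RHS]mxE vP (negPf (gf j)) ffunE.
Qed.

Variable T : Type.

Definition mx_entries m n (A : T -> 'M[k]_(m, n)) : seq (T -> k) :=
  [seq (fun t => A t p.1 p.2) | p <- enum {: 'I_m * 'I_n}].

Lemma In_mx_entries m n (A : T -> 'M[k]_(m, n)) i j : List.In (fun t => A t i j) (mx_entries A).
Proof. exact: (In_enum_map (fun (p : 'I_m * 'I_n) (t : T) => A t p.1 p.2) (i, j)). Qed.

Lemma pfun_mulmx (Z : T -> Prop) X m s p (u : T -> 'M[k]_(m, s)) (v : T -> 'M[k]_(s, p)) :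
  (forall y, List.In y (mx_entries u ++ mx_entries v) -> List.In y X) ->
  forall i j, pfun Z X (fun t => (u t *m v t) i j).
Proof.
move=> sX i j; apply: (@pfun_ext _ _ _ _ (fun t => \sum_l u t i l * v t l j)).
  by apply: pfun_sum => l _ _; apply: pfun_mul; apply: pfun_var; apply: sX; apply: List.in_or_app;
    [left|right]; apply: In_mx_entries.
by move=> t _; rewrite mxE.
Qed.

(** The rows of u outside f are free, and v u = 0 determines the columns f of
    v from the m - s others: a family of dimension 2 s (m - s). *)
Lemma adjoins_sqz (Z : T -> Prop) X m s (f : 'I_s -> 'I_m) (u : T -> 'M[k]_(m, s))
    (v : T -> 'M[k]_(s, m)) :
  (forall t, Z t -> rowsub f (u t) = 1%:M) -> (forall t, Z t -> v t *m u t = 0) ->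
  adjoins Z X (mx_entries u ++ mx_entries v) (2 * (s * (m - s))).
Proof.
move=> fu1 vu0.
have [[t0 Zt0]|nZ] := excluded_middle_informative (exists t, Z t); last first.
  by move=> X' M _ _; apply: dimle_void => t Zt; apply: nZ; exists t.
have inj_f : injective f.
  move=> i j eq_f; have /matrixP Eu := fu1 t0 Zt0.
  have := Eu i i; have := Eu j i; rewrite !mxE eq_f eqxx => -> /=.
  by case: (j =P i) => // _ /eqP; rewrite eq_sym oner_eq0.
pose J : finType := {i : 'I_m | i \notin codom f}.
have cardJ : #|J| = (m - s)%N.
  rewrite card_sig; have -> : (m - s = #|'I_m| - #|codom f|)%N by rewrite card_codom // !card_ord.
  rewrite -(cardC (mem (codom f))) addKn.
  by apply: eq_card => j; rewrite !inE.
pose Y := [seq (fun t => u t (val p.1) p.2) | p <- enum {: J * 'I_s}] ++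
          [seq (fun t => v t p.2 (val p.1)) | p <- enum {: J * 'I_s}].
have szY : size Y = (2 * (s * (m - s)))%N.
  have cJ : size (enum {: J * 'I_s}) = (s * (m - s))%N.
    by apply: etrans (esym (cardE _)) _; rewrite card_prod cardJ card_ord mulnC.
  by rewrite size_cat !size_map -enumT cJ addnn mul2n.
rewrite -szY; apply: (adjoins_pfun (@adjoins_free k T Z X Y)) => y.
have pu i j : pfun Z (Y ++ X) (fun t => u t i j).
  have [/codomP[l ->]|ni] := boolP (i \in codom f).
    apply: (pfun_ext (pfun_const _ _ ((l == j)%:R))) => t Zt.
    by have := congr1 (fun M : 'M_(_, _) => M l j) (fu1 t Zt); rewrite /= !mxE => ->.
  apply: pfun_var; do 2!(apply: List.in_or_app; left).
  exact: (In_enum_map (fun (p : J * 'I_s) (t : T) => u t (val p.1) p.2) (exist _ i ni, j)).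
have pv0 i j : j \notin codom f -> pfun Z (Y ++ X) (fun t => v t i j).
  move=> nj; apply: pfun_var; apply: List.in_or_app; left; apply: List.in_or_app; right.
  exact: (In_enum_map (fun (p : J * 'I_s) (t : T) => v t p.2 (val p.1)) (exist _ j nj, i)).
have pv i j : pfun Z (Y ++ X) (fun t => v t i j).
  have [/codomP[l ->]|] := boolP (j \in codom f); last exact: pv0.
  apply: (@pfun_ext _ _ _ _ (fun t => - \sum_(a | a \notin codom f) v t i a * u t a l)).
    by apply: pfun_opp; apply: pfun_sum => a _ na; apply: pfun_mul => //; apply: pv0.
  move=> t Zt; have := congr1 (fun M : 'M_(_, _) => M i l) (vu0 t Zt).
  rewrite /= !mxE (bigID (mem (codom f))) /= => E.
  apply/eqP; rewrite eq_sym -addr_eq0 -[X in _ == X]E; apply/eqP; congr (_ + _).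
  rewrite (bigD1 (f l)) ?codom_f //= big1 ?addr0 => [|a /andP[/codomP[l' ->]]].
    by have /matrixP/(_ l l) := fu1 t Zt; rewrite !mxE eqxx => ->; rewrite mulr1.
  rewrite (inj_eq inj_f) => /negPf nl.
  by have /matrixP/(_ l' l) := fu1 t Zt; rewrite !mxE nl => ->; rewrite mulr0.
move=> yuv; case: (List.in_app_or _ _ _ yuv) => yin;
  by have [[i j] ->] := In_map_enum yin.
Qed.
End SquareZero.

(** * Zeros of polynomials and forms *)

Section MpolyExtra.
Variable k : comNzRingType.

Lemma comp_mpolyA n1 n2 n3 (p : {mpoly k[n1]}) (s : n1.-tuple {mpoly k[n2]})
    (t : n2.-tuple {mpoly k[n3]}) :
  (p \mPo s) \mPo t = p \mPo [tuple tnth s i \mPo t | i < n1].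
Proof.
rewrite (comp_mpolyEX p) [RHS]comp_mpolyEX raddf_sum; apply: eq_bigr => m _.
rewrite /= comp_mpolyZ comp_mpolyX [in RHS]comp_mpolyX rmorph_prod; congr (_ *: _).
by apply: eq_bigr => i _; rewrite tnth_mktuple /= rmorphXn.
Qed.

Lemma meval_mwiden n (p : {mpoly k[n]}) (x : 'I_n.+1 -> k) :
  (mwiden p).@[x] = p.@[fun i => x (widen_ord (leqnSn n) i)].
Proof.
rewrite [in LHS](mpolyE p) [in RHS](mpolyE p) [mwiden _]raddf_sum !raddf_sum.
apply: eq_bigr => m _ /=.
rewrite mwidenZ !mevalZ mwidenX !mevalX big_ord_recr /=.
rewrite mnmwiden_ordmax expr0 mulr1; congr (_ * _).
by apply: eq_bigr => i _; rewrite mnmwiden_widen.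
Qed.

(** The isomorphism from A[y] to k[x_1, .., x_n, y], for A = k[x_1, .., x_n]. *)
Definition unwiden n (q : {poly {mpoly k[n]}}) : {mpoly k[n.+1]} :=
  (map_poly (@mwiden n k) q).['X_ord_max].

Lemma unwidenD n : {morph @unwiden n : p q / p + q}.
Proof. by move=> p q; rewrite /unwiden rmorphD hornerD. Qed.

Lemma unwidenM n : {morph @unwiden n : p q / p * q}.
Proof. by move=> p q; rewrite /unwiden rmorphM hornerM. Qed.

Lemma unwidenC n p : @unwiden n p%:P = mwiden p.
Proof. by rewrite /unwiden map_polyC hornerC. Qed.

Lemma unwidenX n : @unwiden n 'X = 'X_ord_max.
Proof. by rewrite /unwiden map_polyX hornerX. Qed.

Lemma unwidenZ n c q : @unwiden n (c *: q) = mwiden c * unwiden q.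
Proof. by rewrite -mul_polyC unwidenM unwidenC. Qed.

Lemma unwiden_sum n (I : Type) (r : seq I) (F : I -> {poly {mpoly k[n]}}) :
  unwiden (\sum_(i <- r) F i) = \sum_(i <- r) unwiden (F i).
Proof.
elim/big_rec2: _ => [|i p q _ <-]; last by rewrite unwidenD.
by rewrite -[0 in LHS]polyC0 unwidenC mwiden0.
Qed.

Lemma unwiden_prod n (I : Type) (r : seq I) (F : I -> {poly {mpoly k[n]}}) :
  unwiden (\prod_(i <- r) F i) = \prod_(i <- r) unwiden (F i).
Proof.
elim/big_rec2: _ => [|i p q _ <-]; last by rewrite unwidenM.
by rewrite -polyC1 unwidenC mwiden1.
Qed.

Lemma unwiden_exp n (q : {poly {mpoly k[n]}}) i : unwiden (q ^+ i) = unwiden q ^+ i.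
Proof.
elim: i => [|i IHi]; last by rewrite !exprS unwidenM IHi.
by rewrite !expr0 -polyC1 unwidenC mwiden1.
Qed.

Definition snoc n (x : 'I_n -> k) (y : k) : 'I_n.+1 -> k :=
  fun i => oapp x y (insub (val i)).

Lemma snoc_widen n x y (i : 'I_n) : snoc x y (widen_ord (leqnSn n) i) = x i.
Proof. by rewrite /snoc /= valK. Qed.

Lemma snoc_max n (x : 'I_n -> k) y : snoc x y ord_max = y.
Proof. by rewrite /snoc insubF //= ltnn. Qed.

Lemma meval_unwiden n (q : {poly {mpoly k[n]}}) (x : 'I_n -> k) y :
  (unwiden q).@[snoc x y] = (map_poly (meval x) q).[y].
Proof.
elim/poly_ind: q => [|q c IHq].
  by rewrite -polyC0 unwidenC mwiden0 meval0 map_polyC /= meval0 hornerC.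
rewrite unwidenD unwidenM unwidenC unwidenX mevalD mevalM IHq mevalXU snoc_max.
rewrite rmorphD rmorphM /= map_polyX map_polyC /= hornerMXaddC meval_mwiden.
by congr (_ + _); apply: meval_eq => j; rewrite snoc_widen.
Qed.

Lemma unwiden_surj n (p : {mpoly k[n.+1]}) : exists q, unwiden q = p.
Proof.
exists (\sum_(m <- msupp p) \sum_(i < 1) (p@_m)%:MP%:P * (\prod_(i < n) ('X_i)%:P ^+ m (widen_ord (leqnSn n) i) * 'X^(m ord_max))).
rewrite unwiden_sum [RHS]mpolyE; apply: eq_bigr => m _; rewrite big_ord1 !unwidenM unwidenC.
rewrite mwidenC mul_mpolyC; congr (_ *: _); rewrite unwiden_prod unwiden_exp unwidenX.
rewrite [in RHS]mpolyXE_id big_ord_recr /=; congr (_ * _); apply: eq_bigr => i _.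
by rewrite unwiden_exp unwidenC mwidenX mnmwiden1.
Qed.

End MpolyExtra.

Section Nonvanishing.
Variable k : closedFieldType.

(** A point where the leading coefficient in the last variable is nonzero
    leaves a nonzero polynomial in one variable. *)
Lemma mpoly_nonzero_point n (p : {mpoly k[n]}) : p != 0 -> exists x, p.@[x] != 0.
Proof.
elim: n p => [|n IHn] p p0.
  exists (fun=> 0); rewrite (nvar0_mpolyC p) mevalC; apply: contraNneq p0 => E.
  by rewrite (nvar0_mpolyC p) E mpolyC0.
have [q qp] := unwiden_surj p.
have q0 : q != 0.
  by apply: contraNneq p0 => E; rewrite -qp E -polyC0 unwidenC mwiden0.
have [x xq] : exists x, (lead_coef q).@[x] != 0 by apply: IHn; rewrite lead_coef_eq0.
have mq0 : map_poly (meval x) q != 0.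
  apply/eqP => /polyP/(_ (size q).-1); rewrite coef_map coef0 /=.
  by apply/eqP.
have /closed_nonrootP[y] := mq0.
by rewrite /root -meval_unwiden qp => ?; exists (snoc x y).
Qed.

End Nonvanishing.

(** Sylvester matrices are compatible with f as long as f does not lower the
    degrees. *)
Lemma resultant_map (A : comNzRingType) (B : comNzRingType) (f : {rmorphism A -> B})
    (p q : {poly A}) : f (lead_coef p) != 0 -> f (lead_coef q) != 0 ->
  f (resultant p q) = resultant (map_poly f p) (map_poly f q).
Proof.
move=> fp fq; rewrite /resultant -det_map_mx.
rewrite /Sylvester_mx !size_map_poly_id0 // map_col_mx; congr (\det (col_mx _ _));
  by apply: map_lin1_mx => v; rewrite map_poly_rV rmorphM /= map_rVpoly.
Qed.

Lemma coefM_top (R : comNzRingType) (p q : {poly R}) a b :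
  (size p <= a.+1)%N -> (size q <= b.+1)%N ->
  (size (p * q)%R <= (a + b).+1)%N /\ (p * q)`_(a + b) = p`_a * q`_b.
Proof.
move=> sp sq; split.
  by apply: leq_trans (size_polyMleq p q) _; lia.
have lt_a : (a < (a + b).+1)%N by rewrite ltnS leq_addr.
rewrite coefM (bigD1 (Ordinal lt_a)) //= addKn big1 ?addr0 // => j.
rewrite -val_eqE /= neq_ltn => /orP[lt_ja|lt_aj].
  by rewrite [q`__]nth_default ?mulr0 // (leq_trans sq) //; lia.
by rewrite nth_default ?mul0r // (leq_trans sp).
Qed.

Lemma prod_coef_top (R : comNzRingType) (I : Type) (r : seq I) (p : I -> {poly R}) (e : I -> nat) :
  (forall i, size (p i) <= 2)%N ->
  (size (\prod_(i <- r) p i ^+ e i)%R <= (\sum_(i <- r) e i).+1)%N /\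
  (\prod_(i <- r) p i ^+ e i)`_(\sum_(i <- r) e i) = \prod_(i <- r) (p i)`_1 ^+ e i.
Proof.
move=> sp; have top1 (q : {poly R}) i : (size q <= 2)%N ->
    (size (q ^+ i)%R <= i.+1)%N /\ (q ^+ i)`_i = q`_1 ^+ i.
  move=> sq; elim: i => [|i [IHs IHc]]; first by rewrite expr0 coef1 size_poly1.
  rewrite !exprS; have := coefM_top sq IHs; rewrite add1n => -[-> ->].
  by rewrite IHc.
elim: r => [|i r [IHs IHc]]; first by rewrite !big_nil coef1 size_poly1.
rewrite !big_cons; have [s1 c1] := top1 _ (e i) (sp i).
by have [-> ->] := coefM_top s1 IHs; rewrite c1 IHc.
Qed.

Lemma affine_poly (R : comNzRingType) (a b : R) :
  (size (a%:P + b *: 'X)%R <= 2)%N * ((a%:P + b *: 'X)`_1 = b).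
Proof.
split; last by rewrite coefD coefC coefZ coefX mulr1 add0r.
apply: leq_trans (size_polyD _ _) _; rewrite geq_max (leq_trans (size_polyC_leq1 _)) //.
by rewrite (leq_trans (size_scale_leq _ _)) ?size_polyX.
Qed.

Definition ideal_pred (R : comNzRingType) (J : R -> Prop) :=
  [/\ J 0, forall p q, J p -> J q -> J (p + q) & forall a p, J p -> J (a * p)].

Lemma mcoeff_pihomog (R : nzRingType) n d (p : {mpoly R[n]}) m :
  (pihomog (@mdeg n) d p)@_m = if mdeg m == d then p@_m else 0.
Proof.
rewrite pihomogE raddf_sum big_mkcond /=.
have [mp|mp] := boolP (m \in msupp p).
  rewrite (bigD1_seq m mp (msupp_uniq p)) /= big1 ?addr0 => [|m' /negPf ne].
    by case: ifP => _ //; rewrite mcoeffZ mcoeffX eqxx mulr1.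
  by case: ifP => _ //; rewrite mcoeffZ mcoeffX ne mulr0.
rewrite big1_seq ?(memN_msupp_eq0 mp) ?if_same // => m' /= m'p.
case: ifP => _ //; rewrite mcoeffZ mcoeffX; case: eqP => [E|]; last by rewrite mulr0.
by rewrite E (negPf mp) in m'p.
Qed.

Section Nullstellensatz.
Variable k : closedFieldType.

(** A nonzero element of least degree generates the ideal; it is not constant,
    so it has a root. *)
Lemma poly_ideal_root (J : {poly k} -> Prop) (g : {poly k}) :
  ideal_pred J -> J g -> g != 0 -> ~ J 1 -> exists y, forall p, J p -> p.[y] = 0.
Proof.
move=> [J0 JD JM] Jg g0 J1.
have [m [h [Jh h0 sh minh]]] : exists m h, [/\ J h, h != 0, size h = m &
    forall q, J q -> q != 0 -> (m <= size q)%N].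
  have [m] := ubnP (size g); elim: m g Jg g0 => // m IHm g Jg g0 lt_g.
  have [[q [Jq q0 lt_q]]|nq] := excluded_middle_informative
      (exists q, [/\ J q, q != 0 & (size q < size g)%N]).
    by apply: (IHm q); rewrite // (leq_trans lt_q).
  exists (size g), g; split=> // q Jq q0; rewrite leqNgt; apply/negP => lt_q.
  by apply: nq; exists q.
have dvdh q : J q -> h %| q.
  move=> Jq; apply/modp_eq0P; apply/eqP; apply: contraT => r0.
  have := ltn_modp q h; rewrite h0 ltnNge sh minh //.
  have -> : q %% h = q + (- (q %/ h)) * h by rewrite {2}(divp_eq q h) mulNr addrAC subrr add0r.
  by apply: JD => //; apply: JM.
have /closed_rootP[y hy] : size h != 1%N.
  apply/negP => /size_poly1P[c c0 hc]; apply: J1.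
  have -> : 1 = (c^-1)%:P * h by rewrite hc -polyCM mulVf.
  exact: JM.
by exists y => p /dvdh/dvdpP[q ->]; rewrite hornerM (eqP hy) mulr0.
Qed.

(** Elimination of the last variable. Let x be a common zero of the elements
    of J that do not involve it. If the fibre over x contained no zero of J,
    some q in J would specialise to 1 at x. The resultant of g and q lies in J
    and does not involve the last variable, so it vanishes at x; but g is monic,
    so this resultant specialises to that of g and 1, a unit. *)
Lemma nullstellensatz_monic n (J : {mpoly k[n.+1]} -> Prop) (g : {poly {mpoly k[n]}}) :
  (forall J : {mpoly k[n]} -> Prop, ideal_pred J -> ~ J 1 ->
     exists x, forall p, J p -> p.@[x] = 0) ->
  ideal_pred J -> ~ J 1 -> g \is monic -> (1 < size g)%N -> J (unwiden g) ->
  exists x, forall p, J p -> p.@[x] = 0.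
Proof.
move=> IHn [J0 JD JM] J1 g_monic sg Jg.
have [x xP] : exists x : 'I_n -> k, forall p, J (mwiden p) -> p.@[x] = 0.
  apply: IHn; last by rewrite mwiden1.
  split=> [|p q|a p]; rewrite ?mwiden0 //.
    by rewrite mwidenD; apply: JD.
  by rewrite mwidenM; apply: JM.
pose ev := map_poly (meval x).
have lead1 (q : {poly {mpoly k[n]}}) : q \is monic -> meval x (lead_coef q) != 0.
  by move/monicP->; rewrite meval1 oner_eq0.
pose Jx (p : {poly k}) := exists2 q, J (unwiden q) & p = ev q.
have [||||y yP] := @poly_ideal_root Jx (ev g).
- split.
  + exists 0; last by rewrite /ev rmorph0.
    by rewrite -polyC0 unwidenC mwiden0.
  + move=> _ _ [p Jp ->] [q Jq ->]; exists (p + q); last by rewrite /ev rmorphD.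
    by rewrite unwidenD; apply: JD.
  + move=> a _ [q Jq ->]; exists (map_poly (@mpolyC n k) a * q).
      by rewrite unwidenM; apply: JM.
    rewrite /ev rmorphM /=; congr (_ * _); apply/polyP => i; rewrite !coef_map /=.
    by rewrite mevalC.
- by exists g.
- apply/eqP => /polyP/(_ (size g).-1); rewrite coef_map coef0 /=.
  by apply/eqP; rewrite lead1.
(* adding a multiple of g makes q monic and keeps its values at the zeros of g *)
- case=> q Jq ev_q; pose q' := q + g * 'X^(size q).
  have sq' : size (g * 'X^(size q))%R = (size g + size q)%N.
    by rewrite size_Mmonic ?monic_neq0 ?monicXn // size_polyXn addnS.
  have lt_q : (size q < size (g * 'X^(size q))%R)%N.
    by rewrite sq' -[X in (X < _)%N]add0n ltn_add2r (ltn_trans _ sg).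
  have q'_monic : q' \is monic.
    by rewrite monicE lead_coefDr // lead_coefM lead_coefXn mulr1 -monicE.
  have sq'1 : (1 < size q')%N.
    by rewrite /q' addrC size_polyDl // sq' (leq_trans sg) // leq_addr.
  have Jq' : J (unwiden q').
    by rewrite unwidenD mulrC unwidenM; apply: JD => //; apply: JM.
  have [[u v] /= _ Res] := resultant_in_ideal sg sq'1.
  have : (resultant g q').@[x] = 0.
    apply: xP; rewrite -unwidenC Res unwidenD !unwidenM.
    by apply: JD; apply: JM.
  rewrite (resultant_map (f := meval x)) ?lead1 // => /eqP.
  rewrite resultant_eq0; apply/negP; rewrite -leqNgt.
  have -> : map_poly (meval x) q' = 1 + 'X^(size q) * ev g.
    by rewrite rmorphD rmorphM /= map_polyXn -/(ev q) -ev_q mulrC.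
  have : coprimep (ev g) ('X^(size q) * ev g + 1).
    by rewrite coprimep_addl_mul coprimep1.
  by rewrite addrC /coprimep => /eqP->.
exists (snoc x y) => p Jp; have [q qp] := unwiden_surj p.
by rewrite -qp meval_unwiden; apply: yP; exists q; rewrite ?qp.
Qed.

(** Along a direction b where the leading form of f does not vanish, f is
    monic in the last variable up to a constant, after a linear change of
    variables; then [nullstellensatz_monic] applies. *)
Theorem nullstellensatz n (J : {mpoly k[n]} -> Prop) : ideal_pred J -> ~ J 1 ->
  exists x, forall p, J p -> p.@[x] = 0.
Proof.
elim: n J => [|n IHn] J idJ J1; have [J0 JD JM] := idJ.
  exists (fun=> 0) => p Jp; rewrite (nvar0_mpolyC p) mevalC; apply/eqP; apply: contraT => p0.
  case: J1; have := JM ((p@_0%MM)^-1)%:MP p Jp.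
  by rewrite {2}(nvar0_mpolyC p) -mpolyCM mulVf.
have [[f [Jf f0]]|nf] := excluded_middle_informative (exists f, J f /\ f != 0); last first.
  exists (fun=> 0) => p Jp; have [->|p0] := eqVneq p 0; first by rewrite meval0.
  by case: nf; exists p.
pose d := mdeg (mlead f); pose F := pihomog (@mdeg n.+1) d f.
have F0 : F * 'X_ord_max != 0.
  rewrite mulf_neq0 //.
    apply: contraNneq f0 => /(congr1 (mcoeff (mlead f))).
    by rewrite mcoeff_pihomog eqxx mcoeff0 => /eqP; rewrite mleadc_eq0.
  by rewrite -msize_poly_eq0 msizeX.
have [b] := mpoly_nonzero_point F0; rewrite mevalM mevalXU mulf_eq0 negb_or => /andP[Fb bn0].
pose lin (i : 'I_n.+1) : {poly {mpoly k[n]}} :=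
  (if insub (val i) is Some j then ('X_(j : 'I_n))%:P else 0) + (b i)%:MP *: 'X.
have linE i : exists a, lin i = a%:P + (b i)%:MP *: 'X.
  by rewrite /lin; case: insub => [j|]; [exists 'X_j|exists 0; rewrite polyC0].
have slin i : (size (lin i) <= 2)%N by have [a ->] := linE i; apply: (affine_poly _ _).1.
have clin i : (lin i)`_1 = (b i)%:MP by have [a ->] := linE i; apply: (affine_poly _ _).2.
pose q := \sum_(m <- msupp f) (f@_m)%:MP *: \prod_i lin i ^+ m i.
have degm m : m \in msupp f -> (mdeg m <= d)%N.
  by move/msupp_le_mlead/lemc_mdeg.
have sq : (size q <= d.+1)%N.
  apply: leq_trans (size_sum _ _ _) _; apply/bigmax_leqP_seq => m mf _.
  apply: leq_trans (size_scale_leq _ _) _.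
  have [sm _] := prod_coef_top (index_enum _) m slin.
  by apply: leq_trans sm _; rewrite ltnS -mdegE degm.
have qd : q`_d = (F.@[b])%:MP.
  rewrite coef_sum /F pihomogE [in RHS]big_mkcond (raddf_sum (meval b)) (raddf_sum (@mpolyC n k)).
  apply: eq_big_seq => m mf /=.
  have [sm cm] := prod_coef_top (index_enum _) m slin; rewrite -mdegE in sm cm.
  rewrite coefZ; case: eqP => [E|/eqP ne].
    rewrite -E cm mevalZ mevalX mpolyCM rmorph_prod; congr (_ * _).
    by apply: eq_bigr => i _; rewrite clin rmorphXn.
  rewrite meval0 mpolyC0 nth_default ?mulr0 // (leq_trans sm) //.
  by rewrite ltn_neqAle ne degm.
(* s maps the last basis vector to b and fixes the others; s' is its inverse *)
pose s : n.+1.-tuple {mpoly k[n.+1]} :=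
  [tuple (if i == ord_max then 0 else 'X_i) + b i *: 'X_ord_max | i < n.+1].
have qs : unwiden q = f \mPo s.
  rewrite unwiden_sum comp_mpolyEX; apply: eq_bigr => m _.
  rewrite unwidenZ mwidenC mul_mpolyC comp_mpolyX unwiden_prod; congr (_ *: _).
  apply: eq_bigr => i _; rewrite unwiden_exp tnth_mktuple unwidenD unwidenZ mwidenC mul_mpolyC.
  rewrite unwidenX; congr ((_ + _) ^+ _).
  case: insubP => [j _ ji|]; rewrite -?leqNgt.
    rewrite unwidenC mwidenX mnmwiden1.
    have -> : widen_ord (leqnSn n) j = i by apply: val_inj.
    by rewrite -val_eqE /= -ji ltn_eqF ?ltn_ord.
  move=> le_ni; have -> : i == ord_max by rewrite -val_eqE /= eqn_leq -ltnS ltn_ord.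
  by rewrite -polyC0 unwidenC mwiden0.
pose s' : n.+1.-tuple {mpoly k[n.+1]} :=
  [tuple (if i == ord_max then 0 else 'X_i - (b i / b ord_max) *: 'X_ord_max) +
         (if i == ord_max then (b ord_max)^-1 *: 'X_ord_max else 0) | i < n.+1].
have ss' p : (p \mPo s) \mPo s' = p.
  rewrite comp_mpolyA -[RHS]comp_mpoly_id; congr (_ \mPo _); apply: eq_from_tnth => i.
  rewrite !tnth_mktuple comp_mpolyD comp_mpolyZ !comp_mpolyXU -!tnth_nth tnth_mktuple eqxx add0r.
  case: eqP => [->|/eqP/negPf ni].
    by rewrite comp_mpoly0 add0r scalerA divff ?scale1r.
  by rewrite comp_mpolyXU -tnth_nth tnth_mktuple ni addr0 scalerA subrK.
have c0 : F.@[b] != 0 by [].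
have sqE : size q = d.+1.
  apply/eqP; rewrite eqn_leq sq ltnNge; apply/negP => le_qd.
  by move: qd; rewrite nth_default // => /esym/eqP; rewrite mpolyC_eq0 (negPf c0).
have d_gt0 : (0 < d)%N.
  rewrite lt0n; apply/eqP => d0; apply: J1.
  have fC : f = (f@_0%MM)%:MP by apply: msize1_polyC; rewrite -mlead_deg // -/d d0.
  have := JM ((f@_0%MM)^-1)%:MP f Jf; rewrite {2}fC -mpolyCM mulVf //.
  by apply: contraNneq f0 => E; rewrite fC E mpolyC0.
pose g := ((F.@[b])^-1)%:MP *: q.
have g_monic : g \is monic.
  by rewrite monicE lead_coefZ lead_coefE sqE qd -mpolyCM mulVf.
have [|||||x xP] := @nullstellensatz_monic n (fun p => J (p \mPo s')) g IHn.
- split=> [|p r|a p]; rewrite ?comp_mpoly0 //.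
    by rewrite comp_mpolyD; apply: JD.
  by rewrite rmorphM; apply: JM.
- by rewrite comp_mpoly1.
- by [].
- by rewrite size_scale ?sqE ?ltnS // mpolyC_eq0 invr_eq0.
- rewrite unwidenZ mwidenC rmorphM qs /= ss'; exact: JM.
exists (fun i => (tnth s i).@[x]) => p Jp; rewrite -comp_mpoly_meval; apply: xP.
by rewrite ss'.
Qed.

End Nullstellensatz.

Lemma pihomog_mulr (k : comNzRingType) n e D (a F : {mpoly k[n]}) : F \is e.-homog ->
  pihomog (@mdeg n) D (a * F) = (if (e <= D)%N then pihomog (@mdeg n) (D - e) a else 0) * F.
Proof.
move=> hF; rewrite {1 2}(mpolyE a) mulr_suml (raddf_sum (pihomog (@mdeg n) D)).
have -> : (if (e <= D)%N then pihomog (@mdeg n) (D - e) (\sum_(m <- msupp a) a@_m *: 'X_[m]) else 0)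
  = \sum_(m <- msupp a) if (e <= D)%N then pihomog (@mdeg n) (D - e) (a@_m *: 'X_[m]) else 0.
  by case: ifP => _; [rewrite (raddf_sum (pihomog (@mdeg n) (D - e)))|rewrite big1].
rewrite mulr_suml; apply: eq_bigr => m _ /=; rewrite -scalerAl !linearZ /=.
have hXF : 'X_[m] * F \is (mdeg m + e).-homog by apply: dhomogM; rewrite ?dhomogX.
have [E|ne] := eqVneq (mdeg m + e)%N D.
  by rewrite pihomog_dE -E // leq_addl addnK pihomogX eqxx scalerAl.
rewrite (pihomog_ne0 ne) // scaler0; case: ifP => leD; last by rewrite mul0r.
rewrite pihomogX ifN ?scaler0 ?mul0r //; apply: contraNneq ne => ->.
by rewrite subnK.
Qed.

(** Finitely many generators m over the polynomials in X only multiply the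
    dimension by a constant, provided that the coefficients obey the same degree
    bound. *)
Lemma dimle_finite (k : fieldType) T (Z : T -> Prop) X Y (J : finType) (m : J -> T -> k) M :
  (forall D f, pf Z Y D f -> exists a : J -> T -> k, (forall j, pf Z X D (a j)) /\
     forall t, Z t -> f t = \sum_j a j t * m j t) ->
  dimle Z X M -> dimle Z Y M.
Proof.
move=> fin [C dimC]; exists (#|J| * C)%N => D; have [I [g [leI gP]]] := dimC D.
exists (J * I)%type, (fun (p : J * I) t => g p.2 t * m p.1 t); split.
  by rewrite card_prod -mulnA leq_mul.
move=> f /fin[a [pa fE]].
have /fin_all_exists[c cP] j : exists c : I -> k, forall t, Z t -> a j t = \sum_i c i * g i t.
  exact: gP.
exists (fun p : J * I => c p.1 p.2) => t Zt.
rewrite fE // -(pair_bigA _ (fun j i => c j i * (g i t * m j t))) /=.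
apply: eq_bigr => j _; rewrite cP // mulr_suml; apply: eq_bigr => i _.
by rewrite mulrA.
Qed.

Section ProjectiveDimension.
Variables (k : closedFieldType) (n : nat) (e : 'I_n -> nat) (F : 'I_n -> {mpoly k[n.+1]}).
Hypothesis e_gt0 : forall i, (0 < e i)%N.
Hypothesis homF : forall i, F i \is (e i).-homog.

(** Together with X_j - 1 the forms generate the unit ideal, by
    [nullstellensatz]; homogenising the resulting identity by powers of X_j
    removes the multiple of X_j - 1. *)
Lemma forms_power_in_ideal :
  (forall x : 'I_n.+1 -> k, (forall i, (F i).@[x] = 0) -> forall j, x j = 0) ->
  forall j, exists N (b : 'I_n -> {mpoly k[n.+1]}), 'X_j ^+ N = \sum_i b i * F i.
Proof.
move=> nozero j; pose J p := exists b c, p = \sum_i b i * F i + c * ('X_j - 1) :> {mpoly k[n.+1]}.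
have idJ : ideal_pred J.
  split=> [|_ _ [b1 [c1 ->]] [b2 [c2 ->]]|a _ [b [c ->]]].
  - by exists (fun=> 0), 0; rewrite mul0r addr0 big1 // => i _; rewrite mul0r.
  - exists (fun i => b1 i + b2 i), (c1 + c2); rewrite mulrDl addrACA -big_split /=.
    by congr (_ + _); apply: eq_bigr => i _; rewrite mulrDl.
  - exists (fun i => a * b i), (a * c); rewrite mulrDr mulrA mulr_sumr.
    by congr (_ + _); apply: eq_bigr => i _; rewrite mulrA.
have [[b [c E]]|nJ1] := excluded_middle_informative (J 1); last first.
  have [x xP] := nullstellensatz idJ nJ1.
  have : ('X_j - 1 : {mpoly k[n.+1]}).@[x] = 0.
    apply: xP; exists (fun=> 0), 1; rewrite mul1r big1 ?add0r // => i _; exact: mul0r.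
  rewrite mevalB meval1 mevalXU nozero => [/eqP|i]; first by rewrite sub0r oppr_eq0 oner_eq0.
  apply: xP; exists (fun l => (l == i)%:R), 0.
  rewrite mul0r addr0 (bigD1 i) //= eqxx mul1r big1 ?addr0 // => l /negPf->.
  by rewrite mul0r.
pose q : {mpoly k[n.+1]} := \sum_i b i * F i.
pose M := maxn (msize q) (msize c).+1.
(* H homogenises to degree M by powers of X_j, so it maps c X_j and c to the same form *)
pose H (p : {mpoly k[n.+1]}) := \sum_(d < M.+1) 'X_j ^+ (M - d) * pihomog (@mdeg n.+1) d p.
have HB p1 p2 : H (p1 - p2) = H p1 - H p2.
  rewrite /H -sumrB; apply: eq_bigr => d _; by rewrite pihomogB mulrBr.
have H1 : H 1 = 'X_j ^+ M.
  rewrite /H big_ord_recl /= subn0 pihomog_dE ?dhomog1 // mulr1 big1 ?addr0 // => i _.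
  by rewrite (@pihomog_ne0 _ _ _ 0%N) ?mulr0 ?dhomog1.
have HX : H (c * 'X_j) = H c.
  rewrite /H big_ord_recl /= big_ord_recr /= [in RHS]subnn.
  have hX : ('X_j : {mpoly k[n.+1]}) \is 1.-homog by rewrite dhomogX /= mdeg1.
  rewrite (pihomog_mulr 0 c hX) /= mul0r mulr0 add0r.
  rewrite [X in _ = _ + X](_ : _ = 0) ?addr0.
    apply: eq_bigr => i _; rewrite (pihomog_mulr _ c hX) /= subSS subn0.
    by rewrite mulrA mulrAC -exprSr -subSn ?subSS.
  rewrite expr0 mul1r; apply/mpolyP => m; rewrite mcoeff_pihomog mcoeff0.
  case: eqP => // mM; apply: memN_msupp_eq0; apply: msize_mdeg_ge; rewrite mM.
  by rewrite (leq_trans (leqnSn _)) ?leq_maxr.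
have qE : q = 1 - (c * 'X_j - c) by rewrite E mulrBr mulr1 addrK.
exists M, (fun i => \sum_(d < M.+1) 'X_j ^+ (M - d) * (if (e i <= d)%N then pihomog (@mdeg n.+1) (d - e i) (b i) else 0)).
have -> : 'X_j ^+ M = H q by rewrite qE !HB HX subrr subr0 H1.
rewrite /H; under [RHS]eq_bigr do rewrite mulr_suml.
rewrite exchange_big; apply: eq_bigr => d _ /=.
rewrite /q (raddf_sum (pihomog (@mdeg n.+1) d)) mulr_sumr; apply: eq_bigr => i _ /=.
by rewrite (pihomog_mulr _ _ (homF i)) mulrA.
Qed.

(** If n forms in n + 1 variables had no common zero, [forms_power_in_ideal]
    would make every monomial a combination of the finitely many monomials with
    exponents less than N, with coefficients polynomial in the forms. The affine
    space of dimension n + 1 would have dimension at most n, against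
    [dimle_vanish]. *)
Theorem projective_dimension : exists x : 'I_n.+1 -> k,
  (exists j, x j != 0) /\ forall i, (F i).@[x] = 0.
Proof.
have [//|nz] := excluded_middle_informative (exists x : 'I_n.+1 -> k,
  (exists j, x j != 0) /\ forall i, (F i).@[x] = 0).
have nozero (x : 'I_n.+1 -> k) : (forall i, (F i).@[x] = 0) -> forall j, x j = 0.
  move=> Fx j; apply/eqP; apply: contraT => xj.
  by case: nz; exists x; split=> //; exists j.
have /fin_all_exists[N0 /fin_all_exists[b0 Xb0]] := forms_power_in_ideal nozero.
pose N := (\max_j N0 j).+1.
pose Z := fun _ : 'I_n.+1 -> k => True.
pose X : seq (('I_n.+1 -> k) -> k) := [seq (fun x => (F i).@[x]) | i <- enum 'I_n].
pose Y : seq (('I_n.+1 -> k) -> k) := [seq (fun x => x i) | i <- enum 'I_n.+1].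
pose S := {ffun 'I_n.+1 -> 'I_N}.
pose mS (m : S) : 'X_{1..n.+1} := [multinom val (m i) | i < n.+1].
have XE j : exists b : 'I_n -> {mpoly k[n.+1]}, 'X_j ^+ N = \sum_i b i * F i.
  exists (fun i => 'X_j ^+ (N - N0 j) * b0 j i).
  have -> : 'X_j ^+ N = 'X_j ^+ (N - N0 j) * 'X_j ^+ N0 j :> {mpoly k[n.+1]}.
    by rewrite -exprD subnK // leqW // leq_bigmax.
  by rewrite Xb0 mulr_sumr; apply: eq_bigr => i _; rewrite mulrA.
have main d p : p \is d.-homog -> exists a : S -> ('I_n.+1 -> k) -> k,
    (forall m, pf Z X d (a m)) /\ forall x, p.@[x] = \sum_m a m x * ('X_[mS m] : {mpoly k[n.+1]}).@[x].
  elim/ltn_ind: d p => d IHd p hp.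
  have sumP (I : Type) (r : seq I) (c : I -> k) (f : I -> {mpoly k[n.+1]}) :
      (forall i, exists a : S -> ('I_n.+1 -> k) -> k,
        (forall m, pf Z X d (a m)) /\ forall x, (f i).@[x] = \sum_m a m x * ('X_[mS m] : {mpoly k[n.+1]}).@[x]) ->
      exists a : S -> ('I_n.+1 -> k) -> k,
        (forall m, pf Z X d (a m)) /\ forall x, (\sum_(i <- r) c i *: f i).@[x] = \sum_m a m x * ('X_[mS m] : {mpoly k[n.+1]}).@[x].
    move=> fP; elim: r => [|i r [a [pa aE]]].
      exists (fun _ _ => 0); split=> [m|x]; first exact: pf_const.
      by rewrite big_nil meval0 big1 // => m _; rewrite mul0r.
    have [a' [pa' a'E]] := fP i.
    exists (fun m x => c i * a' m x + a m x); split=> [m|x].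
      by apply: pf_add => //; rewrite -[d]add0n; apply: pf_mul => //; apply: pf_const.
    rewrite big_cons mevalD mevalZ a'E aE mulr_sumr -big_split /=.
    by apply: eq_bigr => m _; rewrite mulrDl mulrA.
  rewrite (homog_monE hp); apply: (sumP _ _ _ _) => m; set m0 := mon_val m.
  have dm0 : mdeg m0 = d by apply: mon_valK.
  have [small|/forallPn[j]] := boolP [forall j, (m0 j < N)%N].
    pose s : S := [ffun j => inord (m0 j)].
    have ms : mS s = m0.
      by apply/mnmP => j; rewrite mnmE ffunE /= inordK //; apply: (forallP small).
    exists (fun s' _ => (s' == s)%:R); split=> [s'|x]; first exact: pf_const.
    rewrite (bigD1 s) //= eqxx mul1r big1 ?addr0 ?ms // => s' /negPf->.
    by rewrite mul0r.
  rewrite -leqNgt => le_Nj; have [b bE] := XE j.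
  have jm0 : (U_(j) *+ N <= m0)%MM.
    apply/mnm_lepP => i; rewrite mulmnE mnm1E.
    by case: eqP => [<-|]; rewrite ?mul1n ?mul0n.
  have XF : 'X_[m0] = \sum_i (if (e i <= d)%N then pihomog (@mdeg n.+1) (d - e i) ('X_[(m0 - U_(j) *+ N)] * b i) else 0) * F i.
    transitivity (pihomog (@mdeg n.+1) d 'X_[k, m0]); first by rewrite pihomogX /= dm0 eqxx.
    rewrite -{1}(submK jm0) mpolyXD -mpolyXn bE mulr_sumr (raddf_sum (pihomog (@mdeg n.+1) d)).
    by apply: eq_bigr => i _ /=; rewrite mulrA (pihomog_mulr _ _ (homF i)).
  rewrite XF; rewrite (eq_bigr (fun i => 1 *: ((if (e i <= d)%N then pihomog (@mdeg n.+1) (d - e i) ('X_[(m0 - U_(j) *+ N)] * b i) else 0) * F i))) => [|i _]; last by rewrite scale1r.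
  apply: sumP => i; case: ifP => [le_ed|_]; last first.
    exists (fun _ _ => 0); split=> [s|x]; first exact: pf_const.
    by rewrite mul0r meval0 big1 // => s _; rewrite mul0r.
  have [|a [pa aE]] := IHd (d - e i)%N _ _ (pihomogP (@mdeg n.+1) (d - e i) ('X_[(m0 - U_(j) *+ N)] * b i)).
    by rewrite ltn_subrL e_gt0 (leq_trans (e_gt0 i)).
  exists (fun s x => (F i).@[x] * a s x); split=> [s|x]; last first.
    rewrite mulrC mevalM aE mulr_sumr; apply: eq_bigr => s _; exact: mulrA.
  apply: (@pf_leq _ _ _ _ (1 + (d - e i))); first by move: (e_gt0 i) le_ed; lia.
  apply: pf_mul => //; apply: pf_var.
  exact: (In_enum_map (fun i (x : 'I_n.+1 -> k) => (F i).@[x])).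
have pfY D f : pf Z Y D f -> exists p : {mpoly k[n.+1]}, (msize p <= D.+1)%N /\ forall x, f x = p.@[x].
  elim=> {D f} [D c|D f fY|D f g _ [p [sp pE]] _ [q [sq qE]]|D E f g _ [p [sp pE]] _ [q [sq qE]]|D f g _ [p [sp pE]] fg].
  - by exists c%:MP; split=> [|x]; rewrite ?mevalC // msizeC (leq_trans (leq_b1 _)).
  - have [i ->] := In_map_enum fY.
    by exists 'X_i; split=> [|x]; rewrite ?mevalXU // msizeX mdeg1.
  - exists (p + q); split=> [|x]; last by rewrite mevalD pE qE.
    by apply: leq_trans (msizeD_le _ _) _; rewrite geq_max sp.
  - exists (p * q); split=> [|x]; last by rewrite mevalM pE qE.
    have [->|p0] := eqVneq p 0; first by rewrite mul0r msize0.
    have [->|q0] := eqVneq q 0; first by rewrite mulr0 msize0.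
    by rewrite msizeM // -subn1 leq_subLR add1n -addSn -addnS leq_add.
  - by exists p; split=> // x; rewrite -fg.
have dX : dimle Z X n.
  have := dimle_cat X (dimle0 k Z); rewrite cats0 add0n; apply: dimle_leq.
  by rewrite size_map -cardE card_ord.
have dY : dimle Z Y n.
  apply: (dimle_finite (m := fun (s : S) x => ('X_[mS s] : {mpoly k[n.+1]}).@[x]) _ dX).
  move=> D f /pfY[p [sp fE]].
  have /fin_all_exists[a aP] (i : 'I_D.+1) := main i _ (pihomogP (@mdeg n.+1) i p).
  exists (fun s x => \sum_i a i s x); split=> [s|x _].
    apply: pf_sum => i _; have [pa _] := aP i.
    by apply: pf_leq (pa s); rewrite -ltnS.
  rewrite fE (pihomog_partitionE sp) (raddf_sum (meval x)).
  under [RHS]eq_bigr do rewrite mulr_suml.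
  by rewrite exchange_big /=; apply: eq_bigr => i _; have [_ ->] := aP i.
have [||P [P0 PZ]] := @dimle_vanish k _ Z Y n 'I_n.+1 (fun i x => x i) dY.
- by move=> i; apply: pfun_var; apply: (In_enum_map (fun i (x : 'I_n.+1 -> k) => x i)).
- by rewrite card_ord.
have [y] := mpoly_nonzero_point P0.
have := PZ (fun i => y (enum_rank i)) I.
rewrite (meval_eq (v2 := y)) => [->|i]; last by rewrite enum_valK.
by rewrite eqxx.
Qed.
End ProjectiveDimension.

(** * Linear substitutions and involutions *)

Section Pullback.
Variables (k : closedFieldType) (n : nat).
Implicit Types (h g : 'M[k]_n.+1) (p q : {mpoly k[n.+1]}).

Definition linform (u : 'rV[k]_n.+1) : {mpoly k[n.+1]} := \sum_j u 0 j *: 'X_j.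

Lemma pullbackD h p q : pullback h (p + q) = pullback h p + pullback h q.
Proof. exact: comp_mpolyD. Qed.
Lemma pullbackB h p q : pullback h (p - q) = pullback h p - pullback h q.
Proof. exact: comp_mpolyB. Qed.
Lemma pullback0 h : pullback h 0 = 0.
Proof. exact: comp_mpoly0. Qed.
Lemma pullbackM h p q : pullback h (p * q) = pullback h p * pullback h q.
Proof. exact: rmorphM. Qed.
Lemma pullbackZ h c p : pullback h (c *: p) = c *: pullback h p.
Proof. exact: comp_mpolyZ. Qed.
Lemma pullback_sum h (I : Type) (r : seq I) (P : pred I) (F : I -> {mpoly k[n.+1]}) :
  pullback h (\sum_(i <- r | P i) F i) = \sum_(i <- r | P i) pullback h (F i).
Proof. exact: raddf_sum. Qed.

Lemma pullbackX h m : pullback h 'X_[m] = \prod_i linform (row i h) ^+ m i.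
Proof.
rewrite /pullback comp_mpolyX; apply: eq_bigr => i _; rewrite tnth_mktuple.
by congr (_ ^+ _); apply: eq_bigr => j _; rewrite mxE.
Qed.

Lemma pullbackXU h i : pullback h 'X_i = linform (row i h).
Proof.
rewrite /pullback comp_mpolyXU -tnth_nth tnth_mktuple.
by apply: eq_bigr => j _; rewrite mxE.
Qed.

Lemma pullback_lin h u : pullback h (linform u) = linform (u *m h).
Proof.
rewrite pullback_sum; under eq_bigr do rewrite pullbackZ pullbackXU scaler_sumr.
rewrite exchange_big; apply: eq_bigr => j _; rewrite mxE scaler_suml.
by apply: eq_bigr => i _; rewrite mxE scalerA.
Qed.

Lemma pullback_comp h g p : pullback h (pullback g p) = pullback (g *m h) p.
Proof.
rewrite /pullback comp_mpolyA; congr (_ \mPo _); apply: eq_from_tnth => i.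
rewrite !tnth_mktuple.
have := pullback_lin h (row i g); rewrite /pullback /linform -row_mul.
by under eq_bigr do rewrite mxE; under [in X in _ = X -> _]eq_bigr do rewrite mxE.
Qed.

Lemma pullback1 p : pullback 1%:M p = p.
Proof.
rewrite /pullback -[RHS]comp_mpoly_id; congr (_ \mPo _); apply: eq_from_tnth => i.
rewrite !tnth_mktuple (bigD1 i) //= mxE eqxx scale1r big1 ?addr0 // => j /negPf ji.
by rewrite mxE eq_sym ji scale0r.
Qed.

Lemma pullback_inj h : h \in unitmx -> injective (pullback h).
Proof.
move=> hu p q /(congr1 (pullback (invmx h))); rewrite !pullback_comp mulmxV //.
by rewrite !pullback1.
Qed.

Lemma linform_homog u : linform u \is 1.-homog.
Proof. by apply: rpred_sum => j _; apply: rpredZ; rewrite dhomogX /= mdeg1. Qed.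

Lemma dhomog_bigprod (I : Type) (r : seq I) (F : I -> {mpoly k[n.+1]}) (e : I -> nat) :
  (forall i, F i \is (e i).-homog) ->
  \prod_(i <- r) F i \is (\sum_(i <- r) e i).-homog.
Proof.
move=> hF; elim: r => [|i r IHr]; first by rewrite !big_nil dhomog1.
by rewrite !big_cons; apply: dhomogM.
Qed.

Lemma pullback_homog h d p : p \is d.-homog -> pullback h p \is d.-homog.
Proof.
move=> hp; rewrite (homog_monE hp) pullback_sum; apply: rpred_sum => m _.
rewrite pullbackZ; apply: rpredZ; rewrite pullbackX.
suff: \prod_i linform (row i h) ^+ mon_val m i \is (\sum_i mon_val m i).-homog.
  by rewrite -mdegE mon_valK.
apply: dhomog_bigprod => i; rewrite -[X in X.-homog]mul1n.
exact: dhomogMn (linform_homog _).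
Qed.

Lemma meval_linform u (x : 'I_n.+1 -> k) : (linform u).@[x] = \sum_j u 0 j * x j.
Proof. by rewrite raddf_sum; apply: eq_bigr => j _; rewrite /= mevalZ mevalXU. Qed.

Lemma meval_pullback h p (x : 'cV[k]_n.+1) :
  (pullback h p).@[fun j => x j 0] = p.@[fun j => (h *m x) j 0].
Proof.
rewrite /pullback comp_mpoly_meval; apply: meval_eq => i; rewrite tnth_mktuple raddf_sum mxE.
by apply: eq_bigr => j _; rewrite /= mevalZ mevalXU.
Qed.

Lemma pullback_scalar (a : k) d p : p \is d.-homog -> pullback a%:M p = a ^+ d *: p.
Proof.
move=> hp; rewrite {1}(homog_monE hp) pullback_sum [in RHS](homog_monE hp) scaler_sumr.
apply: eq_bigr => m _; rewrite pullbackZ scalerA mulrC -scalerA; congr (_ *: _).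
have -> : a ^+ d = \prod_i a ^+ mon_val m i by rewrite prodrXr -mdegE mon_valK.
rewrite pullbackX mpolyXE_id -scaler_prod.
apply: eq_bigr => i _; rewrite -exprZn; congr (_ ^+ _).
rewrite /linform (bigD1 i) //= !mxE eqxx big1 ?addr0 // => j /negPf ji.
by rewrite !mxE eq_sym ji scale0r.
Qed.

Lemma pfunm_pullback (T : Type) (Z : T -> Prop) X d (h : T -> 'M[k]_n.+1) (f : T -> {mpoly k[n.+1]}) :
  (forall t, Z t -> f t \is d.-homog) -> pfunm Z X f ->
  (forall i j, pfun Z X (fun t => h t i j)) -> pfunm Z X (fun t => pullback (h t) (f t)).
Proof.
move=> hf pf ph.
apply: (@pfunm_ext _ _ _ _ _ (fun t => \sum_(m : mon n.+1 d) (f t)@_(mon_val m) *: pullback (h t) 'X_[mon_val m])).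
  apply: pfunm_sum => m; apply: pfunm_scale => //.
  apply: (@pfunm_ext _ _ _ _ _ (fun t => \prod_i linform (row i (h t)) ^+ mon_val m i)).
    apply: pfunm_prod => i; apply: pfunm_exp; apply: pfunm_sum => j.
    apply: pfunm_scale; last exact: pfunm_const.
    by apply: pfun_ext (ph i j) _ => t _; rewrite mxE.
  by move=> t _; rewrite pullbackX.
move=> t /hf hft; rewrite [in RHS](homog_monE hft) pullback_sum.
by apply: eq_bigr => m _; rewrite pullbackZ.
Qed.

End Pullback.

Section NormalForm.
Variable k : fieldType.

(** Blocks of a basis adapted to N: the rows of P N span the image, z
    completes them to a basis of the kernel, and P lifts the image. *)
Lemma sqz_blocks m (N : 'M[k]_m) : N *m N = 0 ->
  exists (r t : nat) (P : 'M[k]_(r, m)) (z : 'M[k]_(t, m)),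
    [/\ r = \rank N, m = (r + (r + t))%N, z *m N = 0, row_free (P *m N) &
        forall (b : 'rV_r) (c : 'rV_t), b *m (P *m N) + c *m z = 0 -> b = 0 /\ c = 0].
Proof.
move=> NN0; have /submxP[P PN] : (row_base N <= N)%MS by rewrite eq_row_base.
pose K := (kermx N :\: N)%MS.
have sNK : (N <= kermx N)%MS by apply/sub_kermxP.
have rK : (\rank N + \rank K)%N = (m - \rank N)%N.
  rewrite -mxrank_ker -(mxrank_cap_compl (kermx N) N); congr (_ + _)%N.
  by rewrite (capmx_idPr sNK).
exists (\rank N), (\rank K), P, (row_base K); split=> //.
- by rewrite rK subnKC ?rank_leq_row.
- by apply/sub_kermxP; rewrite eq_row_base diffmxSl.
- by rewrite -PN row_base_free.
- move=> b c; rewrite -PN => /eqP; rewrite addr_eq0 => /eqP bc.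
  have : (b *m row_base N <= K :&: N)%MS.
    rewrite sub_capmx; apply/andP; split; last by rewrite -(eq_row_base N) submxMl.
    by rewrite bc -mulNmx -(eq_row_base K) submxMl.
  rewrite capmx_diff submx0 => /eqP b0.
  have b_eq0 : b = 0 by apply: (row_free_inj (row_base_free N)); rewrite mul0mx.
  split=> //; apply: (row_free_inj (row_base_free K)); rewrite mul0mx.
  by move: bc; rewrite b0 => /eqP; rewrite eq_sym oppr_eq0 => /eqP.
Qed.

Definition swn (r i : nat) : nat :=
  if (i < r)%N then (i + r)%N else if (i < r + r)%N then (i - r)%N else i.

(** The exchange of i and i + r for i < r, which is the standard form of
    1 + N for N of rank r. *)
Definition sw r m (i : 'I_m) : 'I_m := insubd i (swn r i).

Lemma val_sw r m (i : 'I_m) : (r + r <= m)%N -> sw r i = swn r i :> nat.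
Proof.
move=> le_rm; rewrite /sw -[LHS]/(val _) val_insubd /swn; have := ltn_ord i.
by case: ifP => //; repeat case: ifP; lia.
Qed.

Lemma swK r m : (r + r <= m)%N -> involutive (@sw r m).
Proof.
move=> le_rm i; apply: val_inj; rewrite /= !val_sw // /swn; have := ltn_ord i.
by repeat case: ifP; lia.
Qed.

(** In characteristic 2 the involution 1 + N exchanges the rows of P with
    those of P + P N and fixes those of z, in the notation of [sqz_blocks]. *)
Lemma sqz_normal m (N : 'M[k]_m) : 2%N \in [pchar k] -> N *m N = 0 ->
  exists2 S : 'M[k]_m, S \in unitmx &
    forall i, row i (S *m (1%:M + N)) = row (sw (\rank N) i) S.
Proof.
move=> char2 NN0; have [r [t [P [z [<- em zN PNf indep]]]]] := sqz_blocks NN0.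
have PNN : P *m N *m N = 0 by rewrite -mulmxA NN0 mulmx0.
have two0 p q (A : 'M[k]_(p, q)) : A + A = 0.
  by apply/matrixP => i j; rewrite !mxE addrr_pchar2.
have le_rm : (r + r <= m)%N by rewrite em addnA leq_addr.
subst m; pose S : 'M[k]_(r + (r + t)) := col_mx P (col_mx (P + P *m N) z).
exists S.
  rewrite -row_free_unit; apply: inj_row_free => v.
  rewrite -[v]hsubmxK -[rsubmx v]hsubmxK /S !mul_row_col mulmxDr.
  set a := lsubmx v; set b := lsubmx _; set c := rsubmx _ => E.
  have ab0 : a + b = 0.
    apply: (row_free_inj PNf); rewrite mul0mx.
    have := congr1 (mulmx^~ N) E; rewrite !mulmxDl -!mulmxA zN (mulmxA P N) PNN !mulmx0 mul0mx !addr0.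
    by [].
  have [|b0 c0] := indep b c.
    move: E; rewrite !addrA -mulmxDl ab0 mul0mx add0r.
    done.
  by move: ab0; rewrite b0 addr0 => ->; rewrite c0 !row_mx0.
move=> i; rewrite mulmxDr mulmx1 /S !mul_col_mx zN mulmxDl PNN addr0 !add_col_mx addr0.
rewrite -addrA two0 addr0.
case: (split_ordP i) => j ->.
  have -> : sw r (lshift (r + t) j) = rshift r (lshift t j).
    by apply: val_inj; rewrite /= val_sw // /swn /= ltn_ord addnC.
  by rewrite rowKu rowKd rowKu.
case: (split_ordP j) => l ->.
  have -> : sw r (rshift r (lshift t l)) = lshift (r + t) l.
    by apply: val_inj; rewrite /= val_sw // /swn /= ltnNge leq_addr ltn_add2l ltn_ord addKn.
  by rewrite !rowKd !rowKu.
have -> : sw r (rshift r (rshift r l)) = rshift r (rshift r l).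
  by apply: val_inj; rewrite /= val_sw // /swn /= addnA !ltnNge leq_addr -addnA leq_addr.
by rewrite !rowKd.
Qed.
End NormalForm.

Definition swm r n (m : 'X_{1..n}) : 'X_{1..n} := [multinom m (sw r i) | i < n].

Lemma swmE r n (m : 'X_{1..n}) i : swm r m i = m (sw r i).
Proof. by rewrite mnmE. Qed.

Lemma swmK r n : (r + r <= n)%N -> involutive (@swm r n).
Proof. by move=> le_rn m; apply/mnmP => i; rewrite !swmE swK. Qed.

Lemma mdeg_swm r n (m : 'X_{1..n}) : (r + r <= n)%N -> mdeg (swm r m) = mdeg m.
Proof.
move=> le_rn; rewrite !mdegE [RHS](reindex (@sw r n)) /=.
  by apply: eq_bigr => i _; rewrite swmE.
exact: onW_bij (inv_bij (swK le_rn)).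
Qed.

(** The exchange of variables has at least rho two-element orbits on the
    monomials of degree d. The last clause with a = b excludes fixed monomials,
    and with a <> b two representatives of the same orbit. *)
Definition swap_orbits r n d rho := exists (J : finType) (q : J -> 'X_{1..n}),
  [/\ (rho <= #|J|)%N, injective q, forall j, mdeg (q j) = d &
      forall a b, swm r (q a) != q b].

Section DifferenceOperator.
Variables (k : closedFieldType) (n : nat).
Hypothesis char2 : 2%N \in [pchar k].

Definition Dop (N : 'M[k]_n.+1) (p : {mpoly k[n.+1]}) := pullback (1%:M + N) p - p.

Lemma Dop_linear N a p q : Dop N (a *: p + q) = a *: Dop N p + Dop N q.
Proof. by rewrite /Dop pullbackD pullbackZ opprD addrACA -scalerBr. Qed.

Lemma Dop_scalar N m : scalar (fun p => (Dop N p)@_m).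
Proof. by move=> a u v; rewrite Dop_linear mcoeffD mcoeffZ. Qed.

Lemma Dop_homog N d p : p \is d.-homog -> Dop N p \is d.-homog.
Proof. by move=> hp; apply: rpredB => //; apply: pullback_homog. Qed.

(** In the coordinates of [sqz_normal], D maps a monomial m to swm m - m;
    for m in different two-element orbits these differences are independent. *)
Lemma Dop_indep (N : 'M[k]_n.+1) d rho : N *m N = 0 -> swap_orbits (\rank N) n.+1 d rho ->
  exists (J : finType) (w : J -> {mpoly k[n.+1]}),
     [/\ (rho <= #|J|)%N, forall j, w j \is d.-homog &
         forall c : J -> k, \sum_j c j *: Dop N (w j) = 0 -> forall j, c j = 0].
Proof.
move=> NN0 [J [q [leJ injq dq swq]]]; have [S Su SE] := sqz_normal char2 NN0.
have le_rn : (\rank N + \rank N <= n.+1)%N by rewrite addnn -mul2n sqz_rank.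
have DE m : Dop N (pullback S 'X_[m]) = pullback S ('X_[swm (\rank N) m] - 'X_[m]).
  rewrite /Dop pullback_comp pullbackB; congr (_ - _).
  rewrite !pullbackX [RHS](reindex (@sw (\rank N) n.+1)) /=.
    by apply: eq_bigr => i _; rewrite SE swmE swK.
  exact: onW_bij (inv_bij (swK le_rn)).
exists J, (fun j => pullback S 'X_[q j]); split=> // [j|c].
  by apply: pullback_homog; rewrite dhomogX /= dq.
under eq_bigr do rewrite DE -pullbackZ.
rewrite -pullback_sum -[RHS](pullback0 S) => /(pullback_inj Su) E i.
have := congr1 (mcoeff (q i)) E; rewrite mcoeff0 raddf_sum (bigD1 i) //= big1 => [|j ji].
  rewrite mcoeffZ mcoeffB !mcoeffX eqxx (negPf (swq _ _)) sub0r addr0 mulrN1.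
  by move/eqP; rewrite oppr_eq0 => /eqP.
by rewrite mcoeffZ mcoeffB !mcoeffX (negPf (swq _ _)) (inj_eq injq) (negPf ji) subr0 mulr0.
Qed.

Lemma pfun_Dop (T : Type) (Z : T -> Prop) X d (N : T -> 'M[k]_n.+1) (f : T -> {mpoly k[n.+1]}) :
  (forall i j, pfun Z X (fun t => N t i j)) ->
  (forall t, Z t -> f t \is d.-homog) -> pfunm Z X f ->
  pfunm Z X (fun t => Dop (N t) (f t)).
Proof.
move=> pN hf pf; apply: pfunm_sub => //; apply: (pfunm_pullback hf pf) => i j.
apply: (pfun_ext (pfun_add (pfun_const Z X ((1%:M : 'M[k]_n.+1) i j)) (pN i j))) => t _.
by rewrite [RHS]mxE.
Qed.

Lemma pfun_DopX (T : Type) (Z : T -> Prop) X (N : T -> 'M[k]_n.+1) m m' :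
  (forall i j, pfun Z X (fun t => N t i j)) ->
  pfun Z X (fun t => (Dop (N t) 'X_[m])@_m').
Proof.
move=> pN; apply: (@pfun_Dop _ _ _ (mdeg m)) => // [t _|]; last exact: pfunm_const.
by rewrite dhomogX.
Qed.

Lemma adjoins_Dop (T : Type) (Z : T -> Prop) X d rho r (N : T -> 'M[k]_n.+1)
    (f b : T -> {mpoly k[n.+1]}) :
  (forall i j, pfun Z X (fun t => N t i j)) ->
  (forall t, Z t -> N t *m N t = 0) -> (forall t, Z t -> \rank (N t) = r) ->
  (forall t, Z t -> f t \is d.-homog) -> pfunm Z X b ->
  (forall t, Z t -> Dop (N t) (f t) = b t) -> swap_orbits r n.+1 d rho ->
  adjoins Z X (coefs d f) (#|mon n.+1 d| - rho).
Proof.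
move=> pN NN0 rN hf pb Df nf.
apply: (@adjoins_form _ _ _ _ _ _ _ (mon n.+1 d) (fun m t p => (Dop (N t) p)@_(mon_val m))
  (fun m t => (b t)@_(mon_val m))) => // [m t|m m'|m t Zt|t Zt].
- exact: Dop_scalar.
- exact: pfun_DopX.
- by rewrite Df.
- have := nf; rewrite -(rN t Zt) => /(Dop_indep (NN0 t Zt))[J [w [leJ hw indep]]].
  exists J, w; split=> // c cE; apply: indep.
  have hs : \sum_j c j *: Dop (N t) (w j) \is d.-homog.
    by apply: rpred_sum => j _; apply: rpredZ; apply: Dop_homog.
  rewrite (homog_monE hs) big1 // => m _; rewrite raddf_sum /=.
  under eq_bigr do rewrite mcoeffZ.
  by rewrite cE scale0r.
Qed.

Lemma adjoins_free_form (T : Type) (Z : T -> Prop) X d (f : T -> {mpoly k[n.+1]}) :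
  adjoins Z X (coefs d f) #|mon n.+1 d|.
Proof. by rewrite -(size_coefs d f); apply: adjoins_free. Qed.
End DifferenceOperator.

(** * Counting orbits of monomials *)

Section MonomialOrbits.
Local Open Scope nat_scope.

Section Pairs.
Variable m : nat.
Implicit Types (W : {set 'I_m}).

Definition opairs W : finType :=
  {p : 'I_m * 'I_m | [&& p.1 \in W, p.2 \in W & p.1 <= p.2]}.

Lemma card_opairs W : 2 * #|opairs W| = #|W| * #|W|.+1.
Proof.
rewrite card_sig.
pose A := [set p : 'I_m * 'I_m | [&& p.1 \in W, p.2 \in W & p.1 <= p.2]].
pose B := [set p : 'I_m * 'I_m | [&& p.1 \in W, p.2 \in W & p.2 <= p.1]].
have -> : #|[pred p : 'I_m * 'I_m | [&& p.1 \in W, p.2 \in W & p.1 <= p.2]]| = #|A|.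
  by apply: eq_card => p; rewrite !inE.
have AB : #|A| = #|B|.
  have swap_inj : injective (fun p : 'I_m * 'I_m => (p.2, p.1)) by move=> [a b] [c d] [-> ->].
  rewrite -(card_imset _ swap_inj); apply: eq_card => -[a b]; apply/imsetP/idP => [[[c d]]|].
    by rewrite !inE /= => /and3P[cW dW le] [-> ->]; rewrite cW dW.
  by rewrite !inE /= => /and3P[aW bW le]; exists (b, a); rewrite ?inE /= ?aW ?bW.
have AUB : #|A :|: B| = #|W| * #|W|.
  rewrite -cardsX; apply: eq_card => -[a b]; rewrite !inE /=.
  by case: (a \in W) => //=; case: (b \in W) => //=; case: leqP => //= /ltnW.
have AIB : #|A :&: B| = #|W|.
  have diag_inj : injective (fun a : 'I_m => (a, a)) by move=> a b [->].
  rewrite -(card_imset _ diag_inj); apply: eq_card => -[a b]; apply/idP/imsetP => [|[c cW [-> ->]]].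
    rewrite !inE /= => /andP[/and3P[aW bW le1] /and3P[_ _ le2]].
    by exists a => //; congr (_, _); apply: val_inj; apply/eqP; rewrite eqn_leq le2 le1.
  by rewrite !inE /= cW leqnn.
by have := cardsUI A B; rewrite AUB AIB -AB mulnS addnC mul2n -addnn => ->.
Qed.

Definition opsum W (p : opairs W) : 'X_{1..m} := (U_((val p).1) + U_((val p).2))%MM.

Lemma opsum_inj W : injective (@opsum W).
Proof.
move=> [[a b] /= H1] [[c d] /= H2]; have /and3P[_ _ /= le1] := H1; have /and3P[_ _ /= le2] := H2.
rewrite /opsum /= => E; apply: val_inj => /=.
have U_inj i j : (U_(i) = U_(j) :> 'X_{1..m})%MM -> i = j.
  by move/eqP; rewrite eq_mnm1 => /eqP.
have := congr1 (fun u : 'X_{1..m} => u a) E; rewrite !mnmDE !mnm1E eqxx.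
have [ca|_] := eqVneq c a; first by subst c => _; move: E => /addmI/U_inj ->.
have [da|_] := eqVneq d a; last by [].
move=> _; subst d.
have /addmI/U_inj bc : (U_(a) + U_(b) = U_(a) + U_(c))%MM by rewrite E addmC.
by subst c; congr (_, _); apply: val_inj => /=; apply/eqP; rewrite eqn_leq le1 le2.
Qed.

Lemma mdeg_opsum W (p : opairs W) : mdeg (opsum p) = 2.
Proof. by rewrite mdegD !mdeg1. Qed.

Lemma opsum_out W (p : opairs W) i : i \notin W -> opsum p i = 0.
Proof.
case: p => [[a b] /= H]; have /and3P[/= aW bW _] := H => iW.
rewrite mnmDE !mnm1E; case: eqP => [E|_]; first by rewrite -E aW in iW.
by case: eqP => [E|//]; rewrite -E bW in iW.
Qed.

Lemma card_opairs_compl (s : seq 'I_m) : uniq s ->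
  2 * #|opairs (~: [set x in s])| = (m - size s) * (m - size s).+1.
Proof.
move=> us; rewrite card_opairs.
suff -> : #|~: [set x in s]| = m - size s by [].
have := cardsC [set x in s]; rewrite card_ord cardsE (card_uniqP us) => E.
by rewrite -[X in X - _]E addKn.
Qed.
End Pairs.

Lemma inj_sum (A B C : Type) (f : A -> C) (g : B -> C) : injective f -> injective g ->
  (forall a b, f a <> g b) -> injective (fun s : A + B => match s with inl a => f a | inr b => g b end).
Proof.
by move=> If Ig fg [a|b] [a'|b'] //; [move/If->|move/fg|move/esym/fg|move/Ig->].
Qed.

Section Selection.
Variables (r m : nat).
Hypothesis le_rm : r + r <= m.

(** A rule that selects at most one monomial of each orbit and no fixed one:
    compare the exponents of x0 and of its partner and, if they are equal, those
    of x1 and its partner. Two pairs of variables suffice for the counts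
    below. *)
Definition selected (x0 x1 : 'I_m) (u : 'X_{1..m}) : bool :=
  (u (sw r x0) < u x0) || (u x0 == u (sw r x0)) && (u (sw r x1) < u x1).

Definition nselected x0 x1 d := #|[pred u : mon m d | selected x0 x1 (mon_val u)]|.

Lemma swap_orbits_sel x0 x1 d : swap_orbits r m d (nselected x0 x1 d).
Proof.
exists {u : mon m d | selected x0 x1 (mon_val u)}, (fun u => mon_val (val u)); split.
- by rewrite card_sig.
- by move=> u v /mon_val_inj/val_inj.
- by move=> u; apply: mon_valK.
- move=> [u su] [v sv] /=; apply/eqP => E; move: sv; rewrite -E /selected !swmE !swK //.
  move: su; rewrite /selected; lia.
Qed.

Lemma leq_nselected x0 x1 d (I : finType) (f : I -> 'X_{1..m}) : injective f ->
  (forall i, mdeg (f i) = d) -> (forall i, selected x0 x1 (f i)) -> #|I| <= nselected x0 x1 d.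
Proof.
move=> If df sf; have dfb i : mdeg (f i) == d by rewrite df.
pose g i := mon_of (dfb i).
have Ig : injective g by move=> i j /(congr1 (@mon_val _ _)) /If.
rewrite -(card_image Ig) subset_leq_card //; apply/subsetP => u /imageP[i _ ->].
by rewrite inE; apply: sf.
Qed.
End Selection.

(** Representatives: x_i x_j for i <= j < r, x_i y_j for j < i < r, where y_j
    is the partner of x_j, and x_i z for z among the m - 2 r fixed variables. *)
Lemma swap_orbits_quadric r m : r + r <= m -> swap_orbits r m 2 (r * (m - r)).
Proof.
move=> le_rm; have [->|r0] := posnP r.
  by exists void, (fun j : void => match j with end); split=> [|[]|[]|[]]; rewrite ?card_void.
have m0 : 0 < m by lia.
pose o i : 'I_m := insubd (Ordinal m0) i.
have oE i : i < m -> o i = i :> nat by move=> lt; rewrite /o -[LHS]/(val _) val_insubd lt.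
pose y (i : 'I_r) (j : 'I_(m - r)) : nat := if (j < r) && (i <= j) then (j : nat) else (j : nat) + r.
have y_lt i j : y i j < m.
  by rewrite /y; have := ltn_ord j; have := ltn_ord i; case: ifP; lia.
pose q (p : 'I_r * 'I_(m - r)) : 'X_{1..m} := (U_(o p.1) + U_(o (y p.1 p.2)))%MM.
have U_inj (a b : 'I_m) : (U_(a) = U_(b) :> 'X_{1..m})%MM -> a = b.
  by move/eqP; rewrite eq_mnm1 => /eqP.
have pair (a b c d : 'I_m) : (U_(a) + U_(b) = U_(c) + U_(d))%MM ->
    a = c /\ b = d \/ a = d /\ b = c.
  move=> E; have := congr1 (fun u : 'X_{1..m} => u a) E; rewrite !mnmDE !mnm1E eqxx.
  have [ca|_] := eqVneq c a; first by subst c => _; left; move: E => /addmI/U_inj ->.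
  have [da|_] := eqVneq d a; last by [].
  by move=> _; subst d; right; split=> //; move: E; rewrite [RHS]addmC => /addmI/U_inj.
have le_rm' : r <= m by lia.
have swU (a : 'I_m) : swm r U_(a) = U_(sw r a)%MM.
  by apply/mnmP => i; rewrite swmE !mnm1E -(inj_eq (inv_inj (swK le_rm))) swK.
have swD (u v : 'X_{1..m}) : swm r (u + v)%MM = (swm r u + swm r v)%MM.
  by apply/mnmP => i; rewrite swmE !mnmDE !swmE.
exists ('I_r * 'I_(m - r))%type, q; split.
- by rewrite card_prod !card_ord.
- move=> [i j] [i' j'] /pair/= H.
  have := ltn_ord i; have := ltn_ord i'; have := ltn_ord j; have := ltn_ord j'.
  move=> lj' lj li' li.
  have vals : (i = i' :> nat /\ y i j = y i' j') \/ (i = y i' j' :> nat /\ y i j = i' :> nat).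
    by case: H => -[/(congr1 val)/= + /(congr1 val)/=]; rewrite !oE ?y_lt //; lia.
  suff [ei ej] : i = i' :> nat /\ j = j' :> nat.
    by congr (_, _); apply: val_inj.
  by move: vals; rewrite /y; do 2!case: ifP; lia.
- by move=> p; rewrite mdegD !mdeg1.
- move=> [i j] [i' j'] /=; apply/eqP; rewrite swD !swU => /pair H.
  have := ltn_ord i; have := ltn_ord i'; have := ltn_ord j; have := ltn_ord j'.
  move=> lj' lj li' li.
  have vals : (swn r i = i' :> nat /\ swn r (y i j) = y i' j') \/ (swn r i = y i' j' /\ swn r (y i j) = i' :> nat).
    by case: H => -[/(congr1 val)/= + /(congr1 val)/=]; rewrite !val_sw // !oE ?y_lt //; lia.
  by move: vals; rewrite /swn li /y; do 2!case: ifP; repeat case: ifP; lia.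
Qed.

Lemma swap_orbits_leq r n d rho rho' : rho' <= rho -> swap_orbits r n d rho -> swap_orbits r n d rho'.
Proof. by move=> le [J [q [leJ *]]]; exists J, q; split=> //; apply: leq_trans leJ. Qed.

Lemma cubic_count_rank2 m w0 w1 a : 3 < m -> 4 * a <= m * m -> 2 * w1 = (m - 3) * (m - 2) -> 2 * w0 = (m - 1) * m -> (2 * a).+1 <= w0 + (1 + (w1 + 1)).
Proof.
move=> m4; have -> : m = (m - 4) + 4 by lia.
move: (m - 4) => e.
have -> : e + 4 - 3 = e + 1 by lia.
have -> : e + 4 - 2 = e + 2 by lia.
have -> : e + 4 - 1 = e + 3 by lia.
nia.
Qed.

Lemma pair_count_rank2 m w0 w1 a : 3 < m -> 4 * a <= m * m -> 2 * w1 = (m - 3) * (m - 2) -> 2 * w0 = (m - 2) * (m - 1) ->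
  a + m - 3 <= w0 + (1 + (w1 + 1)).
Proof.
move=> m4; have -> : m = (m - 4) + 4 by lia.
move: (m - 4) => e.
have -> : e + 4 - 3 = e + 1 by lia.
have -> : e + 4 - 2 = e + 2 by lia.
have -> : e + 4 - 1 = e + 3 by lia.
nia.
Qed.

Lemma cubic_count_rank1 m w0 : 3 < m -> 2 * w0 = (m - 1) * m -> (2 * (1 * (m - 1))).+1 <= w0 + 1.
Proof.
move=> m4; have -> : m = (m - 4) + 4 by lia.
move: (m - 4) => e.
have -> : e + 4 - 1 = e + 3 by lia.
nia.
Qed.

Lemma pair_count_rank1 m w0 : 3 < m -> 2 * w0 = (m - 2) * (m - 1) ->
  1 * (m - 1) + m - 3 <= w0 + 1.
Proof.
move=> m4; have -> : m = (m - 4) + 4 by lia.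
move: (m - 4) => e.
have -> : e + 4 - 2 = e + 2 by lia.
have -> : e + 4 - 1 = e + 3 by lia.
nia.
Qed.

Section Counting.
Variables (r m : nat).
Hypothesis r_gt0 : 0 < r.
Hypothesis le_rm : r + r <= m.
Hypothesis m_ge4 : 4 <= m.

Lemma rank_product_bound : 4 * (r * (m - r)) <= m * m.
Proof.
have le : r <= m by apply: leq_trans le_rm; rewrite leq_addr.
by have [] := nat_AGM2 r (m - r); rewrite subnKC // mulnn.
Qed.

Lemma m_gt0 : 0 < m. Proof. by lia. Qed.
Definition var i : 'I_m := insubd (Ordinal m_gt0) i.

Lemma var_val i : i < m -> var i = i :> nat.
Proof. by move=> lt; rewrite /var -[LHS]/(val _) val_insubd lt. Qed.

(** The variables x0, y0 form a pair that is exchanged, and so do x1, y1 when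
    r > 1. *)
Definition x0 := var 0.
Definition y0 := var r.
Definition x1 := var 1.
Definition y1 := var r.+1.

Lemma sw_x0 : sw r x0 = y0.
Proof. by apply: val_inj; rewrite /= val_sw // !var_val /swn ?r_gt0 //; lia. Qed.
Lemma sw_y0 : sw r y0 = x0.
Proof. by rewrite -sw_x0 swK. Qed.
Lemma x0y0 : (x0 == y0) = false.
Proof. by apply: negbTE; apply/eqP => /(congr1 val); rewrite /= !var_val; lia. Qed.

Lemma y0x0 : (y0 == x0) = false. Proof. by rewrite eq_sym x0y0. Qed.

Lemma x0y1 : (x0 == y1) = false.
Proof. by apply: negbTE; apply/eqP => /(congr1 val); rewrite /= !var_val; lia. Qed.
Lemma y0y1 : (y0 == y1) = false.
Proof. by apply: negbTE; apply/eqP => /(congr1 val); rewrite /= !var_val; lia. Qed.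

Section TwoPairs.
Hypothesis r_gt1 : 1 < r.
Lemma sw_x1 : sw r x1 = y1.
Proof. by apply: val_inj; rewrite /= val_sw // !var_val /swn ?r_gt1 //; lia. Qed.
Lemma x1y1 : (x1 == y1) = false.
Proof. by apply: negbTE; apply/eqP => /(congr1 val); rewrite /= !var_val; lia. Qed.
Lemma x0x1 : (x0 == x1) = false.
Proof. by apply: negbTE; apply/eqP => /(congr1 val); rewrite /= !var_val; lia. Qed.
Lemma y0x1 : (y0 == x1) = false.
Proof. by apply: negbTE; apply/eqP => /(congr1 val); rewrite /= !var_val; lia. Qed.
Lemma y1x1 : (y1 == x1) = false. Proof. by rewrite eq_sym x1y1. Qed.
Lemma x1x0 : (x1 == x0) = false. Proof. by rewrite eq_sym x0x1. Qed.
Lemma y1x0 : (y1 == x0) = false. Proof. by rewrite eq_sym x0y1. Qed.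
Lemma x1y0 : (x1 == y0) = false. Proof. by rewrite eq_sym y0x1. Qed.
Lemma y1y0 : (y1 == y0) = false. Proof. by rewrite eq_sym y0y1. Qed.
Definition distinct_vars := (x1y1, x0x1, x0y1, y0x1, y0y1, (y1x1, x1x0, y1x0, x1y0, y1y0)).
End TwoPairs.

Local Notation W0 := (~: [set x in [:: y0]]).
Local Notation V0 := (~: [set x in [:: x0; y0]]).
Local Notation W1 := (~: [set x in [:: x0; y0; y1]]).

(** The monomials counted below: in each of them x0 occurs more often than y0,
    or equally often and then x1 more often than y1. The factor c only pads the
    degree. *)
Definition up_pair (c : 'X_{1..m}) (p : opairs W0) := (U_(x0) + opsum p + c)%MM.
Definition up_pair2 (c : 'X_{1..m}) (p : opairs V0) := (U_(x0) + opsum p + c)%MM.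
Definition up_cube (c : 'X_{1..m}) (u : unit) := (U_(x0) + U_(x0) + U_(y0) + c)%MM.
Definition up_pair1 (c : 'X_{1..m}) (p : opairs W1) := (U_(x1) + opsum p + c)%MM.
Definition up_cube1 (c : 'X_{1..m}) (u : unit) := (U_(x1) + U_(x1) + U_(y1) + c)%MM.

Lemma up_pairE c p i : up_pair c p i = (x0 == i) + opsum p i + c i.
Proof. by rewrite /up_pair mnmDE mnmDE mnm1E. Qed.
Lemma up_pair2E c p i : up_pair2 c p i = (x0 == i) + opsum p i + c i.
Proof. by rewrite /up_pair2 mnmDE mnmDE mnm1E. Qed.
Lemma up_cubeE c u i : up_cube c u i = (x0 == i) + (x0 == i) + (y0 == i) + c i.
Proof. by rewrite /up_cube !mnmDE !mnm1E. Qed.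
Lemma up_pair1E c p i : up_pair1 c p i = (x1 == i) + opsum p i + c i.
Proof. by rewrite /up_pair1 mnmDE mnmDE mnm1E. Qed.
Lemma up_cube1E c u i : up_cube1 c u i = (x1 == i) + (x1 == i) + (y1 == i) + c i.
Proof. by rewrite /up_cube1 !mnmDE !mnm1E. Qed.

Lemma opsum_shift_inj W (a c : 'X_{1..m}) : injective (fun p : opairs W => (a + opsum p + c)%MM).
Proof. by move=> p q /addIm/addmI/opsum_inj. Qed.

Lemma unit_inj (A : Type) (f : unit -> A) : injective f.
Proof. by move=> [] []. Qed.

Lemma neq_at (i : 'I_m) (u v : 'X_{1..m}) : u i != v i -> u <> v.
Proof. by move=> /eqP ne E; apply: ne; rewrite E. Qed.

Lemma opsum_y0 (p : opairs W0) : opsum p y0 = 0.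
Proof. by apply: opsum_out; rewrite !inE eqxx. Qed.
Lemma opsum2_x0 (p : opairs V0) : opsum p x0 = 0.
Proof. by apply: opsum_out; rewrite !inE eqxx. Qed.
Lemma opsum2_y0 (p : opairs V0) : opsum p y0 = 0.
Proof. by apply: opsum_out; rewrite !inE eqxx !orbT. Qed.
Lemma opsum3_x0 (p : opairs W1) : opsum p x0 = 0.
Proof. by apply: opsum_out; rewrite !inE eqxx. Qed.
Lemma opsum3_y0 (p : opairs W1) : opsum p y0 = 0.
Proof. by apply: opsum_out; rewrite !inE eqxx !orbT. Qed.
Lemma opsum3_y1 (p : opairs W1) : opsum p y1 = 0.
Proof. by apply: opsum_out; rewrite !inE eqxx !orbT. Qed.

Lemma card_opairs1 : 2 * #|opairs W0| = (m - 1) * m.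
Proof. by rewrite card_opairs_compl //= subn1 prednK // m_gt0. Qed.
Lemma card_opairs2 : 2 * #|opairs V0| = (m - 2) * (m - 1).
Proof. by rewrite card_opairs_compl /= ?inE ?x0y0 //; lia. Qed.
Lemma card_opairs3 : 1 < r -> 2 * #|opairs W1| = (m - 3) * (m - 2).
Proof. by move=> r1; rewrite card_opairs_compl /= ?inE ?x0y0 ?x0y1 ?y0y1 //; lia. Qed.

(** Selected monomials of degree 3, times a power of x0: x0 times two variables
    other than y0, x0 ^ 2 y0, x1 times two variables other than x0, y0, y1, and
    x1 ^ 2 y1. For r = 1 the first two kinds suffice. *)
Lemma swap_orbits_cubic d : 3 <= d -> swap_orbits r m d (2 * (r * (m - r))).+1.
Proof.
move=> d3; pose c := (U_(x0) *+ (d - 3))%MM.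
have degc : mdeg c = d - 3 by rewrite mdegMn mdeg1 mul1n.
have c0 : c x0 = d - 3 by rewrite mulmnE mnm1E eqxx mul1n.
have cy0 : c y0 = 0 by rewrite mulmnE mnm1E x0y0.
have [r1|r1] := leqP r 1.
  have {r1}r1 : r = 1 by lia.
  apply: swap_orbits_leq (swap_orbits_sel le_rm x0 x0 d).
  pose f (s : opairs W0 + unit) := match s with inl a => up_pair c a | inr b => up_cube c b end.
  have card : (2 * (r * (m - r))).+1 <= #|{: opairs W0 + unit}|.
    by rewrite card_sum card_unit r1; apply: (cubic_count_rank1 m_ge4 card_opairs1).
  apply: leq_trans card _; apply: (@leq_nselected _ _ _ _ _ _ f).
  - apply: inj_sum; [exact: opsum_shift_inj|exact: unit_inj|] => p u.
    by apply: (@neq_at y0); rewrite up_pairE up_cubeE x0y0 eqxx opsum_y0 cy0.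
  - by case=> [p|u]; rewrite /f /up_pair /up_cube 1?(mdegD, mdeg_opsum) !(mdegD, mdeg_opsum, mdeg1) degc; lia.
  - case=> [p|u]; rewrite /f /selected sw_x0.
      by rewrite 2!up_pairE x0y0 opsum_y0 c0 cy0 eqxx.
    by rewrite 2!up_cubeE x0y0 y0x0 !eqxx c0 cy0; apply/orP; left; clear; lia.
apply: swap_orbits_leq (swap_orbits_sel le_rm x0 x1 d).
have cy1 : c y1 = 0 by rewrite mulmnE mnm1E (distinct_vars r1).
have cx1 : c x1 = 0 by rewrite mulmnE mnm1E (distinct_vars r1).
pose f (s : opairs W0 + (unit + (opairs W1 + unit))) := match s with inl a => up_pair c a
  | inr b => match b with inl b => up_cube c b | inr b => match b with inl b => up_pair1 c b | inr b => up_cube1 c b end end end.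
have card : (2 * (r * (m - r))).+1 <= #|{: opairs W0 + (unit + (opairs W1 + unit))}|.
  by rewrite !card_sum !card_unit; apply: (cubic_count_rank2 m_ge4 rank_product_bound (card_opairs3 r1) card_opairs1).
apply: leq_trans card _; apply: (@leq_nselected _ _ _ _ _ _ f).
- apply: inj_sum; [exact: opsum_shift_inj| |].
    apply: inj_sum; [exact: unit_inj| |].
      apply: inj_sum; [exact: opsum_shift_inj|exact: unit_inj|] => p u.
      by apply: (@neq_at y1); rewrite up_pair1E up_cube1E opsum3_y1 !(distinct_vars r1) eqxx cy1.
    move=> u [p|u']; apply: (@neq_at y0).
      by rewrite up_cubeE up_pair1E opsum3_y0 x0y0 !(distinct_vars r1) eqxx cy0.
    by rewrite up_cubeE up_cube1E x0y0 !(distinct_vars r1) eqxx cy0.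
  move=> p [u|[p'|u']].
  + by apply: (@neq_at y0); rewrite up_pairE up_cubeE x0y0 eqxx opsum_y0 cy0.
  + by apply: (@neq_at x0); rewrite up_pairE up_pair1E opsum3_x0 !(distinct_vars r1) eqxx c0; clear; lia.
  + by apply: (@neq_at x0); rewrite up_pairE up_cube1E !(distinct_vars r1) eqxx c0; clear; lia.
- by case=> [p|[u|[p|u]]]; rewrite /f /up_pair /up_cube /up_pair1 /up_cube1 1?(mdegD, mdeg_opsum) !(mdegD, mdeg_opsum, mdeg1) degc; lia.
- case=> [p|[u|[p|u]]]; rewrite /f /selected sw_x0 (sw_x1 r1).
  + by rewrite 4!up_pairE x0y0 opsum_y0 eqxx c0 cy0.
  + by rewrite 4!up_cubeE x0y0 y0x0 !eqxx c0 cy0; apply/orP; left; clear; lia.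
  + rewrite 4!up_pair1E opsum3_x0 opsum3_y0 opsum3_y1 !(distinct_vars r1) !eqxx c0 cy0 cx1 cy1.
    by case: (d - 3) => [|e].
  + by rewrite 4!up_cube1E !(distinct_vars r1) !eqxx c0 cy0 cx1 cy1; case: (d - 3) => [|e].
Qed.

Definition nonsel d : finType := {u : mon m d | ~~ selected r x0 x0 (mon_val u)}.

Lemma card_nonsel d : #|mon m d| = nselected r x0 x0 d + #|nonsel d|.
Proof.
rewrite [X in _ + X]card_sig /nselected; apply: etrans (esym (cardC [pred u : mon m d | selected r x0 x0 (mon_val u)])) _.
by congr (_ + _); apply: eq_card => u; rewrite !inE.
Qed.

(** Sends the monomials of degree d that are not selected to selected monomials
    of degree d + 2. *)
Definition up_swap d (u : nonsel d) := (U_(x0) + U_(x0) + swm r (mon_val (val u)))%MM.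

Lemma up_swap_inj d : injective (@up_swap d).
Proof. by move=> u v /addmI/(inv_inj (swmK le_rm))/mon_val_inj/val_inj. Qed.

Lemma up_swap_x0 d (u : nonsel d) : up_swap u x0 = 2 + mon_val (val u) y0.
Proof. by rewrite /up_swap !mnmDE !mnm1E eqxx swmE sw_x0. Qed.

Lemma up_swap_y0 d (u : nonsel d) : up_swap u y0 = mon_val (val u) x0.
Proof. by rewrite /up_swap !mnmDE !mnm1E x0y0 swmE sw_y0. Qed.

Lemma nonsel_le d (u : nonsel d) : mon_val (val u) x0 <= mon_val (val u) y0.
Proof.
by case: u => u /= nu; rewrite leqNgt; apply: contra nu => lt; rewrite /selected sw_x0 lt.
Qed.

Lemma mdeg_up_swap d (u : nonsel d) : mdeg (up_swap u) = d.+2.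
Proof. by rewrite !mdegD !mdeg1 mdeg_swm // mon_valK. Qed.

(** By [up_swap], the selected monomials of degree d are at least as many as
    the monomials of degree d - 2 that are not selected; so the two numbers of
    selected monomials add up to all monomials of degree d - 2, and the surplus
    comes from selected monomials outside the image of [up_swap]. *)
Lemma swap_orbits_pair d : 3 <= d -> exists rho rho', [/\ swap_orbits r m d rho, swap_orbits r m (d - 2) rho' &
  #|mon m (d - 2)| + r * (m - r) + m - 3 <= rho + rho'].
Proof.
move=> d3; pose c := (U_(y1) *+ (d - 3))%MM.
have degc : mdeg c = d - 3 by rewrite mdegMn mdeg1 mul1n.
have c0 : c x0 = 0 by rewrite mulmnE mnm1E eq_sym x0y1.
have cy0 : c y0 = 0 by rewrite mulmnE mnm1E eq_sym y0y1.
have dd : (d - 2).+2 = d by lia.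
have [r1|r1] := leqP r 1.
  have {r1}r1 : r = 1 by lia.
  exists (nselected r x0 x0 d), (nselected r x0 x0 (d - 2)); split; try exact: swap_orbits_sel.
  pose f (s : nonsel (d - 2) + (opairs V0 + unit)) := match s with inl u => up_swap u
    | inr s => match s with inl a => up_pair2 c a | inr b => up_cube c b end end.
  suff : #|{: nonsel (d - 2) + (opairs V0 + unit)}| <= nselected r x0 x0 d.
    rewrite !card_sum card_unit card_nonsel r1; have := pair_count_rank1 m_ge4 card_opairs2.
    by clear; lia.
  apply: (@leq_nselected _ _ _ _ _ _ f).
  - apply: inj_sum; [exact: up_swap_inj| |].
      apply: inj_sum; [exact: opsum_shift_inj|exact: unit_inj|] => p u.
      by apply: (@neq_at y0); rewrite up_pair2E up_cubeE x0y0 opsum2_y0 eqxx cy0.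
    move=> u [p|u'] E; have := nonsel_le u; have := up_swap_x0 u; have := up_swap_y0 u.
      by rewrite E 2!up_pair2E x0y0 opsum2_y0 opsum2_x0 eqxx cy0 c0; clear; lia.
    by rewrite E 2!up_cubeE x0y0 y0x0 !eqxx cy0 c0; clear; lia.
  - case=> [u|[p|u]]; rewrite /f ?mdeg_up_swap // /up_pair2 /up_cube.
      by rewrite !(mdegD, mdeg_opsum, mdeg1) degc; lia.
    by rewrite !(mdegD, mdeg_opsum, mdeg1) degc; lia.
  - case=> [u|[p|u]]; rewrite /f /selected sw_x0; apply/orP; left.
    + by rewrite up_swap_x0 up_swap_y0 ltnS leqW // nonsel_le.
    + by rewrite 2!up_pair2E x0y0 opsum2_y0 opsum2_x0 eqxx cy0 c0.
    + by rewrite 2!up_cubeE x0y0 y0x0 !eqxx cy0 c0.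
exists (nselected r x0 x1 d), (nselected r x0 x0 (d - 2)); split; try exact: swap_orbits_sel.
pose c' := (U_(x1) *+ (d - 3))%MM.
have degc' : mdeg c' = d - 3 by rewrite mdegMn mdeg1 mul1n.
have c'x0 : c' x0 = 0 by rewrite mulmnE mnm1E (distinct_vars r1).
have c'y0 : c' y0 = 0 by rewrite mulmnE mnm1E (distinct_vars r1).
have c'y1 : c' y1 = 0 by rewrite mulmnE mnm1E (distinct_vars r1).
pose f (s : nonsel (d - 2) + (opairs V0 + (unit + (opairs W1 + unit)))) := match s with inl u => up_swap u
  | inr s => match s with inl a => up_pair2 c a | inr b => match b with inl b => up_cube c b
     | inr b => match b with inl b => up_pair1 c' b | inr b => up_cube1 c' b end end end end.
suff : #|{: nonsel (d - 2) + (opairs V0 + (unit + (opairs W1 + unit)))}| <= nselected r x0 x1 d.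
  rewrite !card_sum !card_unit card_nonsel; have := pair_count_rank2 m_ge4 rank_product_bound (card_opairs3 r1) card_opairs2.
  by move: (r * (m - r)) => a; clear; lia.
apply: (@leq_nselected _ _ _ _ _ _ f).
- apply: inj_sum; [exact: up_swap_inj| |].
    apply: inj_sum; [exact: opsum_shift_inj| |].
      apply: inj_sum; [exact: unit_inj| |].
        apply: inj_sum; [exact: opsum_shift_inj|exact: unit_inj|] => p u.
        by apply: (@neq_at y1); rewrite up_pair1E up_cube1E opsum3_y1 !(distinct_vars r1) eqxx c'y1.
      move=> u [p|u']; apply: (@neq_at x0).
        by rewrite up_cubeE up_pair1E opsum3_x0 y0x0 !(distinct_vars r1) eqxx c'x0 c0.
      by rewrite up_cubeE up_cube1E y0x0 !(distinct_vars r1) eqxx c'x0 c0.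
    move=> p [u|[p'|u']].
    + by apply: (@neq_at y0); rewrite up_pair2E up_cubeE x0y0 opsum2_y0 eqxx cy0.
    + by apply: (@neq_at x0); rewrite up_pair2E up_pair1E opsum2_x0 opsum3_x0 !(distinct_vars r1) eqxx c'x0 c0.
    + by apply: (@neq_at x0); rewrite up_pair2E up_cube1E opsum2_x0 !(distinct_vars r1) eqxx c'x0 c0.
  move=> u [p|[u'|[p|u']]] E; have := nonsel_le u; have := up_swap_x0 u; have := up_swap_y0 u.
  + by rewrite E 2!up_pair2E x0y0 opsum2_y0 opsum2_x0 eqxx cy0 c0; clear; lia.
  + by rewrite E 2!up_cubeE x0y0 y0x0 !eqxx cy0 c0; clear; lia.
  + by rewrite E 2!up_pair1E opsum3_x0 opsum3_y0 !(distinct_vars r1) c'x0; clear; lia.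
  + by rewrite E 2!up_cube1E !(distinct_vars r1) c'x0; clear; lia.
- case=> [u|[p|[u|[p|u]]]]; rewrite /f ?mdeg_up_swap // /up_pair2 /up_cube /up_pair1 /up_cube1;
    by rewrite !(mdegD, mdeg_opsum, mdeg1) ?degc ?degc'; lia.
- case=> [u|[p|[u|[p|u]]]]; rewrite /f /selected sw_x0 (sw_x1 r1).
  + by rewrite up_swap_x0 up_swap_y0 ltnS leqW // nonsel_le.
  + by rewrite (up_pair2E _ _ x0) (up_pair2E _ _ y0) x0y0 opsum2_y0 opsum2_x0 eqxx cy0 c0.
  + by rewrite (up_cubeE _ _ x0) (up_cubeE _ _ y0) x0y0 y0x0 !eqxx cy0 c0.
  + rewrite 4!up_pair1E opsum3_x0 opsum3_y0 opsum3_y1 !(distinct_vars r1) !eqxx c'x0 c'y0 c'y1.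
    by [].
  + rewrite 4!up_cube1E !(distinct_vars r1) !eqxx c'x0 c'y0 c'y1.
    by apply/orP; right; rewrite !addn0 /=; case: (c' x1).
Qed.
End Counting.

End MonomialOrbits.

(** * Thin sets of tuples of forms *)

Lemma sum_over_enum (I : finType) (G : I -> nat) : (\sum_(i <- enum I) G i = \sum_i G i)%N.
Proof. by rewrite big_enum. Qed.

Lemma sum_sub_nat (I : finType) (N rho : I -> nat) : (forall i, rho i <= N i)%N ->
  (\sum_i N i = \sum_i (N i - rho i) + \sum_i rho i)%N.
Proof. by move=> le; rewrite -big_split /=; apply: eq_bigr => i _; rewrite subnK. Qed.

Section MonCount.
Variable n : nat.

Lemma leq_card_mon d (I : finType) (f : I -> 'X_{1..n}) : injective f ->
  (forall i, mdeg (f i) = d) -> (#|I| <= #|mon n d|)%N.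
Proof.
move=> If df; have dfb i : mdeg (f i) == d by rewrite df.
by apply: (leq_card (fun i => mon_of (dfb i))) => i j /(congr1 (@mon_val _ _))/If.
Qed.

(** The representatives and their images are pairwise distinct. *)
Lemma swap_orbits_double r d rho : (r + r <= n)%N -> swap_orbits r n d rho -> (2 * rho <= #|mon n d|)%N.
Proof.
move=> le_rn [J [q [leJ injq dq swq]]].
apply: (@leq_trans #|{: J + J}|); first by rewrite card_sum addnn -mul2n leq_mul2l leJ.
apply: (@leq_card_mon _ _ (fun s => match s with inl j => q j | inr j => swm r (q j) end)).
  apply: inj_sum => // [i j /(inv_inj (swmK le_rn))/injq//|i j E].
  by have /eqP := swq j i; rewrite E.
by case=> j; rewrite ?mdeg_swm ?dq.
Qed.
End MonCount.

Lemma card_mon_ge n d : (0 < d)%N -> (n.+1 <= #|mon n.+1 d|)%N.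
Proof.
move=> d0; rewrite -{1}(card_ord n.+1).
apply: (@leq_card_mon _ _ _ (fun i : 'I_n.+1 => (U_(i) + U_(ord0) *+ d.-1)%MM)).
  by move=> i j /addIm/eqP; rewrite eq_mnm1 => /eqP.
by move=> i; rewrite mdegD mdegMn !mdeg1 mul1n add1n prednK.
Qed.

Lemma card_mon2 n : (n.+1 * n.+2 <= 2 * #|mon n.+1 2|)%N.
Proof.
have := card_opairs [set: 'I_n.+1]; rewrite cardsT card_ord => <-.
by rewrite leq_mul2l (@leq_card_mon _ 2 _ (@opsum _ _) (@opsum_inj _ _)) // => p; apply: mdeg_opsum.
Qed.

Section Thin.
Variables (k : closedFieldType) (n c : nat) (d : c.-tuple nat).
Local Notation coefI := (coef_index n d).

Lemma form_homog (F : form_tuple k n d) i : (F i : {mpoly k[n.+1]}) \is (tnth d i).-homog.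
Proof. exact: dhomog_is_dhomog. Qed.

Lemma card_coef_index : #|coefI| = (\sum_i #|mon n.+1 (tnth d i)|)%N.
Proof. by rewrite card_tagged sumnE big_map big_enum. Qed.

(** Contained in a hypersurface of the coefficient space. Finite unions of thin
    sets are thin, so the exceptional tuples may be treated one kind at a time. *)
Definition thin (B : form_tuple k n d -> Prop) :=
  exists2 P : {mpoly k[#|coefI|]}, P != 0 & forall F, B F -> coef_eval F P = 0.

Lemma thin_sub (B B' : form_tuple k n d -> Prop) : (forall F, B' F -> B F) -> thin B -> thin B'.
Proof. by move=> sB [P P0 PB]; exists P => // F /sB/PB. Qed.

Lemma thinU (B B' : form_tuple k n d -> Prop) : thin B -> thin B' -> thin (fun F => B F \/ B' F).
Proof.
move=> [P P0 PB] [Q Q0 QB]; exists (P * Q); first by rewrite mulf_neq0.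
by move=> F [/PB|/QB]; rewrite /coef_eval mevalM => ->; rewrite ?mul0r ?mulr0.
Qed.

Lemma thin_bigU (I : finType) (B : I -> form_tuple k n d -> Prop) :
  (forall i, thin (B i)) -> thin (fun F => exists i, B i F).
Proof.
move=> tB; suff tS (s : seq I) : thin (fun F => exists2 i, i \in s & B i F).
  by apply: thin_sub (tS (enum I)) => F [i BF]; exists i; rewrite ?mem_enum.
elim: s => [|i s IHs].
  by exists 1 => [|F []//]; rewrite oner_neq0.
apply: thin_sub (thinU (tB i) IHs) => F [j]; rewrite inE => /predU1P[->|js] BF; first by left.
by right; exists j.
Qed.

(** The principle behind every count: a family with fewer dimensions than a
    tuple has coefficients lies in a hypersurface. *)
Lemma thin_family (T : Type) (Z : T -> Prop) (F : T -> form_tuple k n d) Y e :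
  adjoins Z [::] Y e -> (forall i, pfunm Z Y (fun t => F t i : {mpoly k[n.+1]})) ->
  (e < \sum_i #|mon n.+1 (tnth d i)|)%N -> thin (fun G => exists2 t, Z t & F t = G).
Proof.
move=> /adjoins_dimle dY pF lt_e; rewrite -card_coef_index in lt_e.
have [||P [P0 PZ]] := @dimle_vanish k T Z Y e coefI (fun s t => form_coef (F t) s) dY.
- by move=> [i m]; apply: pF.
- exact: lt_e.
by exists P => // _ [t Zt <-]; apply: PZ.
Qed.
End Thin.

Section Evaluation.
Variables (k : closedFieldType) (n : nat) (T : Type).
Implicit Types (Z : T -> Prop) (X : seq (T -> k)) (f : T -> {mpoly k[n.+1]}).

Definition ev (x : 'cV[k]_n.+1) (p : {mpoly k[n.+1]}) : k := p.@[fun j => x j 0].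

Implicit Types (x : 'cV[k]_n.+1) (p q : {mpoly k[n.+1]}).

Lemma evM x p q : ev x (p * q) = ev x p * ev x q. Proof. exact: mevalM. Qed.
Lemma evXU x j : ev x 'X_j = x j 0. Proof. exact: mevalXU. Qed.
Lemma evB x p q : ev x (p - q) = ev x p - ev x q. Proof. exact: mevalB. Qed.
Lemma evD x p q : ev x (p + q) = ev x p + ev x q. Proof. exact: mevalD. Qed.
Lemma evZ x a p : ev x (a *: p) = a * ev x p. Proof. exact: mevalZ. Qed.
Lemma ev_exp x p e : ev x (p ^+ e) = ev x p ^+ e. Proof. exact: rmorphXn. Qed.
Lemma ev_pullback (h : 'M[k]_n.+1) x p : ev x (pullback h p) = ev (h *m x) p.
Proof. exact: meval_pullback. Qed.

Lemma homogX j : ('X_j : {mpoly k[n.+1]}) \is 1.-homog.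
Proof. by rewrite dhomogX /= mdeg1. Qed.

Lemma homogXe j e : ('X_j : {mpoly k[n.+1]}) ^+ e \is e.-homog.
Proof. by rewrite -[X in X.-homog]mul1n; apply: dhomogMn; apply: homogX. Qed.

Lemma ev_scalar x : scalar (ev x).
Proof. by move=> a u v; rewrite /ev mevalD mevalZ. Qed.

Lemma pfun_ev Z X d f (x : T -> 'cV[k]_n.+1) :
  (forall t, Z t -> f t \is d.-homog) -> pfunm Z X f ->
  (forall i, pfun Z X (fun t => x t i 0)) -> pfun Z X (fun t => ev (x t) (f t)).
Proof. exact: pfun_meval. Qed.

Lemma pfun_evX Z X m (x : T -> 'cV[k]_n.+1) :
  (forall i, pfun Z X (fun t => x t i 0)) -> pfun Z X (fun t => ev (x t) 'X_[m]).
Proof. exact: pfun_mevalX. Qed.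

(** Points that are separated by forms of degree d impose independent
    conditions on such forms. *)
Lemma adjoins_evs Z X d f (R : finType) (x : R -> T -> 'cV[k]_n.+1) :
  (forall r i, pfun Z X (fun t => x r t i 0)) ->
  (forall t, Z t -> f t \is d.-homog) ->
  (forall r t, Z t -> ev (x r t) (f t) = 0) ->
  (forall t, Z t -> exists w : R -> {mpoly k[n.+1]},
    [/\ forall r, w r \is d.-homog, forall r, ev (x r t) (w r) != 0 &
        forall r r', r != r' -> ev (x r t) (w r') = 0]) ->
  adjoins Z X (coefs d f) (#|mon n.+1 d| - #|R|).
Proof.
move=> px hf fx sep.
apply: (@adjoins_form _ _ _ _ _ _ _ R (fun r t => ev (x r t)) (fun _ _ => 0)) => //.
- by move=> r t; apply: ev_scalar.
- by move=> r m; apply: pfun_evX.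
- by move=> r; apply: pfun_const.
- move=> t /sep[w [hw w1 w0]]; exists R, w; split=> // a aE r.
  have := aE r; rewrite (bigD1 r) //= big1 ?addr0 => [/eqP|r' ne]; last first.
    by rewrite w0 ?mulr0 // eq_sym.
  by rewrite mulf_eq0 (negPf (w1 r)) orbF => /eqP.
Qed.

Lemma exists_coord (x : 'cV[k]_n.+1) : x != 0 -> exists i, x i 0 != 0.
Proof. by case/cV0Pn => i xi; exists i. Qed.

Lemma adjoins_ev Z X d f (x : T -> 'cV[k]_n.+1) :
  (forall i, pfun Z X (fun t => x t i 0)) -> (forall t, Z t -> x t != 0) ->
  (forall t, Z t -> f t \is d.-homog) -> (forall t, Z t -> ev (x t) (f t) = 0) ->
  adjoins Z X (coefs d f) (#|mon n.+1 d| - 1).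
Proof.
move=> px x0 hf fx; rewrite -card_unit.
apply: (@adjoins_evs _ _ _ _ unit (fun _ => x)) => // t /x0/exists_coord[i xi].
exists (fun=> 'X_i ^+ d); split=> [_|_|[] []//].
  by rewrite -[X in X.-homog]mul1n; apply: dhomogMn; rewrite dhomogX /= mdeg1.
by rewrite /ev rmorphXn /= mevalXU expf_neq0.
Qed.

Lemma deriv_homog (p : {mpoly k[n.+1]}) d j : p \is d.-homog -> p^`M(j) \is d.-1.-homog.
Proof.
move=> hp; apply/dhomogP => m; rewrite mcoeff_msupp mcoeff_deriv => nz.
have [E|ne] := eqVneq (mdeg (m + U_(j))%MM) d; first by rewrite -E mdegD mdeg1 addn1.
by rewrite (dhomog_nemf_coeff hp ne) mul0rn eqxx in nz.
Qed.

Lemma pfunm_deriv Z X f j : pfunm Z X f -> pfunm Z X (fun t => (f t)^`M(j)).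
Proof.
move=> pf m; apply: (pfun_ext (pfun_mul (pf (m + U_(j))%MM) (pfun_const Z X (m j).+1%:R))) => t _.
by rewrite mcoeff_deriv mulr_natr.
Qed.

(** Coordinates on the chart of projective space where coordinate j0 is 1. *)
Definition chart_entries (x : T -> 'cV[k]_n.+1) (j0 : 'I_n.+1) : seq (T -> k) :=
  [seq (fun t => x t (lift j0 j) 0) | j <- enum 'I_n].

Lemma pfun_chart_entries Z (x : T -> 'cV[k]_n.+1) j0 : (forall t, Z t -> x t j0 0 = 1) ->
  forall i, pfun Z (chart_entries x j0) (fun t => x t i 0).
Proof.
move=> x1 i; case: (unliftP j0 i) => [j ->|->].
  by apply: pfun_var; apply: (In_enum_map (fun j (t : T) => x t (lift j0 j) 0)).
by apply: (pfun_ext (pfun_const _ _ 1)) => t /x1.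
Qed.

Lemma adjoins_chart_entries Z X (x : T -> 'cV[k]_n.+1) j0 : adjoins Z X (chart_entries x j0) n.
Proof.
have := @adjoins_free k T Z X (chart_entries x j0).
by rewrite size_map -cardE card_ord.
Qed.
End Evaluation.

(** * Singular complete intersections *)

Lemma ev_scale (k : closedFieldType) n d (p : {mpoly k[n.+1]}) (a : k) (x : 'cV[k]_n.+1) :
  p \is d.-homog -> ev (a *: x) p = a ^+ d * ev x p.
Proof.
move=> hp; rewrite -[RHS]mevalZ -(pullback_scalar _ hp) meval_pullback.
by apply: meval_eq => j; rewrite mul_scalar_mx.
Qed.

Lemma big_option (V : nmodType) (I : finType) (F : option I -> V) :
  (\sum_r F r = F None + \sum_i F (Some i))%R.
Proof.
rewrite (bigD1 None) //=; congr (_ + _)%R.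
rewrite (reindex_omap Some id) => [|[]//]; apply: eq_bigl => i /=.
by rewrite eqxx.
Qed.

Section Smooth.
Variables (k : closedFieldType) (n c : nat) (d : c.-tuple nat).
Hypothesis d_gt0 : forall i, (0 < tnth d i)%N.

(** A singular point x comes with a relation a among the rows of the Jacobian;
    normalised by x_j0 = a_i0 = 1, the pair (x, a) has n + c - 1 parameters.
    There is one condition on each F_i with i <> i0, and n + 1 conditions on
    F_i0: its value and n of its partial derivatives at x are prescribed. *)
Lemma singular_chart_thin (i0 : 'I_c) (j0 : 'I_n.+1) : thin (fun F : form_tuple k n d =>
  exists (x : 'cV[k]_n.+1) (a : 'I_c -> k), [/\ x j0 0 = 1, a i0 = 1,
    forall i, ev x (F i) = 0 & forall j, \sum_i a i * ev x ((F i : {mpoly k[n.+1]})^`M(j)) = 0]).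
Proof.
pose T := (form_tuple k n d * 'cV[k]_n.+1 * ('I_c -> k))%type.
pose F (t : T) := t.1.1; pose x (t : T) := t.1.2; pose a (t : T) := t.2.
pose Z (t : T) := [/\ x t j0 0 = 1, a t i0 = 1, forall i, ev (x t) (F t i) = 0 &
   forall j, \sum_i a t i * ev (x t) ((F t i : {mpoly k[n.+1]})^`M(j)) = 0].
have Zx t : Z t -> x t j0 0 = 1 by case.
have x_neq0 t : Z t -> x t != 0.
  by move/Zx => x1; apply: contraTneq (oner_neq0 k) => x0; rewrite -x1 x0 mxE eqxx.
pose f i (t : T) : {mpoly k[n.+1]} := F t i.
have hf i t : Z t -> f i t \is (tnth d i).-homog by move=> _; apply: form_homog.
pose Yx := chart_entries x j0.
pose Ya := [seq (fun t => a t i) | i <- enum 'I_c & i != i0].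
have szYa : size Ya = c.-1.
  rewrite size_map size_filter -sum1_count big_enum_cond /= sum1dep_card.
  by rewrite cardsE cardC1 card_ord.
pose Yo := flatten [seq coefs (tnth d i) (f i) | i <- enum 'I_c & i != i0].
pose Y0 := coefs (tnth d i0) (f i0).
have inYo i y : i != i0 -> List.In y (coefs (tnth d i) (f i)) -> List.In y Yo.
  move=> ne; apply: (@In_flatten _ _ _ _ (fun i => coefs (tnth d i) (f i))).
  by rewrite mem_filter ne mem_enum.
have inX (y : T -> k) : List.In y Yx -> List.In y (Yo ++ Ya ++ Yx).
  by move=> yY; apply: List.in_or_app; right; apply: List.in_or_app; right.
have px W : (forall y, List.In y Yx -> List.In y W) -> forall i, pfun Z W (fun t => x t i 0).
  by move=> sW i; apply: pfun_sub_dom (pfun_chart_entries Zx i).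
have pa i : pfun Z (Yo ++ Ya ++ Yx) (fun t => a t i).
  have [->|ne] := eqVneq i i0; first by apply: (pfun_ext (pfun_const _ _ 1)) => t [].
  apply: pfun_var; apply: List.in_or_app; right; apply: List.in_or_app; left.
  rewrite /Ya; have: i \in [seq i <- enum 'I_c | i != i0] by rewrite mem_filter ne mem_enum.
  by elim: [seq _ <- _ | _] => //= b s IHs; rewrite inE => /predU1P[->|/IHs]; [left|right].
have pf i : i != i0 -> pfunm Z (Yo ++ Ya ++ Yx) (f i).
  move=> ne; apply: (pfunm_coefs (hf i)) => y yY; apply: List.in_or_app; left.
  exact: inYo yY.
have aYx : adjoins Z [::] Yx n by apply: adjoins_chart_entries.
have aYa : adjoins Z [::] (Ya ++ Yx) (n + c.-1).
  by apply: adjoins_cat aYx _; rewrite -szYa; apply: adjoins_free.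
have aYo : adjoins Z [::] (Yo ++ Ya ++ Yx) (n + c.-1 + \sum_(i <- enum 'I_c | i != i0) (#|mon n.+1 (tnth d i)| - 1)).
  rewrite -big_filter; apply: adjoins_cat aYa _; apply: adjoins_flatten => i _.
  apply: (adjoins_ev (x := x)) => // [j|t|t [_ _ Fx _]]; [|exact: hf|exact: Fx].
  by apply: px => y yY; apply: List.in_or_app; left; apply: List.in_or_app; right.
have aY0 : adjoins Z ((Yo ++ Ya ++ Yx) ++ [::]) Y0 (#|mon n.+1 (tnth d i0)| - n.+1).
  rewrite cats0.
  pose b (r : option 'I_n) (t : T) : k := if r is Some j
    then - \sum_(i | i != i0) a t i * ev (x t) ((f i t)^`M(lift j0 j)) else 0.
  pose L (r : option 'I_n) (t : T) (p : {mpoly k[n.+1]}) : k := if r is Some j then ev (x t) (p^`M(lift j0 j)) else ev (x t) p.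
  apply: (@adjoins_form _ _ _ _ _ _ _ (option 'I_n) L b) => //.
  - by move=> t; apply: hf.
  - move=> [j|] t u p q; last exact: ev_scalar.
    by rewrite /L /ev mderivD mderivZ mevalD mevalZ.
  - move=> [j|] m; last by apply: pfun_evX; apply: px.
    apply: (pfun_ev (d := (mdeg m).-1)); last by apply: px.
      by move=> t _; apply: deriv_homog; rewrite dhomogX.
    exact: pfunm_const.
  - move=> [j|]; last exact: pfun_const.
    apply: pfun_opp; apply: pfun_sum => i _ ne; apply: pfun_mul => //.
    apply: (pfun_ev (d := (tnth d i).-1)); last by apply: px.
      by move=> t Zt; apply: deriv_homog; apply: hf.
    by apply: pfunm_deriv; apply: pf.
  - move=> [j|] t [_ a1 Fx dF]; last exact: Fx.
    apply/eqP; rewrite -subr_eq0 opprK -[X in _ == X](dF (lift j0 j)).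
    by rewrite [X in _ == X](bigD1 i0) //= a1 mul1r.
  - move=> t Zt; have x1 := Zx t Zt.
    (* w None does not vanish at x; the others vanish there, with independent differentials *)
    pose X0 : {mpoly k[n.+1]} := 'X_j0 ^+ (tnth d i0).-1.
    pose w (r : option 'I_n) : {mpoly k[n.+1]} := if r is Some j
      then X0 * ('X_(lift j0 j) - x t (lift j0 j) 0 *: 'X_j0) else X0 * 'X_j0.
    have ev0 : ev (x t) X0 = 1 by rewrite /ev rmorphXn /= mevalXU x1 expr1n.
    exists (option 'I_n), w; split; first by rewrite card_option card_ord.
      have hX0 : X0 \is (tnth d i0).-1.-homog.
        by rewrite -[X in X.-homog]mul1n; apply: dhomogMn; rewrite dhomogX /= mdeg1.
      have -> : tnth d i0 = ((tnth d i0).-1 + 1)%N by rewrite addn1 prednK.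
      case=> [j|]; apply: dhomogM => //=; last by rewrite dhomogX /= mdeg1.
      by apply: rpredB; [|apply: rpredZ]; rewrite dhomogX /= mdeg1.
    have evj j : ev (x t) ('X_(lift j0 j) - x t (lift j0 j) 0 *: 'X_j0 : {mpoly k[n.+1]}) = 0.
      by rewrite /ev mevalB mevalZ !mevalXU x1 mulr1 subrr.
    move=> u uE.
    have uN : u None = 0.
      have := uE None; rewrite big_option /= big1 => [|j _].
        by rewrite addr0 /L /= evM ev0 mul1r /ev mevalXU x1 mulr1.
      by rewrite evM evj mulr0 mulr0.
    case=> [j|//]; have := uE (Some j).
    rewrite big_option /= uN mul0r add0r (bigD1 j) //= big1 ?addr0 => [|l /negPf lj].
      rewrite mderivM /ev mevalD -!/(ev _ _) !evM evj mulr0 add0r ev0 mul1r.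
      rewrite mderivB mderivZ !mderivX !mnm1E eqxx (negPf (neq_lift _ _)).
      rewrite /ev mevalB !mevalZ mul1r mul0r mulr0 subr0.
      rewrite [(U_(_) - U_(_))%MM](_ : _ = 0%MM) ?mpolyX0 ?meval1 ?mulr1 //.
      by apply/mnmP => a'; rewrite mnmBE subnn mnm0E.
    rewrite mderivM /ev mevalD -!/(ev _ _) !evM evj mulr0 add0r.
    rewrite mderivB mderivZ !mderivX !mnm1E (inj_eq (@lift_inj _ _)) lj (negPf (neq_lift _ _)).
    by rewrite !scale0r scaler0 subrr /ev meval0 !mulr0.
have aY := adjoins_cat aYo aY0.
apply: thin_sub (thin_family (F := F) aY _ _).
- move=> G [y [b [y1 b1 Gy dG]]]; by exists (G, y, b).
- move=> i; apply: (pfunm_coefs (hf i)) => y yY; apply: List.in_or_app.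
  have [E|ne] := eqVneq i i0; first by left; rewrite /Y0 -E.
  by right; apply: List.in_or_app; left; apply: inYo yY.
- rewrite [X in (_ < X)%N](bigD1 i0) //=.
  have -> : (\sum_(i <- enum 'I_c | i != i0) (#|mon n.+1 (tnth d i)| - 1) =
    \sum_(i < c | i != i0) (#|mon n.+1 (tnth d i)| - 1))%N by rewrite big_enum_cond.
  have -> : (\sum_(i < c | i != i0) #|mon n.+1 (tnth d i)| =
     \sum_(i < c | i != i0) (#|mon n.+1 (tnth d i)| - 1) + c.-1)%N.
    have -> : c.-1 = (\sum_(i < c | i != i0) 1)%N by rewrite sum1_card cardC1 card_ord.
    rewrite -big_split /=; apply: eq_bigr => i _; rewrite subnK //.
    by apply: leq_trans (card_mon_ge n (d_gt0 i)).
  have := card_mon_ge n (d_gt0 i0).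
  by move: #|mon n.+1 (tnth d i0)| (\sum_(i < c | i != i0) _)%N => u v; clear; lia.
Qed.

Lemma singular_thin : thin (fun F : form_tuple k n d => ~ smooth_complete_intersection F).
Proof.
have tB := thin_bigU (fun p : 'I_c * 'I_n.+1 => singular_chart_thin p.1 p.2).
apply: thin_sub tB => F nsm.
have [x [px rk]] : exists x, point_of F x /\ \rank (jacobian F x) <> c.
  have [//|nex] := excluded_middle_informative (exists x, point_of F x /\ \rank (jacobian F x) <> c).
  case: nsm => x px; have [//|ne] := eqVneq (\rank (jacobian F x)) c.
  by case: nex; exists x; split=> //; apply/eqP.
have [x0 Fx] := px; have [j0 xj] := exists_coord x0.
have nfree : kermx (jacobian F x) != 0.
  by rewrite kermx_eq0 /row_free; apply/eqP.
have [a /sub_kermxP aJ a0] := rowV0Pn nfree.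
have [i0 ai] : exists i, a 0 i != 0 by apply/rV0Pn.
exists (i0, j0), ((x j0 0)^-1 *: x),
  (fun i => a 0 i * x j0 0 ^+ (tnth d i).-1 / (a 0 i0 * x j0 0 ^+ (tnth d i0).-1)); split.
- by rewrite mxE mulVf.
- by rewrite divff // mulf_neq0 // expf_neq0.
- by move=> i; rewrite (ev_scale _ _ (form_homog F i)) /ev Fx mulr0.
- move=> j; have aJj : \sum_i a 0 i * ev x ((F i : {mpoly k[n.+1]})^`M(j)) = 0.
    have := congr1 (fun M : 'rV_ _ => M 0 j) aJ; rewrite /= [RHS]mxE mxE => E.
    by rewrite -[RHS]E; apply: eq_bigr => i _; rewrite mxE.
  rewrite (eq_bigr (fun i => (a 0 i0 * x j0 0 ^+ (tnth d i0).-1)^-1 *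
     (a 0 i * ev x ((F i : {mpoly k[n.+1]})^`M(j))))) => [|i _].
    by rewrite -mulr_sumr aJj mulr0.
  rewrite (ev_scale _ _ (deriv_homog j (form_homog F i))) exprVn.
  have u0 : x j0 0 ^+ (tnth d i).-1 != 0 by rewrite expf_neq0.
  have E (A u B C : k) : u != 0 -> A * u * B * (u^-1 * C) = B * (A * C) by move=> ?; field.
  exact: E.
Qed.
End Smooth.

(** * Points on linear sections *)

Section LinearSections.
Variables (k : closedFieldType) (n c : nat) (d : c.-tuple nat).
Local Notation coefI := (coef_index n d).

(** Equations of n + 2 linear spaces of codimension n - c, which are general
    parameters next to F until [thin2_specialize] fixes them. *)
Definition lin_family := 'I_n.+2 -> 'I_(n - c) -> dhomog n.+1 k 1.
Definition lin_index : finType := ('I_n.+2 * 'I_(n - c) * mon n.+1 1)%type.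

Definition pair_coef (F : form_tuple k n d) (L : lin_family) (s : coefI + lin_index) : k :=
  match s with inl s => form_coef F s
             | inr p => (L p.1.1 p.1.2 : {mpoly k[n.+1]})@_(mon_val p.2) end.

Definition thin2 (B : form_tuple k n d -> lin_family -> Prop) :=
  exists2 P : {mpoly k[#|{: coefI + lin_index}|]}, P != 0 &
    forall F L, B F L -> P.@[fun j => pair_coef F L (enum_val j)] = 0.

Lemma thin2_sub (B B' : form_tuple k n d -> lin_family -> Prop) :
  (forall F L, B' F L -> B F L) -> thin2 B -> thin2 B'.
Proof. by move=> sB [P P0 PB]; exists P => // F L /sB/PB. Qed.

Lemma thin2U (B B' : form_tuple k n d -> lin_family -> Prop) :
  thin2 B -> thin2 B' -> thin2 (fun F L => B F L \/ B' F L).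
Proof.
move=> [P P0 PB] [Q Q0 QB]; exists (P * Q); first by rewrite mulf_neq0.
by move=> F L [/PB|/QB]; rewrite mevalM => ->; rewrite ?mul0r ?mulr0.
Qed.

Lemma thin2_bigU (I : finType) (B : I -> form_tuple k n d -> lin_family -> Prop) :
  (forall i, thin2 (B i)) -> thin2 (fun F L => exists i, B i F L).
Proof.
move=> tB; suff tS (s : seq I) : thin2 (fun F L => exists2 i, i \in s & B i F L).
  by apply: thin2_sub (tS (enum I)) => F L [i BF]; exists i; rewrite ?mem_enum.
elim: s => [|i s IHs].
  by exists 1 => [|F L []//]; rewrite oner_neq0.
apply: thin2_sub (thin2U (tB i) IHs) => F L [j]; rewrite inE => /predU1P[->|js] BF; first by left.
by right; exists j.
Qed.

Lemma thin2_family (T : Type) (Z : T -> Prop) (F : T -> form_tuple k n d) (L : T -> lin_family) Y e :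
  adjoins Z [::] Y e -> (forall i, pfunm Z Y (fun t => F t i : {mpoly k[n.+1]})) ->
  (forall j l, pfunm Z Y (fun t => L t j l : {mpoly k[n.+1]})) ->
  (e < \sum_i #|mon n.+1 (tnth d i)| + \sum_(p : 'I_n.+2 * 'I_(n - c)) #|mon n.+1 1|)%N ->
  thin2 (fun G M => exists2 t, Z t & F t = G /\ L t = M).
Proof.
move=> /adjoins_dimle dY pF pL lt_e.
have {lt_e}lt_e : (e < #|{: coefI + lin_index}|)%N.
  by apply: leq_trans lt_e _; rewrite card_sum card_coef_index leq_add2l sum_nat_const /lin_index [X in (_ <= X)%N]card_prod.
have [||P [P0 PZ]] := @dimle_vanish k T Z Y e {: coefI + lin_index} (fun s t => pair_coef (F t) (L t) s) dY.
- by move=> [[i m]|[[j l] m]]; [apply: pF|apply: pL].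
- exact: lt_e.
by exists P => // _ _ [t Zt [<- <-]]; apply: PZ.
Qed.

(** A nonzero polynomial in the coefficients of F and of L remains nonzero for
    a suitable value of those of L. *)
Lemma thin2_specialize (B : form_tuple k n d -> lin_family -> Prop) : thin2 B ->
  exists L, thin (fun F => B F L).
Proof.
case=> P P0 PB; have [y Py] := mpoly_nonzero_point P0.
pose I := {: coefI + lin_index}.
pose q (p : 'I_n.+2 * 'I_(n - c)) : {mpoly k[n.+1]} :=
  \sum_(m : mon n.+1 1) y (enum_rank (inr (p, m) : I)) *: 'X_[mon_val m].
have hq p : q p \is 1.-homog.
  by apply: rpred_sum => m _; apply: rpredZ; rewrite dhomogX /= mon_valK.
pose L j l : dhomog n.+1 k 1 := DHomog (hq (j, l)).
pose s : #|I|.-tuple {mpoly k[#|coefI|]} :=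
  [tuple (match enum_val i with inl s => 'X_(enum_rank s) | inr p => (y i)%:MP end) | i < #|I|].
exists L, (P \mPo s).
  apply: contraNneq Py => PS0.
  pose z (j : 'I_#|coefI|) := y (enum_rank (inl (enum_val j) : I)).
  have E : (P \mPo s).@[z] = P.@[fun i => (tnth s i).@[z]] by apply: comp_mpoly_meval.
  rewrite PS0 meval0 in E; rewrite [X in _ == X]E; apply/eqP; apply: meval_eq => i.
  rewrite tnth_mktuple; case Ei: (enum_val i) => [r|p]; last by rewrite mevalC.
  by rewrite mevalXU /z enum_rankK -Ei enum_valK.
move=> F BF; rewrite /coef_eval comp_mpoly_meval -[RHS](PB F L BF); apply: meval_eq => i.
rewrite tnth_mktuple; case Ei: (enum_val i) => [r|[[j l] m]].
  by rewrite mevalXU enum_rankK.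
rewrite mevalC /= raddf_sum (bigD1 m) //= big1 ?addr0 => [|m' /negPf ne].
  by rewrite mcoeffZ mcoeffX eqxx mulr1 -Ei enum_valK.
by rewrite mcoeffZ mcoeffX (inj_eq (@mon_val_inj _ _)) ne mulr0.
Qed.

Definition on_section (F : form_tuple k n d) (L : lin_family) (j : 'I_n.+2) (p : 'cV[k]_n.+1) :=
  (forall i, ev p (F i) = 0) /\ (forall l, ev p (L j l) = 0).

Lemma on_section_scale F L j p (a : k) : on_section F L j p -> on_section F L j (a *: p).
Proof.
move=> [Fp Lp]; split=> i; rewrite (ev_scale (d := _) a p (dhomog_is_dhomog _)).
  by rewrite Fp mulr0.
by rewrite Lp mulr0.
Qed.

(** The points x i and, at None, a combination of them. *)
Definition combo m (x : 'I_m -> 'cV[k]_n.+1) (a : 'I_m -> k) (r : option 'I_m) : 'cV[k]_n.+1 :=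
  if r is Some i then x i else \sum_i a i *: x i.

(** Linear independence of the x i, in the form of linear forms that separate
    them. *)
Definition dual m (x : 'I_m -> 'cV[k]_n.+1) :=
  exists u : 'I_m -> {mpoly k[n.+1]}, (forall i, u i \is 1.-homog) /\
    forall i j, ev (x j) (u i) = (i == j)%:R.

(** A minimal dependency: independent points on the sections s (Some i), and
    on the section s None a combination of them without zero coefficient. *)
Definition dependent m (s : option 'I_m -> 'I_n.+2) F L :=
  exists (x : 'I_m -> 'cV[k]_n.+1) (a : 'I_m -> k),
    [/\ dual x, forall i, a i != 0 & forall r, on_section F L (s r) (combo x a r)].

Lemma ev_lin_sum (I : finType) (u : {mpoly k[n.+1]}) (a : I -> k) (x : I -> 'cV[k]_n.+1) :
  u \is 1.-homog -> ev (\sum_i a i *: x i) u = \sum_i a i * ev (x i) u.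
Proof.
move=> hu; have ue y : ev y u = \sum_(m : mon n.+1 1) u@_(mon_val m) * ev y 'X_[mon_val m].
  by rewrite {1}(homog_monE hu) /ev raddf_sum; apply: eq_bigr => m _; rewrite /= mevalZ.
rewrite ue; under [RHS]eq_bigr do rewrite ue mulr_sumr.
rewrite exchange_big; apply: eq_bigr => m _ /=.
have /mdeg1P[j /eqP ->] : mdeg (mon_val m) == 1%N by rewrite mon_valK.
rewrite /ev mevalXU summxE mulr_sumr; apply: eq_bigr => i _.
by rewrite mevalXU mxE mulrCA.
Qed.

(** The quadrics u_i (u_i - b u_j), where b is chosen to make them vanish at
    the combination, and u_0 u_1 separate these points; powers of coordinates
    that do not vanish there raise the degree. *)
Lemma combo_sep m (x : 'I_m.+2 -> 'cV[k]_n.+1) (a : 'I_m.+2 -> k) e : (2 <= e)%N ->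
  dual x -> (forall i, a i != 0) ->
  exists w : option 'I_m.+2 -> {mpoly k[n.+1]},
    [/\ forall r, w r \is e.-homog, forall r, ev (combo x a r) (w r) != 0 &
        forall r r', r != r' -> ev (combo x a r) (w r') = 0].
Proof.
move=> e2 [u [hu ux]] a0.
have uN i : ev (combo x a None) (u i) = a i.
  rewrite /= ev_lin_sum // (bigD1 i) //= ux eqxx mulr1 big1 ?addr0 // => j /negPf ne.
  by rewrite ux eq_sym ne mulr0.
have uS i j : ev (combo x a (Some j)) (u i) = (i == j)%:R by rewrite /= ux.
pose o1 : 'I_m.+2 := lift ord0 ord0.
pose oth (i : 'I_m.+2) := if i == ord0 then o1 else ord0.
have oth_ne i : (oth i == i) = false.
  by rewrite /oth; case: (eqVneq i ord0) => [->|/negPf ne] //; rewrite eq_sym.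
pose v (r : option 'I_m.+2) : {mpoly k[n.+1]} := if r is Some i
  then u i * (u i - (a i / a (oth i)) *: u (oth i)) else u ord0 * u o1.
have hv r : v r \is 2.-homog.
  by case: r => [i|]; apply: (@dhomogM _ _ mdeg 1 _ 1) => //; apply: rpredB => //; apply: rpredZ.
have v1 r : ev (combo x a r) (v r) != 0.
  case: r => [i|]; rewrite /v evM ?evB ?evZ.
    by rewrite !uS oth_ne eqxx mulr0 subr0 mulr1 oner_neq0.
  by rewrite !uN mulf_neq0.
have v0 r r' : r != r' -> ev (combo x a r) (v r') = 0.
  case: r r' => [i|] [j|] // ne; rewrite /v evM ?evB ?evZ.
  - rewrite !uS; have -> : (j == i) = false by apply: contraNF ne => /eqP->.
    by rewrite mul0r.
  - rewrite !uS; case: (eqVneq ord0 i) => [<-|_]; last by rewrite mul0r.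
    by rewrite mulr0.
  - by rewrite !uN divfK // subrr mulr0.
have nz r : exists j, (combo x a r) j 0 != 0.
  apply: exists_coord; apply: contraNneq (v1 r) => ->.
  by rewrite -(scale0r (0 : 'cV_ _)) (ev_scale _ _ (hv r)) expr0n mul0r.
have /fin_all_exists[j jP] := nz.
exists (fun r => 'X_(j r) ^+ (e - 2) * v r); split=> [r|r|r r' ne].
- have hX : ('X_(j r) : {mpoly k[n.+1]}) ^+ (e - 2) \is (e - 2).-homog.
    by rewrite -[X in X.-homog]mul1n; apply: dhomogMn; rewrite dhomogX /= mdeg1.
  by have := dhomogM hX (hv r); rewrite subnK.
- by rewrite evM mulf_neq0 // /ev rmorphXn /= mevalXU expf_neq0.
- by rewrite evM v0 ?mulr0.
Qed.
End LinearSections.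

Section Position.
Variables (k : closedFieldType) (n c : nat) (d : c.-tuple nat).
Hypothesis d_ge2 : forall i, (2 <= tnth d i)%N.
Hypothesis c_lt_n : (c < n)%N.

(** By homogeneity each x i can be rescaled to have some coordinate 1, and the
    coefficients to have a 0 = 1. *)
Lemma dependent_normalize m (s : option 'I_m.+1 -> 'I_n.+2) (F : form_tuple k n d) L :
  dependent s F L -> exists (jj : {ffun 'I_m.+1 -> 'I_n.+1}) (x : 'I_m.+1 -> 'cV[k]_n.+1) (a : 'I_m.+1 -> k),
    [/\ dual x, forall i, a i != 0, forall i, x i (jj i) 0 = 1, a ord0 = 1 &
      forall r, on_section F L (s r) (combo x a r)].
Proof.
move=> [x [a [[u [hu ux]] a0 xFL]]].
have x0 i : x i != 0.
  apply: contraTneq (oner_neq0 k) => xi0; rewrite -[1]/((true : nat)%:R) -(eqxx i) -ux xi0.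
  by rewrite -(scale0r (0 : 'cV_ _)) (ev_scale _ _ (hu i)) expr1 mul0r eqxx.
have /fin_all_exists[j jP] i := exists_coord (x0 i).
pose b i := a i * x i (j i) 0.
have b0 i : b i != 0 by rewrite mulf_neq0.
exists (finfun j), (fun i => (x i (j i) 0)^-1 *: x i), (fun i => b i / b ord0); split.
- exists (fun i => x i (j i) 0 *: u i); split=> [i|i l]; first exact: rpredZ.
  rewrite (ev_scale _ _ (dhomogZ _ (hu i))) evZ ux expr1; case: eqP => [->|_]; last by rewrite !mulr0.
  by rewrite mulr1 mulVf.
- by move=> i; rewrite mulf_neq0 ?invr_eq0.
- by move=> i; rewrite ffunE mxE mulVf.
- by rewrite divff.
- case=> [i|]; first by apply: on_section_scale; apply: (xFL (Some i)).
  have -> : combo (fun i => (x i (j i) 0)^-1 *: x i) (fun i => b i / b ord0) None =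
      (b ord0)^-1 *: combo x a None.
    rewrite /= scaler_sumr; apply: eq_bigr => i _; rewrite !scalerA; congr (_ *: _).
    have E (A v B : k) : v != 0 -> A * v / B * v^-1 = B^-1 * A.
      by move=> v0; rewrite mulrAC mulfK // mulrC.
    exact: E.
  exact: on_section_scale.
Qed.

(** The m + 1 independent points and the combination have (m + 1) n + m
    parameters. For m > 0 each of the m + 2 points lies on its own section and on
    X, and these are (m + 2) n conditions since the points are separated by forms
    of every degree d_i >= 2. For m = 0 there is a single point, which lies on two
    sections and on X: n + (n - c) conditions, against n parameters. *)
Lemma dependent_thin m (s : option 'I_m.+1 -> 'I_n.+2) : injective s -> (m < n)%N ->
  thin2 (@dependent k n c d m.+1 s).
Proof.
move=> inj_s lt_mn.
apply: (thin2_sub (B := fun F L => exists jj : {ffun 'I_m.+1 -> 'I_n.+1},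
  exists (x : 'I_m.+1 -> 'cV[k]_n.+1) (a : 'I_m.+1 -> k),
    [/\ dual x, forall i, a i != 0, forall i, x i (jj i) 0 = 1, a ord0 = 1 &
      forall r, on_section F L (s r) (combo x a r)])).
  exact: dependent_normalize.
apply: thin2_bigU => jj.
pose T := (form_tuple k n d * lin_family k n c * ('I_m.+1 -> 'cV[k]_n.+1) * ('I_m.+1 -> k))%type.
pose F (t : T) := t.1.1.1; pose L (t : T) := t.1.1.2; pose x (t : T) := t.1.2; pose a (t : T) := t.2.
pose Z (t : T) := [/\ dual (x t), forall i, a t i != 0, forall i, x t i (jj i) 0 = 1, a t ord0 = 1 &
      forall r, on_section (F t) (L t) (s r) (combo (x t) (a t) r)].
pose f i (t : T) : {mpoly k[n.+1]} := F t i.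
pose l p (t : T) : {mpoly k[n.+1]} := L t p.1 p.2.
have hf i t : Z t -> f i t \is (tnth d i).-homog by move=> _; apply: form_homog.
have hl p t : Z t -> l p t \is 1.-homog by move=> _; apply: dhomog_is_dhomog.
pose Yx := flatten [seq chart_entries (fun t => x t i) (jj i) | i <- enum 'I_m.+1].
pose Ya := [seq (fun t => a t (lift ord0 i)) | i <- enum 'I_m].
pose X := Ya ++ Yx.
have aX : adjoins Z [::] X (m.+1 * n + m).
  rewrite /X; apply: adjoins_cat.
    have -> : (m.+1 * n = \sum_(i <- enum 'I_m.+1) n)%N.
      by rewrite big_const_seq count_predT size_enum_ord iter_addn_0 mulnC.
    by apply: adjoins_flatten => i _; apply: adjoins_chart_entries.
  have := @adjoins_free k T Z (Yx ++ [::]) Ya; rewrite size_map size_enum_ord.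
  exact.
have px i j : pfun Z X (fun t => x t i j 0).
  have x1 t : Z t -> x t i (jj i) 0 = 1 by case.
  apply: pfun_sub_dom (pfun_chart_entries x1 j) => // y yY; apply: List.in_or_app; right.
  apply: (@In_flatten k T _ _ (fun i => chart_entries (fun t => x t i) (jj i)) i) => //.
  by rewrite mem_enum.
have pa i : pfun Z X (fun t => a t i).
  case: (unliftP ord0 i) => [j ->|->].
    apply: pfun_var; apply: List.in_or_app; left.
    exact: (In_enum_map (fun i (t : T) => a t (lift ord0 i))).
  by apply: (pfun_ext (pfun_const _ _ 1)) => t [].
pose q r (t : T) := combo (x t) (a t) r.
have pq r j : pfun Z X (fun t => q r t j 0).
  case: r => [i0|]; first exact: px.
  apply: (@pfun_ext _ _ _ _ (fun t => \sum_i a t i * x t i j 0)).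
    by apply: pfun_sum => i _ _; apply: pfun_mul.
  by move=> t _; rewrite /q /= summxE; apply: eq_bigr => i _; rewrite mxE.
have q0 r t : Z t -> q r t != 0.
  move=> [[u [hu ux]] a0 _ _ _].
  have z1 v : v \is 1.-homog -> ev (0 : 'cV[k]_n.+1) v = 0.
    by move=> hv; rewrite -(scale0r (0 : 'cV_ _)) (ev_scale _ _ hv) expr1 mul0r.
  case: r => [i|]; rewrite /q /=; apply/eqP => E.
    by have := ux i i; rewrite E z1 // eqxx => /eqP; rewrite eq_sym oner_eq0.
  have := ev_lin_sum (a t) (x t) (hu ord0); rewrite E z1 // (bigD1 ord0) //= ux eqxx mulr1.
  rewrite big1 ?addr0 => [/esym/eqP|i /negPf ne]; first by rewrite (negPf (a0 _)).
  by rewrite ux eq_sym ne mulr0.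
(* for m = 0 the combination is proportional to the only point *)
pose rho := if m is 0%N then 1%N else m.+2.
pose Yf := flatten [seq coefs (tnth d i) (f i) | i <- enum 'I_c].
have aYf : adjoins Z X Yf (\sum_(i <- enum 'I_c) (#|mon n.+1 (tnth d i)| - rho)).
  apply: adjoins_flatten => i _; rewrite /rho.
  case Em: m => [|m'].
    apply: (adjoins_ev (x := q (Some ord0))) => // [t|t|t [_ _ _ _ onF]]; [exact: q0|exact: hf|].
    by have [onFi _] := onF (Some ord0); apply: onFi.
  have -> : m'.+3 = #|{: option 'I_m.+1}| by rewrite card_option card_ord Em.
  apply: (adjoins_evs (x := q)) => // [t|r t [_ _ _ _ onF]|t [dx a0 _ _ _]]; first exact: hf.
    by have [onFi _] := onF r; apply: onFi.
  rewrite /q; move: dx a0; move: (x t) (a t); clear -Em d_ge2 k.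
  by subst m => y b dy b0; apply: combo_sep.
pose tau (p : 'I_n.+2 * 'I_(n - c)) : nat := p.1 \in codom s.
pose Yl := flatten [seq coefs 1 (l p) | p <- enum {: 'I_n.+2 * 'I_(n - c)}].
have aYl : adjoins Z X Yl (\sum_(p <- enum {: 'I_n.+2 * 'I_(n - c)}) (#|mon n.+1 1| - tau p)).
  apply: adjoins_flatten => p _; rewrite /tau.
  case: (boolP (p.1 \in codom s)) => [/codomP[r pr]|_]; last first.
    by rewrite subn0; apply: adjoins_free_form.
  apply: (adjoins_ev (x := q r)) => // [t|t|t [_ _ _ _ onF]]; [exact: q0|exact: hl|].
  by rewrite /l pr; have [_ onL] := onF r; apply: onL.
have aFX := adjoins_step aX aYf.
have aY := adjoins_step aFX (adjoins_sub (fun y yX => List.in_or_app Yf X y (or_intror yX)) aYl).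
apply: thin2_sub (thin2_family (F := F) (L := L) aY _ _ _).
- by move=> G M [y [b H]]; exists (G, M, y, b).
- move=> i; apply: (pfunm_coefs (hf i)) => y yY; apply: List.in_or_app; right.
  apply: List.in_or_app; left; apply: (@In_flatten k T _ _ (fun i => coefs (tnth d i) (f i)) i) yY.
  by rewrite mem_enum.
- move=> j b; apply: (pfunm_coefs (hl (j, b))) => y yY; apply: List.in_or_app; left.
  by apply: (@In_flatten k T _ _ (fun p => coefs 1 (l p)) (j, b)) yY; rewrite mem_enum.
have rhoN i : (rho <= #|mon n.+1 (tnth d i)|)%N.
  apply: leq_trans (card_mon_ge n (ltnW (d_ge2 i))); rewrite /rho; clear -lt_mn.
  by case: (m) lt_mn => [|m'] /= lt_mn; lia.
have tauN p : (tau p <= #|mon n.+1 1|)%N.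
  by apply: leq_trans (leq_b1 _) (leq_trans _ (card_mon_ge n (ltn0Sn 0))).
rewrite !sum_over_enum (sum_sub_nat rhoN) (sum_sub_nat tauN) /=.
have -> : (\sum_(i < c) rho = c * rho)%N by rewrite sum_nat_const card_ord.
have -> : (\sum_(p : 'I_n.+2 * 'I_(n - c)) tau p = m.+2 * (n - c))%N.
  rewrite -(pair_big xpredT xpredT (fun j _ => (j \in codom s : nat))) /=.
  under eq_bigr do rewrite sum_nat_const card_ord mulnC.
  by rewrite -big_distrl /= -big_mkcond /= sum1_card card_codom // card_option card_ord.
move: (\sum_(i < c) _)%N (\sum_(p : 'I_n.+2 * 'I_(n - c)) _)%N => A B.
suff : (m.+1 * n + m < c * rho + m.+2 * (n - c))%N by clear; lia.
rewrite /rho; clear -lt_mn c_lt_n; case: m lt_mn => [|m] lt_mn; first by lia.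
have -> : (c * m.+3 + m.+3 * (n - c) = m.+3 * n)%N by rewrite mulnC -mulnDr subnKC // ltnW.
by clear -lt_mn; nia.
Qed.
End Position.

(** * Two fixed quadrics *)

Section PointConditions.
Variables (k : closedFieldType) (n : nat).
Hypothesis char2 : 2%N \in [pchar k].
Implicit Types (p q : {mpoly k[n.+1]}) (x y : 'cV[k]_n.+1) (N : 'M[k]_n.+1).

Lemma lin_nonzero2 x y : x != 0 -> y != 0 ->
  exists2 l : {mpoly k[n.+1]}, l \is 1.-homog & (ev x l != 0) && (ev y l != 0).
Proof.
move=> /exists_coord[i xi] /exists_coord[j yj].
case: (eqVneq (y i 0) 0) => yi; last by exists 'X_i; rewrite ?homogX // !evXU xi.
case: (eqVneq (x j 0) 0) => xj; last by exists 'X_j; rewrite ?homogX // !evXU yj xj.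
exists ('X_i + 'X_j); first by rewrite rpredD ?homogX.
by rewrite !evD !evXU yi xj addr0 add0r xi.
Qed.

Lemma lin_separate x y : y != 0 -> (forall a, x != a *: y) ->
  exists2 l : {mpoly k[n.+1]}, l \is 1.-homog & (ev x l != 0) && (ev y l == 0).
Proof.
move=> /exists_coord[j yj] ne.
have [i] : exists i, (x - (x j 0 / y j 0) *: y) i 0 != 0.
  by apply: exists_coord; rewrite subr_eq0.
rewrite !mxE => xi; exists ('X_i - (y i 0 / y j 0) *: 'X_j).
  by rewrite rpredB ?rpredZ ?homogX.
rewrite !evB !evZ !evXU divfK // subrr eqxx andbT; apply: contraNneq xi => /eqP.
by rewrite subr_eq0 => /eqP ->; apply/eqP; field.
Qed.

Lemma adjoins_ev2 (T : Type) (Z : T -> Prop) X d f (x y : T -> 'cV[k]_n.+1) : (0 < d)%N ->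
  (forall i, pfun Z X (fun t => x t i 0)) -> (forall i, pfun Z X (fun t => y t i 0)) ->
  (forall t, Z t -> x t != 0) -> (forall t, Z t -> y t != 0) ->
  (forall t, Z t -> forall a, x t != a *: y t) ->
  (forall t, Z t -> f t \is d.-homog) ->
  (forall t, Z t -> ev (x t) (f t) = 0) -> (forall t, Z t -> ev (y t) (f t) = 0) ->
  adjoins Z X (coefs d f) (#|mon n.+1 d| - 2).
Proof.
move=> d0 px py x0 y0 ne hf fx fy; rewrite -card_bool.
apply: (@adjoins_evs _ _ _ _ _ _ _ bool (fun b t => if b then x t else y t)).
- by case.
- exact: hf.
- by case=> t Zt; [apply: fx|apply: fy].
move=> t Zt.
have ne' a : y t != a *: x t.
  apply/eqP => E; have a0 : a != 0.
    by apply: contraTneq (y0 t Zt) => a0; rewrite E a0 scale0r eqxx.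
  by have := ne t Zt a^-1; rewrite E scalerA mulVf // scale1r eqxx.
have [l hl /andP[lx /eqP ly]] := lin_separate (y0 t Zt) (ne t Zt).
have [l' hl' /andP[ly' /eqP lx']] := lin_separate (x0 t Zt) ne'.
have [i xi] := exists_coord (x0 t Zt); have [j yj] := exists_coord (y0 t Zt).
exists (fun b => if b then l * 'X_i ^+ (d - 1) else l' * 'X_j ^+ (d - 1)); split.
- by case; [have := dhomogM hl (homogXe _ i (d - 1))|have := dhomogM hl' (homogXe _ j (d - 1))];
    rewrite subnKC.
- by case; rewrite evM mulf_neq0 // ev_exp evXU expf_neq0.
- by case; case=> // _; rewrite evM ?ly ?lx' mul0r.
Qed.

(** Passing through p is independent of being fixed by h = 1 + N: for a linear
    form l that vanishes neither at p nor at h p, the quadric l (l o h) is fixed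
    and does not contain p. *)
Lemma adjoins_fixed_quadric (T : Type) (Z : T -> Prop) X f (N : T -> 'M[k]_n.+1) (p : T -> 'cV[k]_n.+1) r :
  (r + r <= n.+1)%N ->
  (forall i j, pfun Z X (fun t => N t i j)) -> (forall i, pfun Z X (fun t => p t i 0)) ->
  (forall t, Z t -> N t *m N t = 0) -> (forall t, Z t -> \rank (N t) = r) ->
  (forall t, Z t -> p t != 0) ->
  (forall t, Z t -> f t \is 2.-homog) -> (forall t, Z t -> Dop (N t) (f t) = 0) ->
  (forall t, Z t -> ev (p t) (f t) = 0) ->
  adjoins Z X (coefs 2 f) (#|mon n.+1 2| - (r * (n.+1 - r)).+1).
Proof.
move=> le_r pN pp NN rN p0 hf Df fp.
apply: (@adjoins_form _ _ _ _ _ _ _ (option (mon n.+1 2))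
  (fun o t q => if o is Some m then (Dop (N t) q)@_(mon_val m) else ev (p t) q) (fun _ _ => 0)).
- exact: hf.
- by case=> [m|] t; [apply: Dop_scalar|apply: ev_scalar].
- by case=> [m|] m'; [apply: pfun_DopX|apply: pfun_evX].
- by move=> o; apply: pfun_const.
- by case=> [m|] t Zt; rewrite ?Df ?mcoeff0 ?fp.
move=> t Zt; have nf : swap_orbits (\rank (N t)) n.+1 2 (r * (n.+1 - r)) by rewrite rN //; apply: swap_orbits_quadric.
have [J [w [cJ hw iw]]] := Dop_indep char2 (NN t Zt) nf.
have hp0 : (1%:M + N t) *m p t != 0.
  apply: contraNneq (p0 t Zt) => E; have : (1%:M - N t) *m ((1%:M + N t) *m p t) = p t.
    by rewrite mulmxA mulmxBl mulmxDr mulmxDr !mul1mx !mulmx1 NN // addr0 addrK mul1mx.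
  by rewrite E mulmx0 => <-.
have [l hl /andP[lp lhp]] := lin_nonzero2 (p0 t Zt) hp0.
(* a fixed quadric that does not contain p *)
pose nu := l * pullback (1%:M + N t) l.
have hnu : nu \is 2.-homog by apply: (@dhomogM _ _ mdeg 1 _ 1) => //; apply: pullback_homog.
have Dnu : Dop (N t) nu = 0.
  have cN : N t + N t = 0 by rewrite -mulr2n -scaler_nat (pcharf0 char2) scale0r.
  rewrite /Dop /nu pullbackM pullback_comp mulmxDr mulmxDl mulmxDl !mul1mx mulmx1 NN // addr0.
  by rewrite -addrA cN addr0 pullback1 mulrC subrr.
have nup : ev (p t) nu != 0 by rewrite evM ev_pullback mulf_neq0.
exists (option J), (fun o => if o is Some j then w j else nu); split.
- by rewrite card_option ltnS.
- by case.
move=> a Ha; have aS j : a (Some j) = 0.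
  apply: (iw (fun j => a (Some j))); apply/mpolyP => m; rewrite mcoeff0.
  have hD : \sum_j a (Some j) *: Dop (N t) (w j) \is 2.-homog.
    by apply: rpred_sum => i _; apply: rpredZ; apply: Dop_homog.
  case: (eqVneq (mdeg m) 2%N) => [/eqP md|md]; last by rewrite (dhomog_nemf_coeff hD).
  have := Ha (Some (mon_of md)); rewrite big_option Dnu mcoeff0 mulr0 add0r => E.
  by rewrite raddf_sum -[RHS]E; apply: eq_bigr => i _; rewrite /= mcoeffZ.
case=> [j|]; first exact: aS.
have := Ha None; rewrite big_option big1 => [/eqP|j _]; last by rewrite aS mul0r.
by rewrite addr0 mulf_eq0 (negPf nup) orbF => /eqP.
Qed.
End PointConditions.

Section Pencil.
Variables (k : closedFieldType) (n c : nat) (d : c.-tuple nat).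
Hypothesis char2 : 2%N \in [pchar k].
Hypothesis d_ge2 : forall i, (2 <= tnth d i)%N.
Hypothesis c_lt_n : (c < n)%N.

(** Two fixed quadrics, and a point p of X on the j-th section that is moved by
    1 + N to another point of X; the latter is recorded for F_i1 only. *)
Definition pencil_event (i0 i0' i1 : 'I_c) (F : form_tuple k n d) (L : lin_family k n c) :=
  exists (N : 'M[k]_n.+1) (j : 'I_n.+2) (p : 'cV[k]_n.+1),
    [/\ N *m N = 0, N *m p != 0, on_section F L j p,
        Dop N (F i0) = 0 /\ Dop N (F i0') = 0 & ev ((1%:M + N) *m p) (F i1) = 0].

(** With a = r (n + 1 - r) there are 2 a parameters for N and n for p.
    There are a + 1 conditions on each quadric, 2 on F_i1, 1 on each of the c - 3
    other forms and n - c on the section through p, which is 2 a + n + 1. *)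
Lemma pencil_chart_thin (i0 i0' i1 : 'I_c) r (f : 'I_r -> 'I_n.+1) (jj : 'I_n.+1) (j : 'I_n.+2) :
  (r + r <= n.+1)%N -> tnth d i0 = 2%N -> tnth d i0' = 2%N -> (2 < tnth d i1)%N -> i0 != i0' ->
  thin2 (fun (F : form_tuple k n d) (L : lin_family k n c) => exists (u : 'M[k]_(n.+1, r)) (v : 'M[k]_(r, n.+1)) (p : 'cV[k]_n.+1),
    [/\ rowsub f u = 1%:M, v *m u = 0, \rank (u *m v) = r &
     [/\ p jj 0 = 1, u *m v *m p != 0, on_section F L j p,
        Dop (u *m v) (F i0) = 0 /\ Dop (u *m v) (F i0') = 0 & ev ((1%:M + u *m v) *m p) (F i1) = 0]]).
Proof.
move=> le_r d0 d0' d1 ne00'.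
have ne01 : i0 != i1 by apply: contraTneq d1 => <-; rewrite d0.
have ne01' : i0' != i1 by apply: contraTneq d1 => <-; rewrite d0'.
pose T := (form_tuple k n d * lin_family k n c * 'M[k]_(n.+1, r) * 'M[k]_(r, n.+1) * 'cV[k]_n.+1)%type.
pose F (t : T) : form_tuple k n d := t.1.1.1.1; pose L (t : T) : lin_family k n c := t.1.1.1.2; pose u (t : T) := t.1.1.2.
pose v (t : T) := t.1.2; pose p (t : T) := t.2; pose N t := u t *m v t.
pose q t := (1%:M + N t) *m p t.
pose Z (t : T) := [/\ rowsub f (u t) = 1%:M, v t *m u t = 0, \rank (u t *m v t) = r &
     [/\ p t jj 0 = 1, u t *m v t *m p t != 0, on_section (F t) (L t) j (p t),
        Dop (u t *m v t) (F t i0) = 0 /\ Dop (u t *m v t) (F t i0') = 0 &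
        ev ((1%:M + u t *m v t) *m p t) (F t i1) = 0]].
pose g i (t : T) : {mpoly k[n.+1]} := F t i.
pose l b (t : T) : {mpoly k[n.+1]} := L t b.1 b.2.
have hg i t : Z t -> g i t \is (tnth d i).-homog by move=> _; apply: form_homog.
have hl b t : Z t -> l b t \is 1.-homog by move=> _; apply: dhomog_is_dhomog.
have NN t : Z t -> N t *m N t = 0.
  by move=> [_ vu _ _]; rewrite /N mulmxA -(mulmxA (u t)) vu mulmx0 mul0mx.
have rN t : Z t -> \rank (N t) = r by case.
have Np0 t : Z t -> N t *m p t != 0 by move=> [_ _ _ []].
have p0 t : Z t -> p t != 0 by move/Np0; apply: contraNneq => ->; rewrite mulmx0.
have Nq t : Z t -> N t *m q t = N t *m p t.
  by move=> Zt; rewrite /q mulmxA mulmxDr mulmx1 NN // addr0.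
have q0 t : Z t -> q t != 0.
  by move=> Zt; have := Np0 _ Zt; rewrite -Nq //; apply: contraNneq => ->; rewrite mulmx0.
have pq t : Z t -> forall a, p t != a *: q t.
  move=> Zt a; apply/eqP => E; have := Np0 _ Zt.
  have E1 : N t *m p t = a *: (N t *m p t) by rewrite -{2}(Nq _ Zt) scalemxAr -E.
  have : q t = p t + N t *m p t by rewrite /q mulmxDl mul1mx.
  have [a1|a1] := eqVneq a 1.
    rewrite a1 scale1r in E; rewrite -E => /eqP.
    by rewrite addrC -subr_eq subrr eq_sym => ->.
  move=> _ /negP[]; move/eqP: E1; rewrite -subr_eq0 -{1}(scale1r (N t *m p t)) -scalerBl scaler_eq0.
  by rewrite subr_eq0 eq_sym (negPf a1).
pose X := chart_entries p jj ++ (mx_entries u ++ mx_entries v).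
have aX : adjoins Z [::] X (2 * (r * (n.+1 - r)) + n).
  rewrite /X; apply: adjoins_cat; last exact: adjoins_chart_entries.
  by apply: (@adjoins_sqz k T Z [::] n.+1 r f) => t [].
have pp i : pfun Z X (fun t => p t i 0).
  have p1 t : Z t -> p t jj 0 = 1 by move=> [_ _ _ []].
  by apply: pfun_sub_dom (pfun_chart_entries p1 i) => // y yY; apply: List.in_or_app; left.
have pN a b : pfun Z X (fun t => N t a b).
  by apply: pfun_mulmx => y yY; apply: List.in_or_app; right.
have pfq i : pfun Z X (fun t => q t i 0).
  apply: (@pfun_ext _ _ _ _ (fun t => p t i 0 + \sum_b N t i b * p t b 0)).
    by apply: pfun_add => //; apply: pfun_sum => b _ _; apply: pfun_mul.
  by move=> t _; rewrite /q mulmxDl mul1mx !mxE.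
pose rho i := if (i == i0) || (i == i0') then (r * (n.+1 - r)).+1 else if i == i1 then 2%N else 1%N.
pose Yg := flatten [seq coefs (tnth d i) (g i) | i <- enum 'I_c].
have Fp i t : Z t -> ev (p t) (g i t) = 0 by move=> [_ _ _ [_ _ [Fp _] _ _]]; apply: Fp.
have aYg : adjoins Z X Yg (\sum_(i <- enum 'I_c) (#|mon n.+1 (tnth d i)| - rho i)).
  apply: adjoins_flatten => i _; rewrite /rho.
  have quad : (i == i0) || (i == i0') ->
      adjoins Z X (coefs (tnth d i) (g i)) (#|mon n.+1 (tnth d i)| - (r * (n.+1 - r)).+1).
    move=> ii0; have di : tnth d i = 2%N by case/orP: ii0 => /eqP->.
    rewrite di; apply: (adjoins_fixed_quadric char2 (N := N) (p := p)) => //.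
    - by move=> t Zt; rewrite -di; apply: hg.
    - by move=> t [_ _ _ [_ _ _ [D0 D0'] _]]; case/orP: ii0 => /eqP->.
    - exact: Fp.
  case: ifP => // _; case: eqP => [->|_].
    apply: (adjoins_ev2 (x := p) (y := q)) => //; first by apply: ltnW; apply: ltnW.
    - exact: hg.
    - exact: Fp.
    - by move=> t [_ _ _ []].
  by apply: (adjoins_ev (x := p)) => //; [apply: hg|apply: Fp].
pose tau (b : 'I_n.+2 * 'I_(n - c)) : nat := b.1 == j.
pose Yl := flatten [seq coefs 1 (l b) | b <- enum {: 'I_n.+2 * 'I_(n - c)}].
have aYl : adjoins Z X Yl (\sum_(b <- enum {: 'I_n.+2 * 'I_(n - c)}) (#|mon n.+1 1| - tau b)).
  apply: adjoins_flatten => b _; rewrite /tau.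
  case: eqP => [bj|_]; last by rewrite subn0; apply: adjoins_free_form.
  apply: (adjoins_ev (x := p)) => //; first exact: hl.
  by move=> t [_ _ _ [_ _ [_ Lp] _ _]]; rewrite /l bj; apply: Lp.
have aGX := adjoins_step aX aYg.
have aY := adjoins_step aGX (adjoins_sub (fun y yX => List.in_or_app Yg X y (or_intror yX)) aYl).
apply: thin2_sub (thin2_family (F := F) (L := L) aY _ _ _).
- by move=> G M [u' [v' [p' H]]]; exists (G, M, u', v', p').
- move=> i; apply: (pfunm_coefs (hg i)) => y yY; apply: List.in_or_app; right.
  apply: List.in_or_app; left; apply: (@In_flatten k T _ _ (fun i => coefs (tnth d i) (g i)) i) yY.
  by rewrite mem_enum.
- move=> a b; apply: (pfunm_coefs (hl (a, b))) => y yY; apply: List.in_or_app; left.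
  by apply: (@In_flatten k T _ _ (fun p => coefs 1 (l p)) (a, b)) yY; rewrite mem_enum.
have rhoN i : (rho i <= #|mon n.+1 (tnth d i)|)%N.
  rewrite /rho; case: ifP => [ii0|_].
    have -> : tnth d i = 2%N by case/orP: ii0 => /eqP->.
    by move: (card_mon2 n); clear -le_r c_lt_n; nia.
  have := card_mon_ge n (ltnW (d_ge2 i)); case: ifP => _; clear -c_lt_n; lia.
have tauN b : (tau b <= #|mon n.+1 1|)%N.
  by apply: leq_trans (leq_b1 _) (leq_trans _ (card_mon_ge n (ltn0Sn 0))).
rewrite !sum_over_enum (sum_sub_nat rhoN) (sum_sub_nat tauN) /=.
have -> : (\sum_b tau b = n - c)%N.
  rewrite -(pair_big xpredT xpredT (fun a _ => (a == j : nat))) /=.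
  rewrite (bigD1 j) //= [X in (_ + X)%N]big1 => [|a /negPf ->]; last by rewrite big1.
  by rewrite eqxx addn0 sum_nat_const card_ord muln1.
have c3 : #|[set i0; i0'; i1]| = 3%N.
  by rewrite -setUA cardsU1 cards2 !inE negb_or ne00' ne01 ne01'.
have : (2 * (r * (n.+1 - r)).+1 + 2 + (c - 3) <= \sum_i rho i)%N.
  rewrite (bigD1 i0) //= (bigD1 i0') /=; last by rewrite eq_sym ne00'.
  rewrite (bigD1 i1) /=; last by rewrite eq_sym ne01 eq_sym ne01'.
  have -> : rho i0 = (r * (n.+1 - r)).+1 by rewrite /rho eqxx.
  have -> : rho i0' = (r * (n.+1 - r)).+1 by rewrite /rho eqxx orbT.
  have -> : rho i1 = 2%N by rewrite /rho eqxx eq_sym (negPf ne01) eq_sym (negPf ne01').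
  rewrite mul2n -addnn -!addnA !leq_add2l.
  rewrite (eq_bigr (fun=> 1%N)) => [|i /andP[/andP[ni0 ni0'] ni1]].
    rewrite sum1_card -{1}(card_ord c) leq_subLR.
    rewrite -c3.
    rewrite -(cardsC [set i0; i0'; i1]) leq_add2l; apply: subset_leq_card; apply/subsetP => i.
    by rewrite !inE !negb_or.
  by rewrite /rho (negPf ni0) (negPf ni0') (negPf ni1).
move: (\sum_i rho i)%N (\sum_(i < c) (_ - rho i))%N (\sum_(b : 'I_n.+2 * 'I_(n - c)) _)%N (r * (n.+1 - r))%N.
have c3' : (2 < c)%N.
  by rewrite -c3 -[X in (_ <= X)%N]card_ord; apply: max_card.
by clear -c_lt_n c3'; lia.
Qed.

Lemma pencil_thin (i0 i0' i1 : 'I_c) :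
  tnth d i0 = 2%N -> tnth d i0' = 2%N -> (2 < tnth d i1)%N -> i0 != i0' ->
  thin2 (pencil_event i0 i0' i1).
Proof.
move=> d0 d0' d1 ne.
pose B (r : 'I_n.+2) (f : {ffun 'I_r -> 'I_n.+1}) jj j (F : form_tuple k n d) (L : lin_family k n c) :=
  (r + r <= n.+1)%N /\ exists (u : 'M[k]_(n.+1, r)) (v : 'M[k]_(r, n.+1)) (p : 'cV[k]_n.+1),
    [/\ rowsub f u = 1%:M, v *m u = 0, \rank (u *m v) = r &
     [/\ p jj 0 = 1, u *m v *m p != 0, on_section F L j p,
        Dop (u *m v) (F i0) = 0 /\ Dop (u *m v) (F i0') = 0 & ev ((1%:M + u *m v) *m p) (F i1) = 0]].
apply: (thin2_sub (B := fun F L => exists r f jj j, @B r f jj j F L)); last first.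
  apply: thin2_bigU => r; apply: thin2_bigU => f; apply: thin2_bigU => jj; apply: thin2_bigU => j.
  case: (leqP (r + r) n.+1) => [le_r|nle_r].
    by apply: thin2_sub (@pencil_chart_thin i0 i0' i1 r f jj j le_r d0 d0' d1 ne) => F L [].
  by exists 1; [apply: oner_neq0|move=> F L []; rewrite leqNgt nle_r].
move=> F L [N [j [p [NN Np0 Fp [D0 D0'] qF]]]].
have [f [u [v [Nuv fu vu _]]]] := sqz_factor NN.
have lt_r : (\rank N < n.+2)%N by rewrite ltnS rank_leq_row.
have p0 : p != 0 by apply: contraNneq Np0 => ->; rewrite mulmx0.
have [jj pjj] := exists_coord p0.
exists (Ordinal lt_r), f, jj, j; split.
  by have := sqz_rank NN; rewrite mul2n -addnn.
exists u, v, ((p jj 0)^-1 *: p); rewrite -Nuv; split=> //; split=> //.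
- by rewrite mxE mulVf.
- by rewrite -scalemxAr scaler_eq0 invr_eq0 (negPf pjj).
- exact: on_section_scale.
- by rewrite -scalemxAr (ev_scale _ _ (form_homog F i1)) qF mulr0.
Qed.
End Pencil.

(** * The forms of lowest degree *)

Section LowestBlock.
Variables (k : closedFieldType) (n c : nat) (d : c.-tuple nat).
Hypothesis char2 : 2%N \in [pchar k].
Variables (c1 : nat) (e : 'I_c1 -> 'I_c) (d0 : nat).
Hypothesis inj_e : injective e.
Hypothesis deg_e : forall i, tnth d (e i) = d0.

(** 1 + N acts on the forms of the group e by the constant matrix 1 + B. *)
Definition block_event r s (F : form_tuple k n d) :=
  exists (N : 'M[k]_n.+1) (B : 'M[k]_c1),
    [/\ N *m N = 0, \rank N = r, B *m B = 0, \rank B = s &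
        forall i, Dop N (F (e i)) = \sum_j B i j *: (F (e j) : {mpoly k[n.+1]})].

(** Put B = u' v' as in [sqz_factor], so that v' F = D F_f' on the pivot rows
    f' and D F = u' D F_f'. The s pivot forms F_f' are free parameters. The
    c1 - 2 s forms outside f' and g satisfy rho conditions each, since D F is
    known for them. The s forms F_g are then determined by v' F = D F_f', the
    columns g of v' being invertible. *)
Lemma block_chart_thin r s rho (f : 'I_r -> 'I_n.+1) (f' g : 'I_s -> 'I_c1) :
  (r + r <= n.+1)%N -> swap_orbits r n.+1 d0 rho -> injective f' -> injective g ->
  (forall l l', g l != f' l') ->
  (2 * (r * (n.+1 - r)) + 2 * (s * (c1 - s)) < s * #|mon n.+1 d0| + (c1 - 2 * s) * rho)%N ->
  thin (fun F : form_tuple k n d => exists (u : 'M[k]_(n.+1, r)) (v : 'M[k]_(r, n.+1))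
     (u' : 'M[k]_(c1, s)) (v' : 'M[k]_(s, c1)),
    [/\ rowsub f u = 1%:M, v *m u = 0, \rank (u *m v) = r &
     [/\ rowsub f' u' = 1%:M, v' *m u' = 0, colsub g v' \in unitmx &
       forall i, Dop (u *m v) (F (e i)) = \sum_j (u' *m v') i j *: (F (e j) : {mpoly k[n.+1]})]]).
Proof.
move=> le_r nf inj_f' inj_g gf' num.
pose T := (form_tuple k n d * 'M[k]_(n.+1, r) * 'M[k]_(r, n.+1) * 'M[k]_(c1, s) * 'M[k]_(s, c1))%type.
pose F (t : T) : form_tuple k n d := t.1.1.1.1; pose u (t : T) := t.1.1.1.2.
pose v (t : T) := t.1.1.2; pose u' (t : T) := t.1.2; pose v' (t : T) := t.2; pose N t := u t *m v t.
pose Z (t : T) := [/\ rowsub f (u t) = 1%:M, v t *m u t = 0, \rank (u t *m v t) = r &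
     [/\ rowsub f' (u' t) = 1%:M, v' t *m u' t = 0, colsub g (v' t) \in unitmx &
       forall i, Dop (u t *m v t) (F t (e i)) =
         \sum_j (u' t *m v' t) i j *: (F t (e j) : {mpoly k[n.+1]})]].
pose h i (t : T) : {mpoly k[n.+1]} := F t i.
have hh i t : Z t -> h i t \is (tnth d i).-homog by move=> _; apply: form_homog.
have hhe i t : Z t -> h (e i) t \is d0.-homog by move=> Zt; rewrite -(deg_e i); apply: hh.
have NN t : Z t -> N t *m N t = 0.
  by move=> [_ vu _ _]; rewrite /N mulmxA -(mulmxA (u t)) vu mulmx0 mul0mx.
have rN t : Z t -> \rank (N t) = r by case.
have uvE t i j : (u' t *m v' t) i j = \sum_l u' t i l * v' t l j by rewrite mxE.
have Dpiv l t : Z t -> Dop (N t) (h (e (f' l)) t) = \sum_j v' t l j *: h (e j) t.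
  move=> [_ _ _ [fu _ _ ->]]; apply: eq_bigr => j _; congr (_ *: _).
  transitivity (rowsub f' (u' t *m v' t) l j); first by rewrite !mxE.
  by rewrite rowsub_mul fu mul1mx.
have Dmid i t : Z t -> Dop (N t) (h (e i) t) = \sum_l u' t i l *: Dop (N t) (h (e (f' l)) t).
  move=> Zt; have [_ _ _ [_ _ _ ->]] := Zt.
  under [RHS]eq_bigr => l _ do rewrite (Dpiv l t Zt) scaler_sumr.
  rewrite exchange_big; apply: eq_bigr => j _ /=; rewrite uvE scaler_suml.
  by apply: eq_bigr => l _; rewrite scalerA.
pose X := (mx_entries u' ++ mx_entries v') ++ (mx_entries u ++ mx_entries v).
have aX : adjoins Z [::] X (2 * (r * (n.+1 - r)) + 2 * (s * (c1 - s))).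
  rewrite /X; apply: adjoins_cat.
    by apply: (@adjoins_sqz k T Z [::] n.+1 r f) => t [].
  by apply: (@adjoins_sqz k T Z _ c1 s f') => t [_ _ _ []].
have pN a b : pfun Z X (fun t => N t a b).
  by apply: pfun_mulmx => y yY; apply: List.in_or_app; right.
have pu' a b : pfun Z X (fun t => u' t a b).
  apply: pfun_var; apply: List.in_or_app; left; apply: List.in_or_app; left; exact: In_mx_entries.
have pv' a b : pfun Z X (fun t => v' t a b).
  apply: pfun_var; apply: List.in_or_app; left; apply: List.in_or_app; right; exact: In_mx_entries.
(* the forms outside K are free parameters *)
pose S := [set f' l | l : 'I_s]; pose P := [set g l | l : 'I_s].
pose K := [set e j | j in ~: S].
pose Y1 := flatten [seq (if i \in K then [::] else coefs (tnth d i) (h i)) | i <- enum 'I_c].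
have aY1 : adjoins Z X Y1 (\sum_(i <- enum 'I_c) if i \in K then 0%N else #|mon n.+1 (tnth d i)|).
  apply: adjoins_flatten => i _; case: ifP => _; first exact: adjoins_nil.
  exact: adjoins_free_form.
have inY1 i y : i \notin K -> List.In y (coefs (tnth d i) (h i)) -> List.In y Y1.
  move=> iK yY; apply: (@In_flatten k T _ _ (fun i => if i \in K then [::] else _) i).
    by rewrite mem_enum.
  by rewrite (negPf iK).
have fK l : e (f' l) \notin K.
  by apply/imsetP => -[j]; rewrite inE => jS /inj_e E; rewrite -E imset_f in jS.
pose X1 := Y1 ++ X.
have XX1 y : List.In y X -> List.In y X1 by move=> yX; apply: List.in_or_app; right.
have pf1 l : pfunm Z X1 (h (e (f' l))).
  apply: (pfunm_coefs (hh _)) => y /inY1 yY; apply: List.in_or_app; left; exact: yY.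
have pN1 a b : pfun Z X1 (fun t => N t a b) by apply: pfun_sub_dom (pN a b).
pose mid j := (j \notin S) && (j \notin P).
pose Y2 := flatten [seq (if mid j then coefs d0 (h (e j)) else [::]) | j <- enum 'I_c1].
have aY2 : adjoins Z X1 Y2 (\sum_(j <- enum 'I_c1) if mid j then (#|mon n.+1 d0| - rho)%N else 0%N).
  apply: adjoins_flatten => j _; case: ifP => _; last exact: adjoins_nil.
  apply: (adjoins_Dop char2 (r := r) pN1 NN rN (hhe j) _ (Dmid j) nf).
  apply: pfunm_sum => l; apply: pfunm_scale; first by apply: pfun_sub_dom (pu' j l).
  by apply: (pfun_Dop pN1 (d := d0)) => // t; apply: hhe.
pose X2 := Y2 ++ X1.
have XX2 y : List.In y X1 -> List.In y X2 by move=> yX; apply: List.in_or_app; right.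
have pmid j : j \notin P -> pfunm Z X2 (h (e j)).
  move=> jP; case: (boolP (j \in S)) => [/imsetP[l _ ->]|jS].
    by apply: pfunm_sub_dom (pf1 l).
  apply: (pfunm_coefs (hhe j)) => y yY; apply: List.in_or_app; left.
  apply: (@In_flatten k T _ _ (fun j => if mid j then coefs d0 (h (e j)) else [::]) j).
    by rewrite mem_enum.
  by rewrite /mid jP jS.
pose W l t := Dop (N t) (h (e (f' l)) t) - \sum_j (if j \in P then 0 else v' t l j *: h (e j) t).
have pW l : pfunm Z X2 (W l).
  apply: pfunm_sub.
    apply: (pfun_Dop (d := d0)) => [a b|t|]; [by apply: pfun_sub_dom (pN1 a b)|exact: hhe|].
    by apply: pfunm_sub_dom (pf1 l).
  apply: pfunm_sum => j; case: (boolP (j \in P)) => jP; first exact: pfunm_const.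
  apply: pfunm_scale; last exact: pmid.
  apply: pfun_sub_dom (pv' l j) => // y yX; exact: XX2 (XX1 y yX).
have WE l t : Z t -> W l t = \sum_l' v' t l (g l') *: h (e (g l')) t.
  move=> Zt; rewrite /W Dpiv // (bigID (mem P)) /= [X in _ - X](bigID (mem P)) /=.
  rewrite [X in _ - (X + _)]big1 => [|j ->] //; rewrite add0r.
  rewrite [X in _ - X](eq_bigr (fun j => v' t l j *: h (e j) t)) => [|j /negPf ->] //.
  by rewrite addrK big_imset //= => ? ? _ _; apply: inj_g.
(* the linear system for the forms of the columns g, one monomial at a time *)
pose x m t : 'cV[k]_s := \col_l (h (e (g l)) t)@_m.
pose Y3 := flatten [seq [seq (fun t => x (mon_val m) t j 0) | j <- enum 'I_s] | m <- enum (mon n.+1 d0)].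
have aY3 : adjoins Z X2 Y3 (\sum_(m <- enum (mon n.+1 d0)) 0).
  apply: adjoins_flatten => m _; apply: (adjoins_leq (eq_leq (subnn s))).
  apply: (@adjoins_linear _ _ _ _ _ _ _ (fun t => colsub g (v' t)) (fun t => \col_l (W l t)@_(mon_val m))).
  - move=> a b; apply: (@pfun_ext _ _ _ _ (fun t => v' t a (g b))) => [|t _]; last by rewrite mxE.
    by apply: pfun_sub_dom (pv' a (g b)) => // y yX; exact: XX2 (XX1 y yX).
  - move=> a; apply: (@pfun_ext _ _ _ _ (fun t => (W a t)@_(mon_val m))) => [|t _]; last by rewrite mxE.
    exact: pW.
  - move=> t Zt; apply/colP => a; rewrite !mxE (WE a t Zt) raddf_sum; apply: eq_bigr => b _.
    by rewrite !mxE /= mcoeffZ.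
  - by move=> t [_ _ _ [_ _ /mxrank_unit ->]].
have aX1 := adjoins_step aX aY1.
have aX2 := adjoins_step aX1 aY2.
have aX3 := adjoins_step aX2 aY3.
apply: thin_sub (thin_family (F := F) aX3 _ _).
- by move=> G [u0 [v0 [u1 [v1 H]]]]; exists (G, u0, v0, u1, v1).
- have pY3 l : pfunm Z (Y3 ++ X2) (h (e (g l))).
    move=> m; case: (eqVneq (mdeg m) d0) => [/eqP md|md]; last first.
      by apply: (@pfun_ext _ _ _ _ _ _ (pfun_const _ _ 0)) => t Zt; rewrite (dhomog_nemf_coeff (hhe _ t Zt)).
    apply: (@pfun_ext _ _ _ _ (fun t => x m t l 0)) => [|t _]; last by rewrite mxE.
    apply: pfun_var; apply: List.in_or_app; left.
    apply: (@In_flatten k T _ _ (fun m => [seq (fun t => x (mon_val m) t j 0) | j <- enum 'I_s]) (mon_of md)).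
      by rewrite mem_enum.
    exact: (In_enum_map (fun j t => x m t j 0)).
  move=> i; case: (boolP (i \in K)) => [/imsetP[j _ ->]|iK].
    case: (boolP (j \in P)) => [/imsetP[l _ ->]|jP]; first exact: pY3.
    by apply: pfunm_sub_dom (pmid j jP) => // y yX; apply: List.in_or_app; right.
  apply: (pfunm_coefs (hh i)) => y /(inY1 _ _ iK) yY.
  by apply: List.in_or_app; right; apply: XX2; apply: List.in_or_app; left.
rewrite !sum_over_enum big1_eq addn0.
have cS : #|S| = s by rewrite card_imset // card_ord.
have cP : #|P| = s by rewrite card_imset // card_ord.
have dSP : [disjoint S & P].
  rewrite -setI_eq0; apply/eqP/setP => j; rewrite !inE; apply: contraTF isT.
  by case/andP => /imsetP[l _ ->] /imsetP[l' _ E]; have := gf' l' l; rewrite E eqxx.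
have cSP : #|S :|: P| = (2 * s)%N by rewrite cardsU disjoint_setI0 // cards0 subn0 cS cP mul2n addnn.
have c2s : (2 * s <= c1)%N by rewrite -cSP -[X in (_ <= X)%N]card_ord max_card.
have cmid : #|[pred j | mid j]| = (c1 - 2 * s)%N.
  have := cardsC (S :|: P); rewrite cSP card_ord => /esym E; rewrite [in RHS]E addKn.
  by apply: eq_card => j; rewrite !inE negb_or.
have -> : (\sum_i (if mid i then #|mon n.+1 d0| - rho else 0) = (c1 - 2 * s) * (#|mon n.+1 d0| - rho))%N.
  by rewrite -big_mkcond sum_nat_const cmid.
have cnS : #|~: S| = (c1 - s)%N.
  by have := cardsC S; rewrite cS card_ord => /esym E; rewrite [in RHS]E addKn.
rewrite [X in (_ < X)%N](bigID (mem K)) /= [X in (_ < X + _)%N]big_imset /=; last first.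
  by move=> ? ? _ _; apply: inj_e.
rewrite [X in (_ < X + _)%N](eq_bigr (fun=> #|mon n.+1 d0|)) => [|j _]; last by rewrite deg_e.
rewrite sum_nat_const cnS.
have -> : (\sum_i (if i \in K then 0 else #|mon n.+1 (tnth d i)|) =
    \sum_(i | i \notin K) #|mon n.+1 (tnth d i)|)%N.
  by rewrite [RHS]big_mkcond; apply: eq_bigr => i _; case: ifP.
have le_rho : (rho <= #|mon n.+1 d0|)%N.
  by have := swap_orbits_double le_r nf; clear; lia.
move: (\sum_(i | _) _)%N => A.
move: num le_rho c2s; move: #|mon n.+1 d0| (r * _)%N (s * (c1 - s))%N => M a b num le_rho c2s.
have -> : (c1 - s = c1 - 2 * s + s)%N by clear -c2s; lia.
move: (c1 - 2 * s)%N num => C num; rewrite mulnBr mulnDl.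
have := leq_mul (leqnn C) le_rho; move: (C * rho)%N (C * M)%N (s * M)%N num => *.
by lia.
Qed.

Lemma block_thin r s rho : swap_orbits r n.+1 d0 rho ->
  ((r + r <= n.+1)%N -> (2 * s <= c1)%N ->
   2 * (r * (n.+1 - r)) + 2 * (s * (c1 - s)) < s * #|mon n.+1 d0| + (c1 - 2 * s) * rho)%N ->
  thin (@block_event r s).
Proof.
move=> nf num.
pose B (fgg : {ffun 'I_r -> 'I_n.+1} * {ffun 'I_s -> 'I_c1} * {ffun 'I_s -> 'I_c1}) (F : form_tuple k n d) :=
  [/\ (r + r <= n.+1)%N, (2 * s <= c1)%N, injective fgg.1.2, injective fgg.2 & (forall l l', fgg.2 l != fgg.1.2 l')] /\
  exists (u : 'M[k]_(n.+1, r)) (v : 'M[k]_(r, n.+1))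
     (u' : 'M[k]_(c1, s)) (v' : 'M[k]_(s, c1)),
    [/\ rowsub fgg.1.1 u = 1%:M, v *m u = 0, \rank (u *m v) = r &
     [/\ rowsub fgg.1.2 u' = 1%:M, v' *m u' = 0, colsub fgg.2 v' \in unitmx &
       forall i, Dop (u *m v) (F (e i)) = \sum_j (u' *m v') i j *: (F (e j) : {mpoly k[n.+1]})]].
have inj_sub m q (h : 'I_q -> 'I_m) p (A : 'M[k]_(m, p)) (M : 'M[k]_q) :
    M \in unitmx -> (exists C : 'M_(p, q), rowsub h A *m C = M) -> injective h.
  move=> uM [C E] i j hij; apply/eqP; apply: contraT => ne.
  have : row i M = row j M.
    by rewrite -E !row_mul; congr (_ *m _); apply/rowP => b; rewrite !mxE hij.
  move/(congr1 (mulmx^~ (invmx M))); rewrite -!row_mul mulmxV // => /rowP/(_ i).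
  by rewrite !mxE eqxx eq_sym (negPf ne) => /eqP; rewrite oner_eq0.
apply: (thin_sub (B := fun F => exists fgg, B fgg F)); last first.
  apply: thin_bigU => -[[f f'] g].
  case: (excluded_middle_informative [/\ (r + r <= n.+1)%N, (2 * s <= c1)%N, injective f', injective g & (forall l l', g l != f' l')]) => [[le_r le_s if' ig gf]|no].
    by apply: thin_sub (block_chart_thin f le_r nf if' ig gf (num le_r le_s)) => F [].
  by exists 1; [apply: oner_neq0|move=> F [/no]].
move=> F [N [M [NN rN MM rM DF]]].
have [f [u [v [Nuv fu vu _]]]] := sqz_factor_rank NN rN.
have [f' [u' [v' [Muv fu' vu' fv']]]] := sqz_factor_rank MM rM.
have [g [gf' ug]] := sqz_pivot fu' vu' fv'.
have le_r : (r + r <= n.+1)%N by rewrite addnn -mul2n -rN sqz_rank.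
have le_s : (2 * s <= c1)%N by rewrite -rM sqz_rank.
exists (f, f', g); split; last first.
  by exists u, v, u', v'; rewrite -Nuv -Muv; split.
split=> //=.
  by apply: (inj_sub _ _ f' _ u' 1%:M); rewrite ?unitmx1 //; exists 1%:M; rewrite mulmx1.
apply: (inj_sub _ _ g _ (trmx v') (trmx (colsub g v'))); first by rewrite unitmx_tr.
by exists 1%:M; rewrite mulmx1; apply/matrixP => i j; rewrite !mxE.
Qed.
End LowestBlock.

(** * A single fixed quadric *)

Section Quadric.
Variables (k : closedFieldType) (n c : nat) (d : c.-tuple nat).
Hypothesis char2 : 2%N \in [pchar k].
Hypothesis c_ge2 : (2 <= c)%N.
Hypothesis c_lt_n : (c < n)%N.
Variables (q0 i0 : 'I_c).
Hypothesis deg_q0 : tnth d q0 = 2%N.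
Hypothesis deg_i0 : (3 <= tnth d i0)%N.
Local Notation dd := (tnth d i0).

(** A fixed quadric, and a combination of the forms of degree d_i0, normalised
    at i0, that D maps to the product of the quadric with a fixed form A. *)
Definition quadric_event r (F : form_tuple k n d) :=
  exists (N : 'M[k]_n.+1) (a : 'I_c -> k) (A : {mpoly k[n.+1]}),
    [/\ N *m N = 0, \rank N = r &
     [/\ Dop N (F q0) = 0, A \is (dd - 2).-homog, Dop N A = 0,
        a i0 = 1 /\ a q0 = 0 &
        \sum_i a i *: Dop N (F i) = A * (F q0 : {mpoly k[n.+1]}) /\
        forall i, tnth d i != dd -> a i = 0]].

(** With a = r (n + 1 - r) there are 2 a parameters for N, at most c - 2
    coefficients in the combination, and the coefficients of A. There are a
    conditions on the quadric, rho' on A and rho on F_i0. By [swap_orbits_pair],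
    rho + rho' exceeds the number of coefficients of A by a + n - 2 at least. *)
Lemma quadric_chart_thin r (f : 'I_r -> 'I_n.+1) : (0 < r)%N -> (r + r <= n.+1)%N ->
  thin (fun F : form_tuple k n d => exists (u : 'M[k]_(n.+1, r)) (v : 'M[k]_(r, n.+1))
     (a : 'I_c -> k) (A : {mpoly k[n.+1]}),
    [/\ rowsub f u = 1%:M, v *m u = 0, \rank (u *m v) = r &
     [/\ Dop (u *m v) (F q0) = 0, A \is (dd - 2).-homog, Dop (u *m v) A = 0,
        a i0 = 1 /\ a q0 = 0 &
        \sum_i a i *: Dop (u *m v) (F i) = A * (F q0 : {mpoly k[n.+1]}) /\
        forall i, tnth d i != dd -> a i = 0]]).
Proof.
move=> r0 le_r.
have ne : i0 != q0 by apply: contraTneq deg_i0 => ->; rewrite deg_q0.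
have [|rho [rho' [nf nf' num]]] := swap_orbits_pair r0 le_r _ deg_i0; first by clear -c_ge2 c_lt_n; lia.
pose T := (form_tuple k n d * 'M[k]_(n.+1, r) * 'M[k]_(r, n.+1) * ('I_c -> k) * {mpoly k[n.+1]})%type.
pose F (t : T) : form_tuple k n d := t.1.1.1.1; pose u (t : T) := t.1.1.1.2.
pose v (t : T) := t.1.1.2; pose a (t : T) := t.1.2; pose A (t : T) := t.2; pose N t := u t *m v t.
pose Z (t : T) := [/\ rowsub f (u t) = 1%:M, v t *m u t = 0, \rank (u t *m v t) = r &
     [/\ Dop (u t *m v t) (F t q0) = 0, A t \is (dd - 2).-homog, Dop (u t *m v t) (A t) = 0,
        a t i0 = 1 /\ a t q0 = 0 &
        \sum_i a t i *: Dop (u t *m v t) (F t i) = A t * (F t q0 : {mpoly k[n.+1]}) /\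
        forall i, tnth d i != dd -> a t i = 0]].
pose h i (t : T) : {mpoly k[n.+1]} := F t i.
have hh i t : Z t -> h i t \is (tnth d i).-homog by move=> _; apply: form_homog.
have hA t : Z t -> A t \is (dd - 2).-homog by move=> [_ _ _ []].
have hQ t : Z t -> h q0 t \is 2.-homog by rewrite -deg_q0; apply: hh.
have NN t : Z t -> N t *m N t = 0.
  by move=> [_ vu _ _]; rewrite /N mulmxA -(mulmxA (u t)) vu mulmx0 mul0mx.
have rN t : Z t -> \rank (N t) = r by case.
pose X0 := mx_entries u ++ mx_entries v.
have aX0 : adjoins Z [::] X0 (2 * (r * (n.+1 - r))).
  by apply: (@adjoins_sqz k T Z [::] n.+1 r f) => t [].
have pN X : (forall y, List.In y X0 -> List.In y X) -> forall i j, pfun Z X (fun t => N t i j).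
  exact: pfun_mulmx.
pose grp i := (tnth d i == dd) && (i != i0).
pose Ya := flatten [seq (if grp i then [:: fun t => a t i] else [::]) | i <- enum 'I_c].
have aYa : adjoins Z X0 Ya (\sum_(i <- enum 'I_c) grp i).
  apply: adjoins_flatten => i _; case: (grp i); last exact: adjoins_nil.
  exact: (@adjoins_free k T Z X0 [:: _]).
have aX1 := adjoins_step aX0 aYa; set X1 := Ya ++ X0 in aX1.
have sX1 y : List.In y X0 -> List.In y X1 by move=> yX; apply: List.in_or_app; right.
have pa i : pfun Z X1 (fun t => a t i).
  case: (eqVneq i i0) => [->|ni].
    by apply: (pfun_ext (pfun_const _ _ 1)) => t [_ _ _ [_ _ _ [-> _] _]].
  case: (eqVneq (tnth d i) dd) => di; last first.
    by apply: (pfun_ext (pfun_const _ _ 0)) => t [_ _ _ [_ _ _ _ [_ ->]]].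
  apply: pfun_var; apply: List.in_or_app; left.
  apply: (@In_flatten k T _ _ (fun i => if grp i then [:: fun t => a t i] else [::]) i).
    by rewrite mem_enum.
  by rewrite /grp di ni eqxx /=; left.
have aYQ : adjoins Z X1 (coefs 2 (h q0)) (#|mon n.+1 2| - r * (n.+1 - r)).
  apply: (adjoins_Dop char2 (r := r) (b := fun=> 0) (pN _ sX1) NN rN hQ) => //.
  - exact: pfunm_const.
  - by move=> t [_ _ _ []].
  - exact: swap_orbits_quadric.
have aX2 := adjoins_step aX1 aYQ; set X2 := coefs 2 (h q0) ++ X1 in aX2.
have sX2 y : List.In y X1 -> List.In y X2 by move=> yX; apply: List.in_or_app; right.
have aYA : adjoins Z X2 (coefs (dd - 2) A) (#|mon n.+1 (dd - 2)| - rho').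
  apply: (adjoins_Dop char2 (r := r) (b := fun=> 0) (pN _ _) NN rN hA _ _ nf').
  - by move=> y /sX1/sX2.
  - exact: pfunm_const.
  - by move=> t [_ _ _ []].
have aX3 := adjoins_step aX2 aYA; set X3 := coefs (dd - 2) A ++ X2 in aX3.
have sX3 y : List.In y X2 -> List.In y X3 by move=> yX; apply: List.in_or_app; right.
pose oth i := (i != i0) && (i != q0).
pose Yf := flatten [seq (if oth i then coefs (tnth d i) (h i) else [::]) | i <- enum 'I_c].
have aYf : adjoins Z X3 Yf (\sum_(i <- enum 'I_c) if oth i then #|mon n.+1 (tnth d i)| else 0%N).
  apply: adjoins_flatten => i _; case: ifP => _; last exact: adjoins_nil.
  exact: adjoins_free_form.
have aX4 := adjoins_step aX3 aYf; set X4 := Yf ++ X3 in aX4.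
have sX4 y : List.In y X3 -> List.In y X4 by move=> yX; apply: List.in_or_app; right.
have ph i : i != i0 -> pfunm Z X4 (h i).
  move=> ni; apply: (pfunm_coefs (hh i)) => y yY; apply: List.in_or_app.
  case: (eqVneq i q0) => iq.
    right; apply: sX3; apply: List.in_or_app; left; move: yY; rewrite iq.
    by have -> : coefs (tnth d q0) (h q0) = coefs 2 (h q0) by rewrite deg_q0.
  left; apply: (@In_flatten k T _ _ (fun i => if oth i then coefs (tnth d i) (h i) else [::]) i).
    by rewrite mem_enum.
  by rewrite /oth ni iq.
have pA : pfunm Z X4 A.
  by apply: (pfunm_coefs hA) => y yY; apply: sX4; apply: List.in_or_app; left.
have pN4 : forall i j, pfun Z X4 (fun t => N t i j) by apply: pN => y /sX1/sX2/sX3/sX4.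
pose b t := A t * h q0 t - \sum_i (if i == i0 then 0 else a t i *: Dop (N t) (h i t)).
have Db t : Z t -> Dop (N t) (h i0 t) = b t.
  move=> [_ _ _ [_ _ _ [a1 _] [E _]]]; rewrite /b -E [X in _ = X - _](bigD1 i0) //= a1 scale1r.
  rewrite [X in _ - X](bigD1 i0) //= eqxx add0r.
  by rewrite [X in _ - X](eq_bigr (fun i => a t i *: Dop (N t) (h i t))) ?addrK // => i /negPf ->.
have pb : pfunm Z X4 b.
  apply: pfunm_sub; first by apply: pfunm_mul => //; apply: ph; rewrite eq_sym.
  apply: pfunm_sum => i; case: eqVneq => ni; first exact: pfunm_const.
  apply: pfunm_scale; last by apply: (pfun_Dop pN4 (hh i)); apply: ph.
  by apply: pfun_sub_dom (pa i) => // y /sX2/sX3/sX4.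
have aY0 := adjoins_Dop char2 pN4 NN rN (hh i0) pb Db nf.
have aX5 := adjoins_step aX4 aY0.
apply: thin_sub (thin_family (F := F) aX5 _ _).
- by move=> G [u1 [v1 [a1 [A1 H]]]]; exists (G, u1, v1, a1, A1).
- move=> i; case: (eqVneq i i0) => [->|ni].
    by apply: (pfunm_coefs (hh i0)) => y yY; apply: List.in_or_app; left.
  by apply: pfunm_sub_dom (ph i ni) => // y yX; apply: List.in_or_app; right.
rewrite !sum_over_enum.
have -> : (\sum_i (if oth i then #|mon n.+1 (tnth d i)| else 0) =
   \sum_(i | oth i) #|mon n.+1 (tnth d i)|)%N by rewrite [RHS]big_mkcond.
have ca : (\sum_i grp i <= c - 2)%N.
  rewrite -[X in (X - _)%N]card_ord leq_subRL -?card_bool; last by rewrite card_bool card_ord.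
  rewrite -big_mkcond sum1_card.
  have -> : #|{: bool}| = #|[set i0; q0]| by rewrite cards2 ne card_bool.
  rewrite -(cardsC [set i0; q0]) leq_add2l; apply: subset_leq_card; apply/subsetP => i.
  rewrite !inE negb_or => /andP[/eqP di ->]; apply: contraTneq deg_i0 => iq.
  by rewrite -di iq deg_q0.
rewrite [X in (_ < X)%N](bigD1 i0) //= [X in (_ < _ + X)%N](bigD1 q0) /=; last by rewrite eq_sym.
rewrite deg_q0.
rewrite /oth.
have := swap_orbits_double le_r nf; have := swap_orbits_double le_r nf'; have := swap_orbits_double le_r (swap_orbits_quadric le_r).
move: num ca; move: (\sum_(i | _) _)%N (\sum_i grp i)%N #|mon n.+1 2| #|mon n.+1 dd| #|mon n.+1 (dd - 2)|.
move: (r * (n.+1 - r))%N.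
by clear -c_lt_n c_ge2; lia.
Qed.

Lemma quadric_thin r : (0 < r)%N -> thin (quadric_event r).
Proof.
move=> r0; case: (leqP (r + r) n.+1) => [le_r|nle_r]; last first.
  exists 1; [apply: oner_neq0|move=> F [N [a [A [NN rN _]]]]].
  by move: nle_r; rewrite ltnNge addnn -mul2n -rN sqz_rank.
apply: thin_sub (thin_bigU (fun f : {ffun 'I_r -> 'I_n.+1} => @quadric_chart_thin r f r0 le_r)).
move=> F [N [a [A [NN rN H]]]].
have [f [u [v [Nuv fu vu _]]]] := sqz_factor_rank NN rN.
by exists f, u, v, a, A; rewrite -Nuv.
Qed.
End Quadric.

(** * Involutions preserving the ideal *)

Section Relations.
Variables (k : closedFieldType) (n c : nat) (d : c.-tuple nat) (F : form_tuple k n d).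
Hypothesis char2 : 2%N \in [pchar k].
Hypothesis smF : smooth_complete_intersection F.
Variable p : 'cV[k]_n.+1.
Hypothesis pX : point_of F p.
Local Notation f i := (F i : {mpoly k[n.+1]}).

(** Differentiating the relation at p, where all F_j vanish, shows that the
    vector of the B_j(p) annihilates the Jacobian, whose rows are independent. *)
Lemma relation_vanish (B : 'I_c -> {mpoly k[n.+1]}) : \sum_i B i * f i = 0 -> forall i, ev p (B i) = 0.
Proof.
move=> E i; have [p0 Fp] := pX.
have rf : row_free (jacobian F p) by rewrite /row_free (smF pX).
suff : \row_i ev p (B i) = 0 by move/rowP/(_ i); rewrite !mxE.
apply: (row_free_inj rf); rewrite mul0mx; apply/rowP => j; rewrite !mxE.
have := congr1 (fun q => ev p q^`M(j)) E; rewrite mderiv0 => E0.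
have z : ev p 0 = 0 :> k by apply: meval0.
rewrite -[RHS]z -E0 raddf_sum /ev (raddf_sum (meval _)); apply: eq_bigr => l _ /=.
by rewrite mderivM mevalD !mevalM Fp mulr0 add0r !mxE.
Qed.

Lemma form_neq0 i : f i != 0.
Proof.
apply/eqP => E; have /eqP := oner_neq0 k; apply.
have R : \sum_j (j == i)%:R * f j = 0.
  by rewrite big1 // => j _; case: eqVneq => [->|_]; rewrite ?E ?mulr0 ?mul0r.
by have := relation_vanish R i; rewrite eqxx /ev meval1.
Qed.

Lemma homog0E (q : {mpoly k[n.+1]}) : q \is 0.-homog -> q = (ev p q)%:MP.
Proof.
move=> hq; have E : q = (q@_0)%:MP.
  apply/mpolyP => m; rewrite mcoeffC; case: eqVneq => [<-|ne]; first by rewrite mulr1.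
  by rewrite mulr0 (dhomog_nemf_coeff hq) // mdeg_eq0.
by rewrite {1}E /ev {2}E mevalC.
Qed.

Lemma pullbackC h (a : k) : pullback h a%:MP = a%:MP :> {mpoly k[n.+1]}.
Proof. exact: comp_mpolyC. Qed.

Variables (N : 'M[k]_n.+1) (A : 'I_c -> 'I_c -> {mpoly k[n.+1]}).
Hypothesis NN : N *m N = 0.
Hypothesis sF : forall i, pullback (1%:M + N) (f i) = \sum_j A i j * f j.
Hypothesis hA : forall i j, (tnth d j <= tnth d i)%N -> A i j \is (tnth d i - tnth d j).-homog.
Hypothesis A0 : forall i j, (tnth d i < tnth d j)%N -> A i j = 0.

Lemma char2_addmx m l (M : 'M[k]_(m, l)) : M + M = 0.
Proof. by rewrite -mulr2n -scaler_nat (pcharf0 char2) scale0r. Qed.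

Lemma pullback_invol q : pullback (1%:M + N) (pullback (1%:M + N) q) = q.
Proof.
rewrite pullback_comp mulmxDr !mulmxDl !mulmx1 mul1mx NN addr0 -addrA char2_addmx addr0.
exact: pullback1.
Qed.

Section Group.
Variables (m : nat) (e : 'I_m -> 'I_c) (D : nat).
Hypothesis inj_e : injective e.
Hypothesis imE : forall i, reflect (exists j, i = e j) (tnth d i == D).

(** The matrix by which 1 + N acts on the forms of degree D modulo those of
    lower degree, minus the identity. The A i j concerned are constants, which
    evaluation at p reads off. *)
Definition diag_block : 'M[k]_m := \matrix_(i, j) (ev p (A (e i) (e j)) - (i == j)%:R).

Lemma deg_group j : tnth d (e j) = D.
Proof. by apply/eqP/imE; exists j. Qed.

Lemma sum_group (G : 'I_c -> {mpoly k[n.+1]}) :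
  (forall i, tnth d i != D -> G i = 0) -> \sum_i G i = \sum_j G (e j).
Proof.
move=> G0; rewrite (bigID (fun i => tnth d i == D)) /= [X in _ + X]big1 // addr0.
rewrite -(big_imset _ (in2W inj_e)) /=; apply: eq_bigl => i.
by apply/(imE i)/imsetP => [[j ->]|[j _ ->]]; exists j.
Qed.

Lemma block_entry i j : A (e i) (e j) = (ev p (A (e i) (e j)))%:MP.
Proof. by apply: homog0E; have := @hA (e i) (e j); rewrite !deg_group subnn; apply. Qed.

(** The identity h^2 = 1 yields a relation among the F_j, whose constant
    coefficients vanish by [relation_vanish]. Hence 1 + B is an involution, and
    B ^ 2 = 0 in characteristic 2. *)
Lemma diag_block_sqz : diag_block *m diag_block = 0.
Proof.
pose al : 'M[k]_m := \matrix_(i, j) ev p (A (e i) (e j)).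
have -> : diag_block = al - 1%:M by apply/matrixP => i j; rewrite !mxE.
suff alal : al *m al = 1%:M.
  have -> : - 1%:M = 1%:M :> 'M[k]_m by apply/eqP; rewrite eq_sym -addr_eq0 char2_addmx.
  by rewrite mulmxDl !mulmxDr !mulmx1 mul1mx alal (addrC al) addrACA !char2_addmx.
apply/matrixP => i j.
have R : \sum_l (\sum_q pullback (1%:M + N) (A (e i) q) * A q l - (l == e i)%:R) * f l = 0.
  under eq_bigr => l _ do rewrite mulrBl mulr_suml.
  rewrite sumrB exchange_big /= [X in _ - X](bigD1 (e i)) //= eqxx mul1r.
  rewrite [X in _ - (_ + X)]big1 => [|l /negPf ->]; last by rewrite mul0r.
  rewrite addr0; apply/eqP; rewrite subr_eq0 -[X in _ == X]pullback_invol [X in pullback _ X]sF.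
  rewrite pullback_sum; apply/eqP/eq_bigr => q _; rewrite pullbackM sF mulr_sumr.
  by apply: eq_bigr => l _; rewrite mulrA.
have := relation_vanish R (e j); rewrite evB => /eqP; rewrite subr_eq0 => /eqP.
have -> : ev p ((e j == e i)%:R) = (i == j)%:R.
  by rewrite (inj_eq inj_e) eq_sym; case: (i == j); rewrite /ev ?meval1 ?meval0.
move=> E1; rewrite [RHS]mxE -E1 mxE sum_group => [|q ne].
  rewrite /ev (raddf_sum (meval _)); apply: eq_bigr => l _.
  by rewrite !mxE [in RHS]block_entry pullbackC /= mevalM mevalC.
case: (ltngtP (tnth d q) D) => qD; last by rewrite qD eqxx in ne.
  by rewrite [A q _]A0 ?mulr0 // deg_group.
by rewrite [A _ q]A0 ?deg_group // pullback0 mul0r.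
Qed.

Lemma diag_block_D i (R : {mpoly k[n.+1]}) :
  pullback (1%:M + N) (f (e i)) = \sum_j A (e i) (e j) * f (e j) + R ->
  Dop N (f (e i)) = \sum_j diag_block i j *: f (e j) + R.
Proof.
rewrite /Dop => ->; rewrite addrAC; congr (_ + _).
under [RHS]eq_bigr => j _ do rewrite mxE scalerBl.
rewrite sumrB; congr (_ - _); first by apply: eq_bigr => j _; rewrite [in LHS]block_entry mul_mpolyC.
rewrite (bigD1 i) //= eqxx scale1r big1 ?addr0 // => j /negPf ne.
by rewrite eq_sym ne scale0r.
Qed.
End Group.
End Relations.

Section Frame.
Variables (k : closedFieldType) (n c : nat) (d : c.-tuple nat) (F : form_tuple k n d).
Hypothesis d_gt0 : forall i, (0 < tnth d i)%N.
Hypothesis c_le_n : (c <= n)%N.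
Variable L : lin_family k n c.

(** The section is cut out by c + (n - c) forms in n + 1 variables. *)
Lemma section_point (j : 'I_n.+2) : exists2 x : 'cV[k]_n.+1, x != 0 & on_section F L j x.
Proof.
pose sp (i : 'I_n) := split (cast_ord (esym (subnKC c_le_n)) i).
pose G (i : 'I_n) : {mpoly k[n.+1]} := match sp i with inl a => F a | inr b => L j b end.
pose e (i : 'I_n) := match sp i with inl a => tnth d a | inr b => 1%N end.
have e0 i : (0 < e i)%N by rewrite /e; case: (sp i).
have hG i : G i \is (e i).-homog.
  by rewrite /G /e; case: (sp i) => a; [apply: form_homog|apply: dhomog_is_dhomog].
have [x [[l xl] Gx]] := projective_dimension e0 hG.
have evE q : ev (\col_l x l) q = q.@[x] by apply: meval_eq => i; rewrite mxE.
exists (\col_l x l); first by apply/cV0Pn; exists l; rewrite mxE.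
split=> a; rewrite evE.
  have := Gx (cast_ord (subnKC c_le_n) (lshift _ a)).
  by rewrite /G /sp cast_ordK; case: split_ordP => b /eqP; [rewrite eq_lshift => /eqP ->|rewrite eq_lrshift].
have := Gx (cast_ord (subnKC c_le_n) (rshift _ a)).
by rewrite /G /sp cast_ordK; case: split_ordP => b /eqP; [rewrite eq_rlshift|rewrite eq_rshift => /eqP ->].
Qed.

Hypothesis indep : forall m (s : option 'I_m.+1 -> 'I_n.+2), injective s -> (m < n)%N ->
  ~ dependent s F L.
Variable p : 'I_n.+2 -> 'cV[k]_n.+1.
Hypothesis p_neq0 : forall j, p j != 0.
Hypothesis pX : forall j, on_section F L j (p j).

(** In a shortest relation no coefficient vanishes and all points but one are
    independent, which is the configuration [dependent]. *)
Lemma frame_free q (s : 'I_q -> 'I_n.+2) (a : 'I_q -> k) : injective s -> (q <= n.+1)%N ->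
  \sum_i a i *: p (s i) = 0 -> forall i, a i = 0.
Proof.
elim: q s a => [|q IHq] s a inj_s le_q E; first by case.
case: (boolP [exists i, a i == 0]) => [/existsP[i0 /eqP a0]|].
  have H : \sum_i a (lift i0 i) *: p (s (lift i0 i)) = 0.
    by rewrite -[RHS]E (bigD1_ord i0) //= a0 scale0r add0r.
  have {}H := IHq (s \o lift i0) (a \o lift i0) (inj_comp inj_s lift_inj) (ltnW le_q) H.
  by move=> i; case: (unliftP i0 i) => [j ->|-> //]; apply: H.
rewrite negb_exists => /forallP a0; exfalso.
case: q IHq s a inj_s le_q E a0 => [|m] IHq s a inj_s le_q E a0.
  move/eqP: E; rewrite big_ord1 scaler_eq0 (negPf (a0 ord0)) (negPf (p_neq0 _)).
  by [].
pose x i := p (s (lift ord0 i)).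
pose r (o : option 'I_m.+1) := if o is Some i then s (lift ord0 i) else s ord0.
have inj_r : injective r.
  move=> [i|] [j|] //= /inj_s.
  - by move/lift_inj => ->.
  - by move=> H; have := neq_lift ord0 i; rewrite H eqxx.
  - by move=> H; have := neq_lift ord0 j; rewrite -H eqxx.
apply: (indep inj_r); first by clear -le_q; lia.
pose b i := - (a ord0)^-1 * a (lift ord0 i).
exists x, b; split.
- pose Q : 'M[k]_(m.+1, n.+1) := \matrix_(i, l) x i l 0.
  have fQ : row_free Q.
    rewrite -kermx_eq0; apply/rowV0P => y /sub_kermxP yQ; apply/rowP => i; rewrite mxE.
    apply: (IHq (s \o lift ord0) (fun i => y 0 i) (inj_comp inj_s lift_inj) (ltnW le_q)).
    apply/colP => l; move/rowP/(_ l): yQ; rewrite !mxE summxE => yQ; rewrite -[RHS]yQ.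
    by apply: eq_bigr => i' _; rewrite !mxE.
  have [B QB] := row_freeP fQ.
  exists (fun i => linform (row i B^T)); split=> [i|i j]; first exact: linform_homog.
  rewrite /ev meval_linform; move/matrixP/(_ j i): QB; rewrite !mxE eq_sym => <-.
  by apply: eq_bigr => l _; rewrite !mxE mulrC.
- by move=> i; rewrite /b mulf_neq0 // oppr_eq0 invr_eq0.
case=> [i|] /=; first exact: pX.
have -> : \sum_i b i *: x i = p (s ord0); last exact: pX.
move: E; rewrite big_ord_recl => /eqP; rewrite addr_eq0 => /eqP E.
rewrite -[RHS](scalerK (a0 ord0)) E scalerN -scaleNr scaler_sumr.
by apply: eq_bigr => i _; rewrite scalerA.
Qed.

Lemma frame_relation (b : 'I_n.+2 -> k) i : \sum_j b j *: p j = 0 -> b i = 0 -> forall j, b j = 0.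
Proof.
move=> E bi; have H : \sum_j b (lift i j) *: p (lift i j) = 0.
  by rewrite -[RHS]E (bigD1_ord i) //= bi scale0r add0r.
have {}H := frame_free (a := b \o lift i) (@lift_inj _ i) (leqnn _) H.
by move=> j; case: (unliftP i j) => [l ->|-> //]; apply: H.
Qed.

Lemma frame_span (M : 'M[k]_n.+1) : (forall j, M *m p j = 0) -> M = 0.
Proof.
move=> Mp; pose Q : 'M[k]_n.+1 := \matrix_(i, l) p (lift ord0 l) i 0.
have uQ : Q \in unitmx.
  rewrite -unitmx_tr -row_free_unit -kermx_eq0; apply/rowV0P => y /sub_kermxP yQ.
  apply/rowP => i; rewrite mxE.
  apply: (frame_free (a := fun i => y 0 i) (@lift_inj _ ord0) (leqnn _)).
  apply/colP => l; move/rowP/(_ l): yQ; rewrite !mxE summxE => yQ; rewrite -[RHS]yQ.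
  by apply: eq_bigr => i' _; rewrite !mxE.
rewrite -[M](mulmxK uQ); have -> : M *m Q = 0; last by rewrite mul0mx.
apply/matrixP => i j; move/colP/(_ i): (Mp (lift ord0 j)); rewrite !mxE => E; rewrite -[RHS]E.
by apply: eq_bigr => l _; rewrite !mxE.
Qed.

(** The n + 2 points satisfy a relation, without zero coefficient by
    [frame_relation]. Applying M and subtracting mu_0 times the relation gives
    one with a zero coefficient, so all eigenvalues are equal. *)
Lemma frame_scalar (M : 'M[k]_n.+1) (mu : 'I_n.+2 -> k) : (forall j, M *m p j = mu j *: p j) ->
  M = (mu ord0)%:M.
Proof.
move=> Mp; pose Q : 'M[k]_(n.+2, n.+1) := \matrix_(j, l) p j l 0.
have [y /sub_kermxP yQ y0] : exists2 y : 'rV_n.+2, (y <= kermx Q)%MS & y != 0.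
  apply/rowV0Pn; rewrite -mxrank_eq0 mxrank_ker subn_eq0 -ltnNge ltnS.
  exact: rank_leq_col.
have E : \sum_j y 0 j *: p j = 0.
  apply/colP => l; move/rowP/(_ l): yQ; rewrite !mxE summxE => yQ; rewrite -[RHS]yQ.
  by apply: eq_bigr => i' _; rewrite !mxE.
have yj j : y 0 j != 0.
  apply: contraNneq y0 => yj; apply/eqP/rowP => i; rewrite mxE.
  exact: (frame_relation E yj).
have ME : \sum_j (y 0 j * (mu j - mu ord0)) *: p j = 0.
  have : M *m (\sum_j y 0 j *: p j) - mu ord0 *: (\sum_j y 0 j *: p j) = 0.
    by rewrite E mulmx0 scaler0 subr0.
  rewrite mulmx_sumr scaler_sumr -sumrB => H; rewrite -[RHS]H; apply: eq_bigr => j _.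
  by rewrite -scalemxAr Mp !scalerA mulrBr scalerBl [mu ord0 * _]mulrC.
have muE j : mu j = mu ord0.
  have := @frame_relation _ ord0 ME; rewrite subrr mulr0 => /(_ erefl j)/eqP.
  by rewrite mulf_eq0 (negPf (yj j)) subr_eq0 => /eqP.
apply/eqP; rewrite -subr_eq0; apply/eqP/frame_span => j.
by rewrite mulmxBl Mp muE mul_scalar_mx subrr.
Qed.
End Frame.

Section Components.
Variables (k : closedFieldType) (n c : nat) (d : c.-tuple nat) (F : form_tuple k n d).

(** Components of degree d_i of an expression of F_i o h in the ideal. *)
Lemma homog_components (h : 'M[k]_n.+1) :
  (forall i, in_ideal F (pullback h (F i))) ->
  exists A : 'I_c -> 'I_c -> {mpoly k[n.+1]},
    [/\ forall i, pullback h (F i) = \sum_j A i j * (F j : {mpoly k[n.+1]}),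
        forall i j, (tnth d j <= tnth d i)%N -> A i j \is (tnth d i - tnth d j).-homog &
        forall i j, (tnth d i < tnth d j)%N -> A i j = 0].
Proof.
move=> hI; have /fin_all_exists[a aP] := hI.
exists (fun i j => if (tnth d j <= tnth d i)%N then pihomog mdeg (tnth d i - tnth d j) (a i j) else 0).
split=> [i|i j ->|i j]; last by rewrite ltnNge => /negPf ->.
  have hp := pullback_homog h (form_homog F i).
  rewrite -(pihomog_dE hp) {1}aP raddf_sum; apply: eq_bigr => j _ /=.
  by rewrite (pihomog_mulr _ _ (form_homog F j)).
exact: pihomogP.
Qed.
End Components.

(** * Conclusion *)

(** The cases settled by the forms of lowest degree d0, in number c1. The
    complement, for r > 0, is one quadric, or two quadrics fixed by h. *)
Definition block_bound d0 c1 r s := (0 < r)%N && [|| (2 < d0)%N, (2 < c1)%N | (c1 == 2%N) && (0 < s)%N].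

Lemma block_count_cubic c1 s a M n : (n <= a)%N -> (c1 < n)%N -> (0 < c1)%N -> (2 * s <= c1)%N ->
  (2 * (2 * a).+1 <= M)%N -> (2 * a + 2 * (s * (c1 - s)) < s * M + (c1 - 2 * s) * (2 * a).+1)%N.
Proof.
move=> na cn c0 sc; have [t Et] : exists t, c1 = (2 * s + t)%N by exists (c1 - 2 * s)%N; lia.
subst c1.
rewrite (_ : 2 * s + t - s = s + t)%N; last by lia.
rewrite addKn => aM.
have : (s * (2 * (2 * a).+1) <= s * M)%N by rewrite leq_mul2l aM orbT.
have : (2 * s + t < a)%N by lia.
move: (s * M)%N => sM; clear -c0 => *; nia.
Qed.

(** In degree 2 each fixed form gives a = r (n + 1 - r) conditions only, so
    c1 = 2 forms with s = 0 do not beat the 2 a parameters of N. For s > 0 every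
    determined form counts for all its coefficients, which exceed 2 a by at least
    (n + 1) / 2. *)
Lemma block_num n d0 c1 r s : (0 < r)%N -> (r + r <= n.+1)%N -> (2 <= d0)%N -> (c1 < n)%N -> (0 < c1)%N ->
  (3 <= n)%N -> (2 * s <= c1)%N -> (d0 = 2%N -> c1 = 2%N -> (4 <= n)%N) -> block_bound d0 c1 r s ->
  exists2 rho, swap_orbits r n.+1 d0 rho &
  (2 * (r * (n.+1 - r)) + 2 * (s * (c1 - s)) < s * #|mon n.+1 d0| + (c1 - 2 * s) * rho)%N.
Proof.
move=> r0 le_r d2 cn c0 n3 sc n4 /andP[_ gd].
have an : (n <= r * (n.+1 - r))%N by clear -r0 le_r; nia.
case: (ltnP 2 d0) => d0_2.
  have nf : swap_orbits r n.+1 d0 (2 * (r * (n.+1 - r))).+1 by apply: swap_orbits_cubic.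
  exists (2 * (r * (n.+1 - r))).+1 => //.
  exact: (block_count_cubic an cn c0 sc (swap_orbits_double le_r nf)).
have {d2 d0_2}E : d0 = 2%N by apply/eqP; rewrite eqn_leq d2 d0_2.
subst d0; exists (r * (n.+1 - r))%N; first exact: swap_orbits_quadric.
have am : (4 * (r * (n.+1 - r)) <= n.+1 * n.+1)%N by clear -le_r; nia.
have := card_mon2 n; move: gd => /= gd.
move: (r * (n.+1 - r))%N #|mon n.+1 2| an am => a M an am Mn.
have M2 : (4 * a + n.+1 <= 2 * M)%N by clear -am Mn; nia.
clear r0 le_r Mn am.
have [c2|c2] := leqP c1 2; last first.
  have [t Et] : exists t, c1 = (2 * s + t)%N by exists (c1 - 2 * s)%N; clear -sc; lia.
  rewrite Et (_ : 2 * s + t - s = s + t)%N; last by clear; lia.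
  rewrite addKn; have : (s * (4 * a + n.+1) <= s * (2 * M))%N by rewrite leq_mul2l M2 orbT.
  rewrite [(s * (2 * M))%N]mulnCA.
  move: (s * M)%N => sM; clear -Et an cn c2 => H; nia.
have /andP[/eqP c1_2 s1] : (c1 == 2%N) && (0 < s)%N by move: gd; rewrite ltnNge c2.
have -> : s = 1%N by clear -sc s1 c2; lia.
by have := n4 erefl c1_2; rewrite c1_2; clear -M2; lia.
Qed.

Section Involution.
Variables (k : closedFieldType) (n c : nat) (d : c.-tuple nat) (F : form_tuple k n d).
Hypothesis char2 : 2%N \in [pchar k].
Hypothesis smF : smooth_complete_intersection F.
Variable L : lin_family k n c.
Hypothesis d_gt0 : forall i, (0 < tnth d i)%N.
Hypothesis c_le_n : (c <= n)%N.
Hypothesis indep : forall m (s : option 'I_m.+1 -> 'I_n.+2), injective s -> (m < n)%N ->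
  ~ dependent s F L.

(** By [frame_scalar], h ^ 2 = b ^ 2 for some scalar b; then N = h / b - 1 has
    square zero in characteristic 2. It is nonzero since a scalar matrix acts
    trivially. *)
Lemma involution_normal_form h : linear_automorphism F h -> induced_order F h 2 ->
  exists (N : 'M[k]_n.+1) (A : 'I_c -> 'I_c -> {mpoly k[n.+1]}),
    [/\ N *m N = 0, N != 0,
        forall i, pullback (1%:M + N) (F i) = \sum_j A i j * (F j : {mpoly k[n.+1]}),
        forall i j, (tnth d j <= tnth d i)%N -> A i j \is (tnth d i - tnth d j).-homog &
        forall i j, (tnth d i < tnth d j)%N -> A i j = 0].
Proof.
move=> [uh hI] [_ h2 h1].
have /fin_all_exists2[p p0 pX] := section_point F d_gt0 c_le_n L.
have ptX j : point_of F (p j) by split=> // i; have [Fp _] := pX j; apply: Fp.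
have /fin_all_exists2[mu mu0 hmu] j := h2 _ (ptX j).
have hh : h *m h = (mu ord0)%:M.
  by rewrite -(frame_scalar indep p0 pX hmu) expr2.
have [b bb] : exists b : k, b ^+ 2 = mu ord0.
  have [b E] := @solve_monicpoly k 2 (fun i => if i == 0%N then mu ord0 else 0) isT.
  by exists b; rewrite E big_ord_recl big_ord1 /= expr0 mulr1 mul0r addr0.
have b0 : b != 0.
  by apply: contraNneq (mu0 ord0) => b0; rewrite -bb b0 expr0n.
pose N := b^-1 *: h - 1%:M.
have gE : 1%:M + N = b^-1%:M *m h by rewrite /N addrCA subrr addr0 mul_scalar_mx.
have FI i : in_ideal F (pullback (1%:M + N) (F i)).
  rewrite gE -pullback_comp (pullback_scalar _ (form_homog F i)) pullbackZ.
  have /hI[a ->] : in_ideal F (F i).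
    exists (fun j => (j == i)%:R); rewrite (bigD1 i) //= eqxx mul1r big1 ?addr0 // => j /negPf->.
    by rewrite mul0r.
  exists (fun j => b^-1 ^+ tnth d i *: a j); rewrite scaler_sumr; apply: eq_bigr => j _.
  by rewrite scalerAl.
have [A [sF hA A0]] := homog_components FI.
exists N, A; split=> //.
  have gg : (b^-1 *: h) *m (b^-1 *: h) = 1%:M.
    rewrite -scalemxAl -scalemxAr hh scalerA -bb scale_scalar_mx -invfM -expr2 mulVf //.
    by rewrite expf_neq0.
  rewrite /N; have -> : - 1%:M = 1%:M :> 'M[k]_n.+1.
    by apply/eqP; rewrite eq_sym -addr_eq0 char2_addmx.
  by rewrite mulmxDl !mulmxDr !mulmx1 mul1mx gg [1%:M + _]addrC char2_addmx.
apply/eqP => N0; apply: (h1 1%N isT) => x _; exists b => //.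
have /(congr1 (fun M => b *: M)) : b^-1 *: h = 1%:M by apply/eqP; rewrite -subr_eq0 -/N N0.
by rewrite scalerA divff // scale1r scale_scalar_mx mulr1 expr1 => ->; rewrite mul_scalar_mx.
Qed.
End Involution.

Section Blocks.
Variables (k : closedFieldType) (n c : nat) (d : c.-tuple nat) (F : form_tuple k n d).
Hypothesis char2 : 2%N \in [pchar k].
Hypothesis smF : smooth_complete_intersection F.
Variable p : 'cV[k]_n.+1.
Hypothesis pX : point_of F p.
Local Notation f i := (F i : {mpoly k[n.+1]}).
Variables (N : 'M[k]_n.+1) (A : 'I_c -> 'I_c -> {mpoly k[n.+1]}).
Hypothesis NN : N *m N = 0.
Hypothesis sF : forall i, pullback (1%:M + N) (f i) = \sum_j A i j * f j.
Hypothesis hA : forall i j, (tnth d j <= tnth d i)%N -> A i j \is (tnth d i - tnth d j).-homog.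
Hypothesis A0 : forall i j, (tnth d i < tnth d j)%N -> A i j = 0.

Definition degree_group D := [pred i : 'I_c | tnth d i == D].
Definition group_enum D : 'I_#|degree_group D| -> 'I_c := enum_val.

Lemma group_enum_inj D : injective (@group_enum D). Proof. exact: enum_val_inj. Qed.

Lemma group_enumP D i : reflect (exists j, i = @group_enum D j) (tnth d i == D).
Proof.
apply: (iffP idP) => [iD|[j ->]]; last exact: (enum_valP j).
by exists (enum_rank_in (iD : i \in degree_group D) i); rewrite /group_enum enum_rankK_in.
Qed.

Local Notation B D := (diag_block p A (@group_enum D)).

Lemma lowest_block D : (forall i, (D <= tnth d i)%N) -> forall i,
  Dop N (f (@group_enum D i)) = \sum_j B D i j *: f (@group_enum D j).
Proof.
move=> le_D i; rewrite -[RHS]addr0.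
apply: (diag_block_D p hA (@group_enumP D)); rewrite addr0 sF.
apply: (sum_group (@group_enum_inj D) (@group_enumP D)) => j jD.
by rewrite A0 ?mul0r // (deg_group (@group_enumP D)) ltn_neqAle eq_sym jD le_D.
Qed.

Lemma ev_moved i : ev ((1%:M + N) *m p) (F i) = 0.
Proof.
have [_ Fp] := pX; rewrite -ev_pullback sF /ev (raddf_sum (meval _)) big1 // => j _ /=.
by rewrite mevalM Fp mulr0.
Qed.

Lemma char2_mpoly (q : {mpoly k[n.+1]}) : q + q = 0.
Proof. by rewrite -mulr2n -scaler_nat (pcharf0 char2) scale0r. Qed.

(** The block C of the second lowest degree has square zero, hence some row
    vector l <> 0 satisfies l C = 0. The combination G with coefficients l is then
    moved by a multiple R Q of the quadric only, and h^2 = 1 forces R to be fixed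
    because Q is. *)
Lemma second_block_event q0 i1 : tnth d q0 = 2%N -> Dop N (f q0) = 0 -> i1 != q0 ->
  (forall i, i != q0 -> (2 < tnth d i1 <= tnth d i)%N) ->
  exists2 i0, (2 < tnth d i0)%N & quadric_event q0 i0 (\rank N) F.
Proof.
move=> d0 DQ ne1 le_D; set D := tnth d i1 in le_D.
have D2 : (2 < D)%N by have /andP[] := le_D i1 ne1.
pose e := @group_enum D; have inj_e : injective e := @group_enum_inj D.
have eP : forall i, reflect (exists j, i = e j) (tnth d i == D) := @group_enumP D.
have de j : tnth d (e j) = D := deg_group eP j.
have ne j : e j != q0 by apply: contraTneq D2 => E; rewrite -(de j) E d0.
have BB := diag_block_sqz char2 smF pX NN sF hA A0 inj_e eP; set C := diag_block p A e in BB.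
have [la laC la0] : exists2 la : 'rV_#|degree_group D|, (la <= kermx C)%MS & la != 0.
  apply/rowV0Pn; rewrite -mxrank_eq0 mxrank_ker subn_eq0 -ltnNge.
  have := sqz_rank BB; have : (0 < #|degree_group D|)%N by apply/card_gt0P; exists i1; rewrite inE.
  by clear; lia.
move/sub_kermxP: laC => laC; case/rV0Pn: la0 => j0 laj0.
pose l j := la 0 j / la 0 j0.
have lC j : \sum_i l i * C i j = 0.
  move/rowP/(_ j): laC; rewrite mxE [RHS]mxE => E.
  transitivity ((la 0 j0)^-1 * \sum_i la 0 i * C i j); last by rewrite E mulr0.
  by rewrite mulr_sumr; apply: eq_bigr => i _; rewrite /l [la 0 i / _]mulrC mulrA.
have De j : Dop N (f (e j)) = \sum_i C j i *: f (e i) + A (e j) q0 * f q0.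
  apply: (diag_block_D p hA eP); rewrite sF (bigD1 q0) //= addrC; congr (_ + _).
  rewrite big_mkcond (sum_group inj_e eP) => [|i ni].
    by apply: eq_bigr => i _; rewrite ne.
  case: eqVneq => // iq; rewrite A0 ?mul0r // de ltn_neqAle eq_sym ni.
  by have /andP[] := le_D i iq.
pose R := \sum_j l j *: A (e j) q0.
pose G := \sum_j l j *: f (e j).
have DZ a q : Dop N (a *: q) = a *: Dop N q by rewrite /Dop pullbackZ scalerBr.
have DG : \sum_j l j *: Dop N (f (e j)) = R * f q0.
  under eq_bigr => j _ do rewrite De scalerDr scalerAl scaler_sumr.
  rewrite big_split /= exchange_big /= big1 ?add0r; last first.
    move=> i _; under eq_bigr => j _ do rewrite scalerA.
    by rewrite -scaler_suml lC scale0r.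
  by rewrite /R mulr_suml.
have sG : pullback (1%:M + N) G = G + R * f q0.
  rewrite -DG /G pullback_sum -big_split; apply: eq_bigr => j _ /=.
  by rewrite pullbackZ /Dop scalerBr addrC subrK.
have sQ : pullback (1%:M + N) (f q0) = f q0 by apply/eqP; rewrite -subr_eq0 -/(Dop N (f q0)) DQ.
have DR : Dop N R = 0.
  have E : pullback (1%:M + N) R * f q0 = R * f q0.
    rewrite -[X in _ * X]sQ -pullbackM; apply/eqP; rewrite -subr_eq0; apply/eqP.
    have -> : R * f q0 = pullback (1%:M + N) G - G by rewrite sG addrC addKr.
    rewrite pullbackB (pullback_invol char2 NN).
    suff E (x y : {mpoly k[n.+1]}) : x - y - (y - x) = 0 by apply: E.
    have -> : x - y - (y - x) = (x + x) - (y + y) by ring.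
    by rewrite !char2_mpoly subr0.
  by apply: (mulIf (form_neq0 smF pX q0)); rewrite mul0r /Dop mulrBl E subrr.
exists (e j0); first by rewrite de.
pose a i := \sum_j (e j == i)%:R * l j.
have ae i : a (e i) = l i.
  rewrite /a (bigD1 i) //= eqxx mul1r big1 ?addr0 // => j /negPf nj.
  by rewrite (inj_eq inj_e) nj mul0r.
have a0 i : tnth d i != D -> a i = 0.
  move=> ni; rewrite /a big1 // => j _; case: eqVneq => [E|_]; rewrite ?mul0r //.
  by rewrite -E de eqxx in ni.
exists N, a, R; split=> //; rewrite de; split=> //.
- apply: rpred_sum => j _; apply: rpredZ; have := @hA (e j) q0; rewrite de d0; apply.
  exact: ltnW.
- by rewrite ae /l divff // a0 // d0; apply: contraTneq D2 => <-.
split=> //; rewrite -DG (sum_group inj_e eP) => [|i ni]; last by rewrite a0 ?scale0r.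
by apply: eq_bigr => j _; rewrite ae.
Qed.
End Blocks.

Section Exceptional.
Variables (k : closedFieldType) (n c : nat) (d : c.-tuple nat).
Hypothesis char2 : 2%N \in [pchar k].
Hypothesis d_ge2 : forall i, (2 <= tnth d i)%N.
Hypothesis c_ge2 : (2 <= c)%N.
Hypothesis c_lt_n : (c < n)%N.
Hypothesis d_neq22 : tval d <> [:: 2; 2]%N.
Implicit Types (F : form_tuple k n d) (L : lin_family k n c).

Definition exceptional_frame F L :=
  (exists (m : 'I_n) (s : {ffun option 'I_m.+1 -> 'I_n.+2}), injective s /\ dependent s F L) \/
  (exists t : 'I_c * 'I_c * 'I_c, [/\ tnth d t.1.1 = 2%N, tnth d t.1.2 = 2%N, (2 < tnth d t.2)%N &
      t.1.1 != t.1.2] /\ pencil_event t.1.1 t.1.2 t.2 F L).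

Lemma thin_conj (P : Prop) (B : form_tuple k n d -> Prop) : (P -> thin B) -> thin (fun F => P /\ B F).
Proof.
case: (excluded_middle_informative P) => [p /(_ p) tB|np _].
  by apply: thin_sub tB => F [].
by exists 1; [apply: oner_neq0|move=> F []].
Qed.

Lemma thin2_conj (P : Prop) (B : form_tuple k n d -> lin_family k n c -> Prop) :
  (P -> thin2 B) -> thin2 (fun F L => P /\ B F L).
Proof.
case: (excluded_middle_informative P) => [p /(_ p) tB|np _].
  by apply: thin2_sub tB => F L [].
by exists 1; [apply: oner_neq0|move=> F L []].
Qed.

Lemma exceptional_frame_thin : thin2 exceptional_frame.
Proof.
apply: thin2U.
  apply: thin2_bigU => m; apply: thin2_bigU => s; apply: thin2_conj => inj_s.
  exact: dependent_thin.
apply: thin2_bigU => t; apply: thin2_conj => -[d0 d0' d1 ne].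
exact: pencil_thin.
Qed.

Definition lowest_degree D := (forall i, (D <= tnth d i)%N) /\ exists i, tnth d i = D.

Lemma lowest_degree_exists : exists D, lowest_degree D.
Proof.
have [i _ le] := arg_minnP (fun i => tnth d i) (isT : predT (Ordinal (ltnW c_ge2))).
by exists (tnth d i); split; [move=> j; apply: (le j isT)|exists i].
Qed.

Variable D : nat.
Hypothesis D_low : lowest_degree D.
Local Notation c1 := #|degree_group d D|.

Definition exceptional_block F := exists rs : 'I_n.+2 * 'I_c.+1,
  block_bound D c1 rs.1 rs.2 /\ block_event (@group_enum _ d D) rs.1 rs.2 F.

Definition exceptional_quadric F := exists t : 'I_n.+2 * 'I_c * 'I_c,
  [/\ (0 < t.1.1)%N, tnth d t.1.2 = 2%N & (2 < tnth d t.2)%N] /\ quadric_event t.1.2 t.2 t.1.1 F.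

Lemma group_size : (0 < c1 <= c)%N.
Proof.
have [_ [i iD]] := D_low; have := max_card (degree_group d D).
rewrite card_ord => ->; rewrite andbT.
by apply/card_gt0P; exists i; rewrite inE iD.
Qed.

(** Two quadrics and no other form is the excluded multidegree. *)
Lemma two_quadrics : D = 2%N -> c1 = 2%N -> (3 <= c)%N.
Proof.
move=> D2 c12; rewrite leqNgt; apply/negP => c3; apply: d_neq22.
have cE : c = 2%N by apply/eqP; rewrite eqn_leq c_ge2 -ltnS c3.
have all2 i : tnth d i = 2%N.
  have E : #|degree_group d D| = #|'I_c| by rewrite c12 card_ord cE.
  have /(_ i) := elimT (subset_cardP E) (subset_predT _).
  by rewrite !inE => /eqP ->.
apply: (@eq_from_nth _ 0%N) => [|i]; first by rewrite size_tuple.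
rewrite size_tuple => lt_i; rewrite -[i]/(val (Ordinal lt_i)) -tnth_nth all2.
by move: lt_i; rewrite cE /=; case: i => [|[]].
Qed.

Lemma exceptional_block_thin : thin exceptional_block.
Proof.
apply: thin_bigU => -[r s]; apply: thin_conj => /= bd.
have /andP[c10 c1c] := group_size; have [leD [i0 i0D]] := D_low.
have dE i : tnth d (@group_enum _ d D i) = D := deg_group (@group_enumP _ d D) i.
have n3 : (3 <= n)%N by clear -c_ge2 c_lt_n; lia.
case: (leqP (r + r) n.+1) => [le_r|nle_r]; last first.
  exists 1; [apply: oner_neq0|move=> F [N [B [NN rN _]]]].
  by move: nle_r; rewrite ltnNge addnn -mul2n -rN sqz_rank.
case: (leqP (2 * s) c1) => [le_s|nle_s]; last first.
  exists 1; [apply: oner_neq0|move=> F [N [B [_ _ BB rB _]]]].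
  by move: nle_s; rewrite ltnNge -rB sqz_rank.
have [||||rho nf num] := @block_num n D c1 r s _ le_r _ _ c10 n3 le_s _ bd.
- by case/andP: bd.
- by rewrite -i0D.
- by clear -c1c c_lt_n; lia.
- by move=> D2 c12; have := two_quadrics D2 c12; clear -c_lt_n; lia.
exact: (block_thin char2 (@group_enum_inj _ d D) dE nf).
Qed.

Lemma exceptional_quadric_thin : thin exceptional_quadric.
Proof.
apply: thin_bigU => -[[r q0] i0]; apply: thin_conj => -[/= r0 d0 di].
exact: quadric_thin.
Qed.

(** When the forms of lowest degree do not exclude h, they are one or two fixed
    quadrics. Two of them, with a point of the frame that N does not kill, give
    [pencil_event]; a single one gives [quadric_event]. *)
Lemma no_involution F L : smooth_complete_intersection F -> ~ exceptional_frame F L ->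
  ~ exceptional_block F -> ~ exceptional_quadric F ->
  ~ exists h : 'M[k]_n.+1, linear_automorphism F h /\ induced_order F h 2.
Proof.
move=> smF nfr nbl nqu [h [hF h2]].
have d_gt0 i : (0 < tnth d i)%N by apply: ltnW.
have indep m (s : option 'I_m.+1 -> 'I_n.+2) : injective s -> (m < n)%N -> ~ dependent s F L.
  move=> inj_s lt_m [x [a [dx a0 xF]]]; apply: nfr; left; exists (Ordinal lt_m), (finfun s); split.
    by move=> o o'; rewrite !ffunE; apply: inj_s.
  by exists x, a; split=> // r; rewrite ffunE.
have c_le_n := ltnW c_lt_n.
have [N [A [NN N0 sF hA A0]]] := involution_normal_form char2 d_gt0 c_le_n indep hF h2.
have /fin_all_exists2[p p0 pX] := section_point F d_gt0 c_le_n L.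
have ptX j : point_of F (p j) by split=> // i; have [Fp _] := pX j; apply: Fp.
have r0 : (0 < \rank N)%N by rewrite lt0n mxrank_eq0.
have rn : (\rank N < n.+2)%N by rewrite ltnS rank_leq_row.
have [leD [i1 i1D]] := D_low.
pose e := @group_enum _ d D; have inj_e : injective e := @group_enum_inj _ d D.
have eP := @group_enumP _ d D.
have BB := diag_block_sqz char2 smF (ptX ord0) NN sF hA A0 inj_e eP.
have := lowest_block (p ord0) sF hA A0 leD.
set B := diag_block _ _ _ in BB *; move=> DB.
have sB : (2 * \rank B <= c1)%N := sqz_rank BB.
have /andP[c10 c1c] := group_size.
have sc : (\rank B < c.+1)%N by move: sB c1c; clear; lia.
case bd: (block_bound D c1 (\rank N) (\rank B)).
  by apply: nbl; exists (Ordinal rn, Ordinal sc); split=> //; exists N, B.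
move: bd; rewrite /block_bound r0 /= => /negbT; rewrite !negb_or -!leqNgt => /and3P[D2 c12 c1s].
have {D2}ED : D = 2%N by apply/eqP; rewrite eqn_leq D2 -i1D d_ge2.
have {c1s}rB : \rank B = 0%N.
  apply/eqP; rewrite -leqn0 leqNgt; apply: contra c1s => s0; rewrite s0 andbT.
  by apply/eqP; move: c12 sB s0; clear; lia.
have DQ i : tnth d i = 2%N -> Dop N (F i) = 0.
  move/eqP; rewrite -ED => /eP[j ->]; rewrite DB big1 // => l _.
  by move/eqP: rB; rewrite mxrank_eq0 => /eqP ->; rewrite mxE scale0r.
have gt2 i : tnth d i != 2%N -> (2 < tnth d i)%N by move=> di; rewrite ltn_neqAle eq_sym di d_ge2.
case: (ltnP 1 c1) => c1_1.
  have c12' : c1 = 2%N by apply/eqP; rewrite eqn_leq c12.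
  have c3 := two_quadrics ED c12'.
  have /card_gt1P[x [y [xD yD nxy]]] := c1_1.
  have [z zD] : exists z, z \notin degree_group d D.
    apply/existsP; rewrite -negb_forall; apply: contraTN c3 => /forallP H.
    have : (#|'I_c| <= c1)%N by apply: subset_leq_card; apply/subsetP => i _; apply: H.
    by rewrite card_ord c12' -leqNgt.
  have [j Npj] : exists j, N *m p j != 0.
    apply/existsP; rewrite -negb_forall; apply: contraNN N0 => /forallP H.
    by apply/eqP/(frame_span indep p0 pX) => j; apply/eqP; apply: H.
  apply: nfr; right; exists (x, y, z); rewrite !inE ED in xD yD zD; split=> /=.
    by split=> //; [apply/eqP|apply/eqP|apply: gt2].
  exists N, j, (p j); split=> //; last exact: (ev_moved (ptX j) sF).
  by split; apply: DQ; apply/eqP.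
have q0D : tnth d i1 = 2%N by rewrite i1D ED.
have one i : i != i1 -> (2 < tnth d i)%N.
  move=> ni; apply: gt2; apply: contraNneq ni => di.
  have /card_le1P/(_ i1) := c1_1; rewrite inE i1D eqxx => /(_ isT i).
  by rewrite !inE di ED eqxx => /esym.
have [i2 ni2] : exists i2, i2 != i1.
  have /card_gt1P[x [y [_ _ nxy]]] : (1 < #|'I_c|)%N by rewrite card_ord.
  by case: (eqVneq x i1) => [xi|]; [exists y; rewrite eq_sym -xi|exists x].
have [i3 ni3 le3] := @arg_minnP _ i2 (fun i => i != i1) (fun i => tnth d i) ni2.
have [|i0 di0 ev] := second_block_event char2 smF (ptX ord0) NN sF hA A0 q0D (DQ _ q0D) ni3.
  by move=> i ni; rewrite one // le3.
by apply: nqu; exists (Ordinal rn, i1, i0).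
Qed.
End Exceptional.

Theorem theorem1p5 (k : closedFieldType) (n c : nat) (d : c.-tuple nat)
    (char2 : (2%N \in [pchar k])%R)
    (d_ge2 : forall i : 'I_c, (2 <= tnth d i)%N)
    (d_sorted : sorted leq d)
    (c_ge2 : (2 <= c)%N)
    (dim_ge1 : (c + 1 <= n)%N)
    (d_neq22 : tval d <> [:: 2; 2]%N) :
  exists U : form_tuple k n d -> Prop,
    zariski_open U /\
    (exists F : form_tuple k n d, U F) /\
    forall F : form_tuple k n d, U F ->
      smooth_complete_intersection F /\
      ~ exists h : 'M[k]_n.+1,
          linear_automorphism F h /\ induced_order F h 2.
Proof.
have c_lt_n : (c < n)%N by rewrite -addn1.
have d_gt0 i : (0 < tnth d i)%N by apply: ltnW.
have [D D_low] := lowest_degree_exists d c_ge2.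
have [L thL] := thin2_specialize (exceptional_frame_thin (k := k) char2 d_ge2 c_lt_n).
have [P P0 PB] := thinU (@singular_thin k n c d d_gt0) (thinU thL
  (thinU (exceptional_block_thin (k := k) char2 d_ge2 c_ge2 c_lt_n d_neq22 D_low)
         (exceptional_quadric_thin (k := k) d char2 c_ge2 c_lt_n))).
exists (fun F => coef_eval F P <> 0); split; last split.
- exists (fun F => coef_eval F P = 0) => [|F]; last by [].
  by exists (fun Q => Q = P) => F; split=> [E Q ->|H]; [|apply: H].
- have [y Py] := mpoly_nonzero_point P0.
  pose G i : {mpoly k[n.+1]} :=
    \sum_(m : mon n.+1 (tnth d i)) y (enum_rank (existT _ i m : coef_index n d)) *: 'X_[mon_val m].
  have hG i : G i \is (tnth d i).-homog.
    by apply: rpred_sum => m _; apply: rpredZ; rewrite dhomogX /= mon_valK.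
  exists (fun i => DHomog (hG i)); apply/eqP; rewrite (_ : coef_eval _ _ = P.@[y]) //.
  apply: meval_eq => j; rewrite /form_coef /=; case Ej: (enum_val j) => [i m] /=.
  rewrite /G raddf_sum (bigD1 m) //= big1 ?addr0 => [|m' /negPf ne].
    by rewrite mcoeffZ mcoeffX eqxx mulr1 -Ej enum_valK.
  by rewrite mcoeffZ mcoeffX (inj_eq (@mon_val_inj _ _)) ne mulr0.
move=> F UF; have smF : smooth_complete_intersection F.
  by apply: NNPP => ns; apply: UF; apply: PB; left.
split=> //; apply: (no_involution (L := L) char2 d_ge2 c_ge2 c_lt_n d_neq22 D_low smF).
- by move=> B; apply: UF; apply: PB; right; left.
- by move=> B; apply: UF; apply: PB; right; right; left.
- by move=> B; apply: UF; apply: PB; right; right; right.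
Qed.
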